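(* There exists $K_0$ such that for every even integer $k \geq K_0$ and every integer $m$ with $1\leq m \leq \frac{(k-1)^2}{16\pi^2}$ one has $v_\infty\left(P_{k,m,1}\right) = 1$; in particular $P_{k,m,1}\not\equiv 0$.
   Context: For positive integers $k,m,N$ with $k$ even, $P_{k,m,N}$ denotes the Poincaré series of weight $k$ and index $m$ at the cusp $i\infty$ for $\Gamma_0(N)=\{\begin{pmatrix}a&b\\c&d\end{pmatrix}\in \mathrm{SL}_2(\mathbb{Z}) : N\mid c\}$: $$P_{k,m,N}(z)=\sum_{\gamma\in\Gamma_\infty\backslash\Gamma_0(N)} j(\gamma,z)^{-k} e(m\gamma z),$$ where $\Gamma_\infty=\{\begin{pmatrix}1&*\\0&1\end{pmatrix}\in\mathrm{SL}_2(\mathbb{Z})\}$, $j(\begin{pmatrix}a&b\\c&d\end{pmatrix},z)=cz+d$ and $e(z)=e^{2\pi i z}$. It has a Fourier expansion $P_{k,m,N}(z)=\sum_{n\geq1} p_{k,N}(m;n)e(nz)$, and $v_\infty(f)$ denotes the order of vanishing of $f$ at the cusp $i\infty$, i.e. the least $n\ge 1$ with nonzero $n$-th Fourier coefficient. *)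

(* Defs.v *)
From Stdlib Require Import Reals ZArith Lia ClassicalEpsilon.
From Coquelicot Require Import Coquelicot.
Open Scope R_scope.

Definition cexp2pi (z : C) : C :=
  (exp (-(2*PI*Im z)) * cos (2*PI*Re z), exp (-(2*PI*Im z)) * sin (2*PI*Re z)).

Fixpoint Csum (f : nat -> C) (n : nat) : C :=
  match n with O => RtoC 0 | S n' => Cplus (Csum f n') (f n') end.

(* A top row (a,b) with a d - b c = 1 (chosen by choice; exists iff gcd(c,d)=1).
   The coset Gamma_infty gamma of gamma = [[a,b],[c,d]] in Gamma_infty\SL2(Z)
   is determined by (c,d); the summand below does not depend on the choice. *)
Definition top_row (c d : Z) : Z * Z :=
  epsilon (inhabits (0%Z, 0%Z)) (fun ab => (fst ab * d - snd ab * c = 1)%Z).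

Definition poinc_term (k m : nat) (c d : Z) (z : C) : C :=
  let a := fst (top_row c d) in let b := snd (top_row c d) in
  let j := Cplus (Cmult (IZR c) z) (IZR d) in
  Cmult (Cinv (Cpow j k))
        (cexp2pi (Cmult (INR m) (Cdiv (Cplus (Cmult (IZR a) z) (IZR b)) j))).

Definition bottom_row_ok (N : nat) (c d : Z) : bool :=
  (Z.eqb (Z.gcd c d) 1 && Z.eqb (Z.modulo c (Z.of_nat N)) 0)%bool.

Definition poinc_partial (k m N M : nat) (z : C) : C :=
  Csum (fun i => Csum (fun j =>
     let c := (Z.of_nat i - Z.of_nat M)%Z in
     let d := (Z.of_nat j - Z.of_nat M)%Z in
     if bottom_row_ok N c d then poinc_term k m c d z else RtoC 0)
   (2*M+1)) (2*M+1).

(* P_{k,m,N}(z) = limit of the (absolutely convergent for k > 2) series *)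
Definition Poincare (k m N : nat) (z : C) : C :=
  (real (Lim_seq (fun M => Re (poinc_partial k m N M z))),
   real (Lim_seq (fun M => Im (poinc_partial k m N M z)))).

Definition fourier_coef (f : C -> C) (n : nat) : C :=
  let g := fun x : R => Cmult (f (x, 1)) (cexp2pi (Cmult (-(INR n)) (x, 1))) in
  (RInt (fun x => Re (g x)) 0 1, RInt (fun x => Im (g x)) 0 1).

Definition vinfty_is (f : C -> C) (n : nat) : Prop :=
  (1 <= n)%nat /\ fourier_coef f n <> RtoC 0 /\
  forall j : nat, (1 <= j < n)%nat -> fourier_coef f j = RtoC 0.

(* Main.v *)
(* With nu = k - 1, the first coefficient is p(m;1) = 2 (delta_{m,1} + J sum_c S(c) c^{-k} Phi(t/c^2)), where
   t = 4 pi^2 m, |S(c)| <= c, S(1) = 1, Phi(t) = sum_j (-t)^j / (j! (nu+1)...(nu+j)) is the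
   normalized Bessel function, and J is the integral of w^{-k} e(-w) over the line Im w = 1.
   The hypothesis says t <= nu^2/4.  There Phi is the minimal solution of its three-term recurrence in nu,
   consecutive ratios stay above 1/2, and this forces exp(-5 nu/8) <= Phi(t) and |Phi(t/c^2)| <= 1.
   The terms c >= 2 add up to at most 4/2^nu, which is smaller than exp(-5 nu/8), so the term c = 1 dominates
   them.  Only two facts about J are needed: it is nonzero, which settles m >= 2, and it tends
   to 0 as k grows, which settles m = 1.  Both follow from J_{s+1} = -(2 pi i / s) J_s (integration by parts)
   and from J_8 <> 0, which is a direct estimate. *)

Require Import Defs.
From Stdlib Require Import Reals Arith ZArith Lra Lia Classical ClassicalEpsilon Znumtheory.
From Coquelicot Require Import Coquelicot.
Open Scope R_scope.

(** * The Bessel series *)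

(** The threshold on m is exactly what the recurrence can bear: 4t <= nu^2 makes 2t/((n+1)(n+2)) at
    most 1/2 for every n >= nu, so a ratio bound of 1/2 reproduces itself downwards from infinity,
    where the normalized functions tend to 1. The resulting loss exp(-5 nu/8) is affordable because
    exp(5/8) < 2, while the trivial bound for S(c) leaves c^(-nu), whose sum over c >= 2 is of size
    2^(-nu). By residues J_s = (-2 pi i)^s/(s-1)!; working only with the recurrence and one non-zero
    value keeps contour integration out of the proof. The analytic obstacle is the order of
    summation. The series is a limit over squares |c|, |d| <= M, whereas Bessel functions appear
    only after summing over all d for fixed c. A majorant proportional to 1/((1+c^2)(1+d^2)) on the
    segment Im z = 1, 0 <= Re z <= 1 settles this: it gives uniform convergence, hence the exchange
    of limit and integral, and then a Tannery argument for the sum over c. *)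

(** The series is n! t^(-n/2) J_n(2 sqrt t) for the usual Bessel function J_n. The factor n! makes
    it tend to 1 as n grows with t fixed. *)
Definition bessel_term (n : nat) (t : R) (j : nat) : R :=
  INR (fact n) / (INR (fact j) * INR (fact (n + j))) * (- t) ^ j.

Definition bessel_series (n : nat) (t : R) : R := Series (bessel_term n t).

Lemma INR_fact_pos (n : nat) : 0 < INR (fact n).
Proof. apply INR_fact_lt_0. Qed.

Lemma INR_fact_S (n : nat) : INR (fact (S n)) = (INR n + 1) * INR (fact n).
Proof. rewrite fact_simpl, mult_INR, S_INR; ring. Qed.

Lemma fact_ratio_le (n j : nat) : INR (fact n) / INR (fact (n + S j)) <= / (INR n + 1).
Proof.
  pose proof (INR_fact_pos n) as Hn. pose proof (pos_INR n) as Hp.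
  assert (H : INR (fact (S n)) <= INR (fact (n + S j))).
  { apply le_INR, fact_le. lia. }
  rewrite INR_fact_S in H.
  assert (H0 : 0 < (INR n + 1) * INR (fact n)) by (apply Rmult_lt_0_compat; lra).
  apply Rle_trans with (INR (fact n) / ((INR n + 1) * INR (fact n))).
  - apply Rmult_le_compat_l; [lra|]. apply Rinv_le_contravar; lra.
  - right. field. lra.
Qed.

Lemma fact_ratio_le_1 (n j : nat) : INR (fact n) / INR (fact (n + j)) <= 1.
Proof.
  pose proof (INR_fact_pos n) as Hn.
  assert (H : INR (fact n) <= INR (fact (n + j))) by (apply le_INR, fact_le; lia).
  apply Rmult_le_reg_r with (INR (fact (n + j))); [lra|].
  field_simplify; lra.
Qed.

Lemma bessel_term_bound (n : nat) (t : R) (j : nat) :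
  0 <= t -> Rabs (bessel_term n t j) <= / INR (fact j) * t ^ j.
Proof.
  intros Ht. unfold bessel_term.
  rewrite Rabs_mult, <- RPow_abs, Rabs_Ropp, (Rabs_pos_eq t) by lra.
  apply Rmult_le_compat_r; [now apply pow_le|].
  pose proof (INR_fact_pos n). pose proof (INR_fact_pos j).
  pose proof (INR_fact_pos (n + j)). pose proof (fact_ratio_le_1 n j).
  rewrite Rabs_pos_eq.
  - replace (INR (fact n) / (INR (fact j) * INR (fact (n + j)))) with
      (/ INR (fact j) * (INR (fact n) / INR (fact (n + j)))) by (field; lra).
    rewrite <- (Rmult_1_r (/ INR (fact j))) at 2.
    apply Rmult_le_compat_l; [left; now apply Rinv_0_lt_compat|easy].
  - left. apply Rdiv_lt_0_compat; [easy|]. now apply Rmult_lt_0_compat.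
Qed.

Lemma is_series_exp (t : R) : is_series (fun j => / INR (fact j) * t ^ j) (exp t).
Proof.
  generalize (is_exp_Reals t). unfold is_pseries.
  apply is_series_ext. intros n. rewrite pow_n_pow.
  change (t ^ n * / INR (fact n) = / INR (fact n) * t ^ n). ring.
Qed.

Lemma ex_bessel (n : nat) (t : R) : 0 <= t -> ex_series (bessel_term n t).
Proof.
  intros Ht. apply (ex_series_le (K := R_AbsRing) (V := R_CompleteNormedModule))
    with (fun j => / INR (fact j) * t ^ j).
  - intros j. now apply bessel_term_bound.
  - eexists. apply is_series_exp.
Qed.

Lemma bessel_term_0 (n : nat) (t : R) : bessel_term n t 0 = 1.
Proof.
  unfold bessel_term. rewrite Nat.add_0_r. pose proof (INR_fact_pos n).
  simpl. field. lra.
Qed.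

(** This is the recurrence J_n + J_(n+2) = ((n+1)/sqrt t) J_(n+1) at argument 2 sqrt t, after
    normalization. It holds coefficientwise: term j+1 at orders n and n+1 differs by term j at order
    n+2. *)
Lemma bessel_recurrence (n : nat) (t : R) : 0 <= t ->
  bessel_series n t =
  bessel_series (S n) t - t / ((INR n + 1) * (INR n + 2)) * bessel_series (S (S n)) t.
Proof.
  intros Ht. unfold bessel_series.
  pose proof (pos_INR n) as Hp.
  rewrite (Series_incr_1 (bessel_term n t)) by now apply ex_bessel.
  rewrite (Series_incr_1 (bessel_term (S n) t)) by now apply ex_bessel.
  rewrite <- Series_scal_l.
  assert (E : forall j, bessel_term n t (S j) =
    bessel_term (S n) t (S j) -
    t / ((INR n + 1) * (INR n + 2)) * bessel_term (S (S n)) t j).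
  { intros j. unfold bessel_term.
    replace (S n + S j)%nat with (S (S (n + j))) by lia.
    replace (n + S j)%nat with (S (n + j)) by lia.
    replace (S (S n) + j)%nat with (S (S (n + j))) by lia.
    rewrite !INR_fact_S, !S_INR, !plus_INR. simpl pow.
    pose proof (INR_fact_pos n). pose proof (INR_fact_pos j).
    pose proof (INR_fact_pos (n + j)). pose proof (pos_INR j).
    field. repeat split; lra. }
  rewrite (Series_ext _ _ E), Series_minus.
  - rewrite !bessel_term_0. ring.
  - apply -> (ex_series_incr_1 (bessel_term (S n) t)). now apply ex_bessel.
  - apply (ex_series_scal_l (t / ((INR n + 1) * (INR n + 2))) (bessel_term (S (S n)) t)).
    now apply ex_bessel.
Qed.

(** Every term after the first carries n!/(n+j)! <= 1/(n+1), and what is left is a tail of the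
    series of exp t. *)
Lemma bessel_near_1 (n : nat) (t : R) : 0 <= t ->
  Rabs (bessel_series n t - 1) <= exp t / (INR n + 1).
Proof.
  intros Ht. unfold bessel_series.
  pose proof (pos_INR n) as Hp. pose proof (INR_fact_pos n) as Hn.
  rewrite (Series_incr_1 (bessel_term n t)) by now apply ex_bessel.
  rewrite bessel_term_0. replace (1 + _ - 1) with (Series (fun k => bessel_term n t (S k))) by ring.
  assert (E1 : ex_series (fun j => / INR (fact (S j)) * t ^ S j)).
  { apply -> (ex_series_incr_1 (fun j => / INR (fact j) * t ^ j)).
    eexists; apply is_series_exp. }
  assert (B : forall j, 0 <= Rabs (bessel_term n t (S j)) <=
      / (INR n + 1) * (/ INR (fact (S j)) * t ^ S j)).
  { intros j. split; [apply Rabs_pos|]. unfold bessel_term.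
    rewrite Rabs_mult, <- RPow_abs, Rabs_Ropp, (Rabs_pos_eq t) by lra.
    rewrite <- Rmult_assoc.
    apply Rmult_le_compat_r; [now apply pow_le|].
    pose proof (INR_fact_pos (S j)).
    pose proof (INR_fact_pos (n + S j)). pose proof (fact_ratio_le n j).
    rewrite Rabs_pos_eq.
    - replace (INR (fact n) / (INR (fact (S j)) * INR (fact (n + S j)))) with
        (INR (fact n) / INR (fact (n + S j)) * / INR (fact (S j))) by (field; lra).
      apply Rmult_le_compat_r; [left; now apply Rinv_0_lt_compat|easy].
    - left. apply Rdiv_lt_0_compat; [easy|]. now apply Rmult_lt_0_compat. }
  assert (E2 : ex_series (fun j => / (INR n + 1) * (/ INR (fact (S j)) * t ^ S j))).
  { now apply (ex_series_scal_l (/ (INR n + 1)) (fun j => / INR (fact (S j)) * t ^ S j)). }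
  eapply Rle_trans; [apply Series_Rabs|].
  { apply (ex_series_le (K := R_AbsRing) (V := R_CompleteNormedModule))
      with (2 := E2). intros j. change (norm ?x) with (Rabs x).
    rewrite Rabs_Rabsolu. apply B. }
  eapply Rle_trans; [apply Series_le; [exact B|exact E2]|].
  rewrite Series_scal_l. unfold Rdiv. rewrite Rmult_comm.
  apply Rmult_le_compat_r; [left; apply Rinv_0_lt_compat; lra|].
  rewrite <- (is_series_unique _ _ (is_series_exp t)).
  rewrite (Series_incr_1 (fun j => / INR (fact j) * t ^ j)) by (eexists; apply is_series_exp).
  simpl. lra.
Qed.

Lemma bessel_lim (t : R) : 0 <= t -> is_lim_seq (fun n => bessel_series n t) 1.
Proof.
  intros Ht.
  apply is_lim_seq_ext with (fun n => (bessel_series n t - 1) + 1); [intros; ring|].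
  replace (Finite 1) with (Rbar_plus 0 1) by (simpl; f_equal; ring).
  apply is_lim_seq_plus'; [|apply is_lim_seq_const].
  apply is_lim_seq_abs_0.
  apply is_lim_seq_le_le with (fun _ => 0) (fun n => exp t * / (INR n + 1)).
  - intros n. split; [apply Rabs_pos|now apply bessel_near_1].
  - apply is_lim_seq_const.
  - replace (Finite 0) with (Rbar_mult (exp t) 0) by (simpl; f_equal; ring).
    apply is_lim_seq_scal_l.
    apply is_lim_seq_ext with (fun n => / INR (S n)).
    { intros n. now rewrite S_INR. }
    replace (Finite 0) with (Rbar_inv p_infty) by easy.
    apply is_lim_seq_inv; [|easy].
    apply (is_lim_seq_incr_1 INR), is_lim_seq_INR.
Qed.

Lemma exp_monotone (x y : R) : x <= y -> exp x <= exp y.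
Proof.
  intros [H| ->]; [left; now apply exp_increasing|lra].
Qed.

(** With the exponent written as -2y, it suffices that (1+y)^2 (1-x) >= 1, where the linear terms in
    x cancel. Halving the exponent matters: the cruder 1+2y <= exp(2y) would fail near x = 1/2. *)
Lemma exp_le_one_minus (x : R) : 0 <= x <= 1 / 2 -> exp (- x - 3 / 2 * x ^ 2) <= 1 - x.
Proof.
  intros Hx. set (y := x / 2 + 3 / 4 * x ^ 2).
  assert (Hy : 0 <= y) by (unfold y; nra).
  assert (H : 1 + y <= exp y) by apply exp_ineq1_le.
  replace (- x - 3 / 2 * x ^ 2) with (- (y + y)) by (unfold y; field).
  rewrite exp_Ropp, exp_plus.
  assert (H1 : (1 + y) * (1 + y) <= exp y * exp y) by (apply Rmult_le_compat; lra).
  assert (H2 : 1 <= (1 + y) * (1 + y) * (1 - x)).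
  { apply Rminus_le_0. unfold y.
    replace (_ - _) with (x ^ 2 * (3 / 4 - x - 3 / 16 * x ^ 2 - 9 / 16 * x ^ 3)) by field.
    apply Rmult_le_pos; [apply pow2_ge_0|].
    assert (x ^ 2 <= (1 / 2) ^ 2) by (apply pow_incr; lra).
    assert (x ^ 3 <= (1 / 2) ^ 3) by (apply pow_incr; lra).
    lra. }
  apply Rle_trans with (/ ((1 + y) * (1 + y))).
  - apply Rinv_le_contravar; nra.
  - apply Rmult_le_reg_l with ((1 + y) * (1 + y)); [nra|].
    rewrite Rinv_r by nra. easy.
Qed.

(** * Descent from infinity along a three-term recurrence *)

Section MinimalSolution.

Variables (phi : nat -> R) (t : R) (n0 : nat).
Hypothesis Ht : 0 <= t.
Hypothesis Hn0 : 4 * t <= INR n0 ^ 2.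
Hypothesis Hrec : forall n,
  phi n = phi (S n) - t / ((INR n + 1) * (INR n + 2)) * phi (S (S n)).
Hypothesis Hlim : is_lim_seq phi 1.

(** Twice the coefficient of the recurrence: once phi (n+2) <= 2 phi (n+1) is known, the subtracted
    term is at most x n * phi (n+1). *)
Let x (n : nat) := 2 * t / ((INR n + 1) * (INR n + 2)).

Lemma x_bound (n : nat) : (n0 <= n)%nat -> 0 <= x n <= 1 / 2.
Proof.
  intros Hn. apply le_INR in Hn. pose proof (pos_INR n0). unfold x.
  assert (0 < (INR n + 1) * (INR n + 2)) by nra.
  split.
  - apply Rmult_le_pos; [lra|]. left. now apply Rinv_0_lt_compat.
  - apply Rmult_le_reg_r with ((INR n + 1) * (INR n + 2)); [easy|].
    unfold Rdiv. rewrite Rmult_assoc, Rinv_l by lra.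
    assert (INR n0 ^ 2 <= (INR n + 1) * (INR n + 2)) by nra. lra.
Qed.

Lemma phi_step (n : nat) : (n0 <= n)%nat ->
  0 < phi (S (S n)) <= 2 * phi (S n) ->
  (1 - x n) * phi (S n) <= phi n <= phi (S n).
Proof.
  intros Hn [H1 H2]. pose proof (x_bound n Hn) as Hx.
  rewrite (Hrec n).
  replace (t / ((INR n + 1) * (INR n + 2))) with (x n / 2).
  - nra.
  - unfold x. field. pose proof (pos_INR n). split; lra.
Qed.

(** Far out phi is close to 1, so consecutive ratios are close to 1 as well. Going down, [phi_step]
    keeps phi n >= (1 - x n) phi (n+1) with x n <= 1/2, which is the same ratio bound one index
    lower. *)
Lemma phi_ratio (n : nat) : (n0 <= n)%nat -> 0 < phi (S n) <= 2 * phi n.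
Proof.
  assert (He : exists N, forall m, (N <= m)%nat -> 3 / 4 < phi m < 5 / 4).
  { apply is_lim_seq_spec in Hlim. destruct (Hlim (mkposreal (1/4) ltac:(lra))) as [N HN].
    exists N. intros m Hm. specialize (HN m Hm). simpl in HN.
    apply Rabs_def2 in HN. lra. }
  destruct He as [N HN]. intros Hn.
  (* Downward induction: [i] bounds the distance from m up to N. Beyond N the values lie in (3/4,
     5/4), and 5/4 <= 2 * 3/4. *)
  assert (H : forall i m, (n0 <= m)%nat -> (N <= m + i)%nat -> 0 < phi (S m) <= 2 * phi m).
  { induction i as [|i IH]; intros m Hm Hi.
    - pose proof (HN m ltac:(lia)). pose proof (HN (S m) ltac:(lia)). lra.
    - destruct (IH (S m) ltac:(lia) ltac:(lia)) as [H1 H2].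
      pose proof (phi_step m Hm (conj H1 H2)). pose proof (x_bound m Hm). nra. }
  apply (H N n); lia.
Qed.

(** The sequence is nondecreasing from n0 on, so it stays below its limit. *)
Lemma phi_le_1 (n : nat) : (n0 <= n)%nat -> phi n <= 1.
Proof.
  intros Hn.
  apply (is_lim_seq_le (fun _ => phi n) (fun i => phi (i + n)%nat) (phi n) 1).
  - intros i; induction i as [|i IH]; [simpl; lra|].
    pose proof (phi_step (i + n) ltac:(lia) (phi_ratio (S (i + n)) ltac:(lia))).
    simpl. lra.
  - apply is_lim_seq_const.
  - now apply is_lim_seq_incr_n.
Qed.

(* The exponent telescopes the bounds [1 - x >= exp (- x - 3/2 x^2)]. *)
Let e (n : nat) := 2 * t / (INR n + 1) + (2 * t) ^ 2 / (2 * (INR n + 1) ^ 3).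

Lemma e_step (n : nat) : (n0 <= n)%nat -> x n + 3 / 2 * x n ^ 2 <= e n - e (S n).
Proof.
  intros Hn. unfold x, e. rewrite S_INR. pose proof (pos_INR n) as Hp.
  set (y := INR n + 1). replace (INR n + 2) with (y + 1) by (unfold y; ring).
  assert (Hy : 1 <= y) by (unfold y; lra).
  apply Rminus_le_0.
  (* The linear part telescopes exactly. For the quadratic part, 1/y^3 - 1/(y+1)^3 has numerator
     3y(y+1) + 1 over y^3 (y+1)^3, and only the 1 survives here. *)
  replace (_ - _) with ((2 * t) ^ 2 * / (2 * y ^ 3 * (y + 1) ^ 3)) by (field; lra).
  apply Rmult_le_pos; [apply pow2_ge_0|]. left. apply Rinv_0_lt_compat.
  apply Rmult_lt_0_compat; [apply Rmult_lt_0_compat; [lra|]|]; apply pow_lt; lra.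
Qed.

(** The product phi n * exp (e n) is nonincreasing in n. Since e >= 0, it dominates phi at every
    later index, and those values tend to 1. *)
Lemma phi_lower (n : nat) : (n0 <= n)%nat -> 1 <= phi n * exp (e n).
Proof.
  intros Hn.
  assert (Hs : forall m, (n0 <= m)%nat ->
    phi (S m) * exp (e (S m)) <= phi m * exp (e m)).
  { intros m Hm.
    pose proof (phi_ratio m Hm) as [H0 _].
    destruct (phi_step m Hm (phi_ratio (S m) ltac:(lia))) as [H1 _].
    pose proof (exp_le_one_minus (x m) (x_bound m Hm)) as H2.
    pose proof (e_step m Hm) as H3.
    apply Rle_trans with ((exp (- x m - 3 / 2 * x m ^ 2) * phi (S m)) * exp (e m)).
    - replace (exp (- x m - 3 / 2 * x m ^ 2) * phi (S m) * exp (e m)) with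
        (phi (S m) * (exp (e m) * exp (- x m - 3 / 2 * x m ^ 2))) by ring.
      rewrite <- exp_plus. apply Rmult_le_compat_l; [lra|]. apply exp_monotone. lra.
    - apply Rmult_le_compat_r; [left; apply exp_pos|].
      apply Rle_trans with (2 := H1). apply Rmult_le_compat_r; lra. }
  apply (is_lim_seq_le (fun i => phi (i + n)%nat) (fun _ => phi n * exp (e n)) 1
    (phi n * exp (e n))).
  - intros i. apply Rle_trans with (phi (i + n)%nat * exp (e (i + n)%nat)).
    + pose proof (phi_ratio (i + n) ltac:(lia)).
      assert (0 <= e (i + n)%nat).
      { unfold e. pose proof (pos_INR (i + n)).
        apply Rplus_le_le_0_compat; apply Rmult_le_pos; try nra;
        left; apply Rinv_0_lt_compat; [lra|].
        apply Rmult_lt_0_compat; [lra|]. apply pow_lt; lra. }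
      pose proof (exp_ineq1_le (e (i + n)%nat)). nra.
    + induction i as [|i IH]; [simpl; lra|].
      eapply Rle_trans; [|exact IH]. apply Hs. lia.
  - now apply is_lim_seq_incr_n.
  - apply is_lim_seq_const.
Qed.

Lemma phi_lower_exp : exp (- (5 / 8 * INR n0)) <= phi n0.
Proof.
  pose proof (phi_lower n0 (Nat.le_refl _)) as H.
  pose proof (pos_INR n0) as Hp.
  (* 5/8 = 1/2 + 1/8: inserting 2t <= n0^2/2, the two summands of e are at most n0/2 and n0/8. *)
  assert (He : e n0 <= 5 / 8 * INR n0).
  { unfold e. set (y := INR n0) in *.
    assert (H1 : 2 * t / (y + 1) <= y / 2).
    { apply Rmult_le_reg_r with (y + 1); [lra|]. unfold Rdiv at 1.
      rewrite Rmult_assoc, Rinv_l by lra. nra. }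
    assert (H2 : (2 * t) ^ 2 / (2 * (y + 1) ^ 3) <= y / 8).
    { assert (0 < (y + 1) ^ 3) by (apply pow_lt; lra).
      apply Rmult_le_reg_r with (2 * (y + 1) ^ 3); [lra|]. unfold Rdiv at 1.
      rewrite Rmult_assoc, Rinv_l by lra.
      assert ((2 * t) ^ 2 <= (y ^ 2 / 2) ^ 2) by (apply pow_incr; lra).
      assert (y ^ 3 <= (y + 1) ^ 3) by (apply pow_incr; lra).
      replace (y / 8 * (2 * (y + 1) ^ 3)) with (y / 4 * (y + 1) ^ 3) by field.
      assert (y / 4 * y ^ 3 <= y / 4 * (y + 1) ^ 3) by (apply Rmult_le_compat_l; lra).
      replace ((y ^ 2 / 2) ^ 2) with (y / 4 * y ^ 3) in * by field.
      lra. }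
    lra. }
  rewrite exp_Ropp.
  apply Rmult_le_reg_r with (exp (5 / 8 * INR n0)); [apply exp_pos|].
  rewrite Rinv_l by (apply Rgt_not_eq, exp_pos).
  pose proof (phi_ratio n0 (Nat.le_refl _)).
  eapply Rle_trans; [exact H|]. apply Rmult_le_compat_l; [lra|]. now apply exp_monotone.
Qed.

End MinimalSolution.

Lemma bessel_series_lower (n : nat) (t : R) : 0 <= t -> 4 * t <= INR n ^ 2 ->
  exp (- (5 / 8 * INR n)) <= bessel_series n t.
Proof.
  intros Ht Hn. apply (phi_lower_exp (fun i => bessel_series i t) t n Ht Hn).
  - intros i. now apply bessel_recurrence.
  - now apply bessel_lim.
Qed.

Lemma bessel_series_upper (n : nat) (t : R) : 0 <= t -> 4 * t <= INR n ^ 2 ->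
  Rabs (bessel_series n t) <= 1.
Proof.
  intros Ht Hn. rewrite Rabs_pos_eq.
  - apply (phi_le_1 (fun i => bessel_series i t) t n Ht Hn).
    + intros i. now apply bessel_recurrence.
    + now apply bessel_lim.
    + easy.
  - eapply Rle_trans; [left; apply exp_pos|]. now apply bessel_series_lower.
Qed.

(** * Componentwise calculus for functions from R to C *)

Definition Ccont (f : R -> C) : Prop :=
  (forall x, continuous (fun u => Re (f u)) x) /\
  (forall x, continuous (fun u => Im (f u)) x).

Definition Cder (f : R -> C) (x : R) (l : C) : Prop :=
  is_derive (fun u => Re (f u)) x (Re l) /\ is_derive (fun u => Im (f u)) x (Im l).

(** Same shape as [fourier_coef], so that the coefficients are instances of it and all calculus
    reduces to real [RInt]. *)
Definition Cint (f : R -> C) (a b : R) : C :=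
  (RInt (fun x => Re (f x)) a b, RInt (fun x => Im (f x)) a b).

Lemma Cmod_le_abs (z : C) : Cmod z <= Rabs (Re z) + Rabs (Im z).
Proof.
  destruct z as [a b]. replace ((a, b) : C) with (Cplus (RtoC a) (Cmult Ci (RtoC b))).
  - eapply Rle_trans; [apply Cmod_triangle|].
    rewrite Cmod_mult, Cmod_Ci, !Cmod_R. unfold Re, Im; simpl.
    replace (a + (0 * b - 1 * 0)) with a by ring.
    replace (0 + (0 * 0 + 1 * b)) with b by ring. lra.
  - apply injective_projections; simpl; ring.
Qed.

Lemma im_le_Cmod (z : C) : Rabs (Im z) <= Cmod z.
Proof. eapply Rle_trans; [apply Rmax_r|apply Rmax_Cmod]. Qed.

Lemma Ccont_ext (f g : R -> C) : (forall x, f x = g x) -> Ccont f -> Ccont g.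
Proof.
  intros E [H1 H2]. split; intros x.
  - apply continuous_ext with (fun u => Re (f u)); [intros u; now rewrite E|apply H1].
  - apply continuous_ext with (fun u => Im (f u)); [intros u; now rewrite E|apply H2].
Qed.

Lemma Ccont_const (c : C) : Ccont (fun _ => c).
Proof. split; intros x; apply continuous_const. Qed.

Lemma Ccont_plus (f g : R -> C) : Ccont f -> Ccont g -> Ccont (fun x => Cplus (f x) (g x)).
Proof.
  intros [F1 F2] [G1 G2]. split; intros x.
  - exact (continuous_plus _ _ _ (F1 x) (G1 x)).
  - exact (continuous_plus _ _ _ (F2 x) (G2 x)).
Qed.

Lemma Ccont_mult (f g : R -> C) : Ccont f -> Ccont g -> Ccont (fun x => Cmult (f x) (g x)).
Proof.
  intros [F1 F2] [G1 G2]. split; intros x.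
  - apply (continuous_minus (fun u => Re (f u) * Re (g u)) (fun u => Im (f u) * Im (g u)));
      apply (continuous_mult (K := R_AbsRing)); auto.
  - apply (continuous_plus (fun u => Re (f u) * Im (g u)) (fun u => Im (f u) * Re (g u)));
      apply (continuous_mult (K := R_AbsRing)); auto.
Qed.

Lemma Ccont_opp (f : R -> C) : Ccont f -> Ccont (fun x => Copp (f x)).
Proof.
  intros [F1 F2]. split; intros x.
  - exact (continuous_opp _ _ (F1 x)).
  - exact (continuous_opp _ _ (F2 x)).
Qed.

Lemma Ccont_pow (f : R -> C) (n : nat) : Ccont f -> Ccont (fun x => Cpow (f x) n).
Proof.
  intros F. induction n as [|n IH]; simpl; [apply Ccont_const|now apply Ccont_mult].
Qed.

Lemma Ccont_comp (f : R -> C) (g : R -> R) :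
  Ccont f -> (forall x, continuous g x) -> Ccont (fun x => f (g x)).
Proof.
  intros [F1 F2] G. split; intros x.
  - exact (continuous_comp g (fun u => Re (f u)) x (G x) (F1 _)).
  - exact (continuous_comp g (fun u => Im (f u)) x (G x) (F2 _)).
Qed.

Lemma continuous_exp_R (x : R) : continuous exp x.
Proof. apply (ex_derive_continuous (V := R_NormedModule)). auto_derive. easy. Qed.

Lemma continuous_cos_R (x : R) : continuous cos x.
Proof. apply (ex_derive_continuous (V := R_NormedModule)). auto_derive. easy. Qed.

Lemma continuous_sin_R (x : R) : continuous sin x.
Proof. apply (ex_derive_continuous (V := R_NormedModule)). auto_derive. easy. Qed.

Lemma continuous_scal_R (a : R) (g : R -> R) (x : R) :
  continuous g x -> continuous (fun u => a * g u) x.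
Proof.
  intros G. apply (continuous_mult (K := R_AbsRing)); [apply continuous_const|easy].
Qed.

Lemma Ccont_cexp2pi (f : R -> C) : Ccont f -> Ccont (fun x => cexp2pi (f x)).
Proof.
  intros [F1 F2].
  assert (E : forall x, continuous (fun u => exp (- (2 * PI * Im (f u)))) x).
  { intros x. apply (continuous_comp (fun u => - (2 * PI * Im (f u))) exp).
    - apply (continuous_opp (fun u => 2 * PI * Im (f u))). now apply continuous_scal_R.
    - apply continuous_exp_R. }
  split; intros x; apply (continuous_mult (K := R_AbsRing)); auto.
  - apply (continuous_comp (fun u => 2 * PI * Re (f u)) cos);
      [now apply continuous_scal_R|apply continuous_cos_R].
  - apply (continuous_comp (fun u => 2 * PI * Re (f u)) sin);
      [now apply continuous_scal_R|apply continuous_sin_R].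
Qed.

Lemma Ccont_Csum (f : nat -> R -> C) (n : nat) :
  (forall i, Ccont (f i)) -> Ccont (fun x => Csum (fun i => f i x) n).
Proof.
  intros F. induction n as [|n IH]; simpl; [apply Ccont_const|now apply Ccont_plus].
Qed.

Lemma Cder_cont (f f' : R -> C) : (forall x, Cder f x (f' x)) -> Ccont f.
Proof.
  intros H. split; intros x; apply (ex_derive_continuous (V := R_NormedModule)).
  - exists (Re (f' x)). exact (proj1 (H x)).
  - exists (Im (f' x)). exact (proj2 (H x)).
Qed.

Lemma Cder_ext (f g : R -> C) (x : R) (l : C) :
  (forall u, f u = g u) -> Cder f x l -> Cder g x l.
Proof.
  intros E [H1 H2]. split.
  - apply is_derive_ext with (fun u => Re (f u)); [intros u; now rewrite E|easy].
  - apply is_derive_ext with (fun u => Im (f u)); [intros u; now rewrite E|easy].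
Qed.

Lemma Cder_const (c : C) (x : R) : Cder (fun _ => c) x (RtoC 0).
Proof. split; apply (is_derive_const (V := R_NormedModule)). Qed.

Lemma Cder_plus (f g : R -> C) (x : R) (l m : C) :
  Cder f x l -> Cder g x m -> Cder (fun u => Cplus (f u) (g u)) x (Cplus l m).
Proof.
  intros [F1 F2] [G1 G2]. split.
  - exact (is_derive_plus _ _ _ _ _ F1 G1).
  - exact (is_derive_plus _ _ _ _ _ F2 G2).
Qed.

Lemma Cder_mult (f g : R -> C) (x : R) (l m : C) :
  Cder f x l -> Cder g x m ->
  Cder (fun u => Cmult (f u) (g u)) x (Cplus (Cmult l (g x)) (Cmult (f x) m)).
Proof.
  intros [F1 F2] [G1 G2].
  assert (D : forall (p q : R -> R) (a b : R), is_derive p x a -> is_derive q x b ->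
    is_derive (fun u => p u * q u) x (a * q x + p x * b)).
  { intros p q a b P Q. apply (is_derive_mult p q); try easy. intros; apply Rmult_comm. }
  split.
  - evar_last; [exact (is_derive_minus _ _ _ _ _ (D _ _ _ _ F1 G1) (D _ _ _ _ F2 G2))|].
    unfold minus, plus, opp, Re, Im; simpl. ring.
  - evar_last; [exact (is_derive_plus _ _ _ _ _ (D _ _ _ _ F1 G2) (D _ _ _ _ F2 G1))|].
    unfold plus, Re, Im; simpl. ring.
Qed.

Lemma ex_RInt_cont (f : R -> R) (a b : R) : (forall x, continuous f x) -> ex_RInt f a b.
Proof. intros F. apply (ex_RInt_continuous (V := R_CompleteNormedModule)). auto. Qed.

Lemma Cint_ext (f g : R -> C) (a b : R) :
  (forall x, Rmin a b < x < Rmax a b -> f x = g x) -> Cint f a b = Cint g a b.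
Proof.
  intros E. unfold Cint. f_equal; apply RInt_ext; intros x Hx; now rewrite E.
Qed.

Lemma Cint_plus (f g : R -> C) (a b : R) : Ccont f -> Ccont g ->
  Cint (fun x => Cplus (f x) (g x)) a b = Cplus (Cint f a b) (Cint g a b).
Proof.
  intros [F1 F2] [G1 G2]. unfold Cint. apply injective_projections; simpl.
  - apply (RInt_plus (V := R_CompleteNormedModule)); now apply ex_RInt_cont.
  - apply (RInt_plus (V := R_CompleteNormedModule)); now apply ex_RInt_cont.
Qed.

Lemma Cint_scal (c : C) (f : R -> C) (a b : R) : Ccont f ->
  Cint (fun x => Cmult c (f x)) a b = Cmult c (Cint f a b).
Proof.
  intros [F1 F2].
  assert (S : forall (l : R) (g : R -> R), (forall x, continuous g x) ->
    RInt (fun x => l * g x) a b = l * RInt g a b).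
  { intros l g G. apply (RInt_scal (V := R_CompleteNormedModule)). now apply ex_RInt_cont. }
  unfold Cint. apply injective_projections; simpl.
  - rewrite <- !S by auto.
    apply (RInt_minus (V := R_CompleteNormedModule) (fun x => fst c * Re (f x))
      (fun x => snd c * Im (f x)));
      apply ex_RInt_cont; intros x; now apply continuous_scal_R.
  - rewrite <- !S by auto.
    apply (RInt_plus (V := R_CompleteNormedModule) (fun x => fst c * Im (f x))
      (fun x => snd c * Re (f x)));
      apply ex_RInt_cont; intros x; now apply continuous_scal_R.
Qed.

Lemma Cint_Chasles (f : R -> C) (a b c : R) : Ccont f ->
  Cplus (Cint f a b) (Cint f b c) = Cint f a c.
Proof.
  intros [F1 F2]. unfold Cint. apply injective_projections; simpl.
  - apply (RInt_Chasles (V := R_CompleteNormedModule)); now apply ex_RInt_cont.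
  - apply (RInt_Chasles (V := R_CompleteNormedModule)); now apply ex_RInt_cont.
Qed.

Lemma RInt_shift (f : R -> R) (s a b : R) : (forall x, continuous f x) ->
  RInt (fun x => f (x + s)) a b = RInt f (a + s) (b + s).
Proof.
  intros F.
  rewrite <- (Rmult_1_l a), <- (Rmult_1_l b) at 2.
  rewrite <- (RInt_comp_lin (V := R_CompleteNormedModule) f 1 s a b).
  - apply RInt_ext. intros x _. unfold scal; simpl; unfold mult; simpl.
    now rewrite !Rmult_1_l.
  - now apply ex_RInt_cont.
Qed.

Lemma Cint_shift (f : R -> C) (s a b : R) : Ccont f ->
  Cint (fun x => f (x + s)) a b = Cint f (a + s) (b + s).
Proof.
  intros [F1 F2]. unfold Cint. f_equal.
  - now apply (RInt_shift (fun x => Re (f x))).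
  - now apply (RInt_shift (fun x => Im (f x))).
Qed.

Lemma Cint_derive (F f : R -> C) (a b : R) : (forall x, Cder F x (f x)) -> Ccont f ->
  Cint f a b = Cminus (F b) (F a).
Proof.
  intros D [F1 F2]. unfold Cint. apply injective_projections; simpl.
  - apply is_RInt_unique, (is_RInt_derive (V := R_CompleteNormedModule) (fun x => Re (F x)));
      intros; [apply D|apply F1].
  - apply is_RInt_unique, (is_RInt_derive (V := R_CompleteNormedModule) (fun x => Im (F x)));
      intros; [apply D|apply F2].
Qed.

(** The mean value theorem applied to h - g. Comparing antiderivatives in place of integrals lets
    every majorant below enter through an explicit antiderivative such as atan or a power. *)
Lemma increment_le (g h g' h' : R -> R) (a b : R) : a <= b ->
  (forall x, a <= x <= b -> is_derive g x (g' x)) ->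
  (forall x, a <= x <= b -> is_derive h x (h' x)) ->
  (forall x, a <= x <= b -> g' x <= h' x) ->
  g b - g a <= h b - h a.
Proof.
  intros Hab Dg Dh B.
  destruct (MVT_gen (fun x => h x - g x) a b (fun x => h' x - g' x)) as [c [Hc E]].
  - rewrite Rmin_left, Rmax_right by easy. intros x Hx.
    apply (is_derive_minus h g); [apply Dh|apply Dg]; lra.
  - rewrite Rmin_left, Rmax_right by easy. intros x Hx.
    apply continuity_pt_minus; apply continuity_pt_filterlim;
      apply (ex_derive_continuous (V := R_NormedModule)); eexists; [now apply Dh|now apply Dg].
  - rewrite Rmin_left, Rmax_right in Hc by easy. specialize (B c Hc). nra.
Qed.

Lemma increment_bound (g h g' h' : R -> R) (a b : R) : a <= b ->
  (forall x, a <= x <= b -> is_derive g x (g' x)) ->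
  (forall x, a <= x <= b -> is_derive h x (h' x)) ->
  (forall x, a <= x <= b -> Rabs (g' x) <= h' x) ->
  Rabs (g b - g a) <= h b - h a.
Proof.
  intros Hab Dg Dh B. apply Rabs_le. split.
  - assert (H : - g b - - g a <= h b - h a); [|lra].
    apply (increment_le (fun x => - g x) h (fun x => - g' x) h'); try easy.
    + intros x Hx. now apply (is_derive_opp g), Dg.
    + intros x Hx. specialize (B x Hx). apply Rabs_le_between in B. lra.
  - apply (increment_le g h g' h'); try easy.
    intros x Hx. specialize (B x Hx). apply Rabs_le_between in B. lra.
Qed.

Lemma is_derive_RInt_cont (f : R -> R) (a x : R) : (forall u, continuous f u) ->
  is_derive (RInt f a) x (f x).
Proof.
  intros F. apply (is_derive_RInt (V := R_NormedModule) f _ a x); [|apply F].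
  apply filter_forall. intros u.
  apply (RInt_correct (V := R_CompleteNormedModule)). now apply ex_RInt_cont.
Qed.

(** The factor 2 comes from bounding the real and the imaginary part separately, each by the
    increment of [h]. *)
Lemma Cint_bound (f : R -> C) (h h' : R -> R) (a b : R) : a <= b -> Ccont f ->
  (forall x, a <= x <= b -> is_derive h x (h' x)) ->
  (forall x, a <= x <= b -> Cmod (f x) <= h' x) ->
  Cmod (Cint f a b) <= 2 * (h b - h a).
Proof.
  intros Hab [F1 F2] D B.
  assert (H : forall g : R -> R, (forall x, continuous g x) ->
    (forall x, a <= x <= b -> Rabs (g x) <= h' x) -> Rabs (RInt g a b) <= h b - h a).
  { intros g G Bg.
    replace (RInt g a b) with (RInt g a b - RInt g a a).
    - apply (increment_bound (RInt g a) h g h'); try easy.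
      intros x _. now apply is_derive_RInt_cont.
    - rewrite RInt_point. unfold zero; simpl. ring. }
  eapply Rle_trans; [apply Cmod_le_abs|]. simpl.
  pose proof (H _ F1 (fun x Hx => Rle_trans _ _ _ (re_le_Cmod _) (B x Hx))).
  pose proof (H _ F2 (fun x Hx => Rle_trans _ _ _ (im_le_Cmod _) (B x Hx))).
  simpl in *. lra.
Qed.

(** * The exponential e(z) and its Taylor remainder *)

Lemma cexp2pi_plus (z w : C) : cexp2pi (Cplus z w) = Cmult (cexp2pi z) (cexp2pi w).
Proof.
  destruct z as [a b], w as [c d]. unfold cexp2pi, Re, Im; simpl.
  replace (- (2 * PI * (b + d))) with (- (2 * PI * b) + - (2 * PI * d)) by ring.
  rewrite !Rmult_plus_distr_l, exp_plus, cos_plus, sin_plus.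
  apply injective_projections; simpl; ring.
Qed.

Lemma Cmod_cexp2pi (z : C) : Cmod (cexp2pi z) = exp (- (2 * PI * Im z)).
Proof.
  unfold cexp2pi, Cmod. simpl.
  pose proof (sin2_cos2 (2 * PI * Re z)) as H. unfold Rsqr in H.
  set (e := exp _). assert (He : 0 < e) by apply exp_pos.
  replace (_ + _) with (e ^ 2).
  - now apply sqrt_pow2, Rlt_le.
  - transitivity (e ^ 2 * (sin (2 * PI * Re z) * sin (2 * PI * Re z) +
      cos (2 * PI * Re z) * cos (2 * PI * Re z))); [rewrite H; ring|ring].
Qed.

Lemma cexp2pi_0 : cexp2pi (RtoC 0) = RtoC 1.
Proof.
  unfold cexp2pi. simpl. rewrite !Rmult_0_r, Ropp_0, exp_0, cos_0, sin_0.
  apply injective_projections; simpl; ring.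
Qed.

Lemma cexp2pi_Z (n : Z) : cexp2pi (RtoC (IZR n)) = RtoC 1.
Proof.
  assert (P : forall k : nat, cexp2pi (RtoC (INR k)) = RtoC 1).
  { intros k. unfold cexp2pi. simpl. rewrite Rmult_0_r, Ropp_0, exp_0.
    replace (2 * PI * INR k) with (0 + 2 * INR k * PI) by ring.
    rewrite cos_period, sin_period, cos_0, sin_0.
    apply injective_projections; simpl; ring. }
  destruct (Z_le_gt_dec 0 n) as [H|H].
  - rewrite <- (Z2Nat.id n H), <- INR_IZR_INZ. apply P.
  - pose proof (P (Z.to_nat (- n))) as Q.
    rewrite INR_IZR_INZ, Z2Nat.id in Q by lia.
    rewrite <- (Cmult_1_r (cexp2pi _)). rewrite <- Q at 1.
    rewrite <- cexp2pi_plus, <- cexp2pi_0. f_equal. rewrite opp_IZR.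
    apply injective_projections; simpl; ring.
Qed.

Lemma Cder_cexp2pi (f : R -> C) (x : R) (l : C) : Cder f x l ->
  Cder (fun u => cexp2pi (f u)) x (Cmult (Cmult (0, 2 * PI) l) (cexp2pi (f x))).
Proof.
  intros [F1 F2]. split.
  - evar_last.
    + apply (is_derive_mult (fun u => exp (- (2 * PI * Im (f u))))
        (fun u => cos (2 * PI * Re (f u)))); [| |intros; apply Rmult_comm].
      * apply (is_derive_comp exp (fun u => - (2 * PI * Im (f u)))).
        { auto_derive; [easy|]. apply Rmult_1_l. }
        apply (is_derive_opp (fun u => 2 * PI * Im (f u))).
        apply (is_derive_scal (fun u => Im (f u))). exact F2.
      * apply (is_derive_comp cos (fun u => 2 * PI * Re (f u))).
        { auto_derive; [easy|]. apply Rmult_1_l. }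
        apply (is_derive_scal (fun u => Re (f u))). exact F1.
    + unfold plus, mult, scal, opp; simpl. unfold mult; simpl.
      unfold Re, Im; simpl. ring.
  - evar_last.
    + apply (is_derive_mult (fun u => exp (- (2 * PI * Im (f u))))
        (fun u => sin (2 * PI * Re (f u)))); [| |intros; apply Rmult_comm].
      * apply (is_derive_comp exp (fun u => - (2 * PI * Im (f u)))).
        { auto_derive; [easy|]. apply Rmult_1_l. }
        apply (is_derive_opp (fun u => 2 * PI * Im (f u))).
        apply (is_derive_scal (fun u => Im (f u))). exact F2.
      * apply (is_derive_comp sin (fun u => 2 * PI * Re (f u))).
        { auto_derive; [easy|]. apply Rmult_1_l. }
        apply (is_derive_scal (fun u => Re (f u))). exact F1.
    + unfold plus, mult, scal, opp; simpl. unfold mult; simpl.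
      unfold Re, Im; simpl. ring.
Qed.

Lemma is_derive_pow_fact (n : nat) (s : R) :
  is_derive (fun u => u ^ S n / INR (fact (S n))) s (s ^ n / INR (fact n)).
Proof.
  rewrite INR_fact_S. pose proof (INR_fact_pos n) as HF. pose proof (pos_INR n).
  evar_last.
  - apply (is_derive_ext (fun u => / ((INR n + 1) * INR (fact n)) * u ^ S n)).
    { intros u. apply Rmult_comm. }
    apply is_derive_scal, is_derive_pow, is_derive_id.
  - rewrite S_INR. unfold one; simpl. field. lra.
Qed.

Definition exp_partial (a : C) (n : nat) (s : R) : C :=
  Csum (fun j => Cmult (RtoC (s ^ j / INR (fact j))) (Cpow a j)) n.

Lemma Cder_RtoC (g : R -> R) (x l : R) : is_derive g x l -> Cder (fun u => RtoC (g u)) x (RtoC l).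
Proof. intros G. split; [exact G|]. exact (is_derive_const 0 x). Qed.

Lemma Cder_exp_partial (a : C) (n : nat) (s : R) :
  Cder (exp_partial a (S n)) s (Cmult a (exp_partial a n s)).
Proof.
  induction n as [|n IH].
  - unfold exp_partial. simpl. evar_last; [|symmetry; apply Cmult_0_r].
    apply Cder_ext with (fun _ => Cplus (RtoC 0) (Cmult (RtoC (1 / 1)) (RtoC 1))); [easy|].
    apply Cder_const.
  - change (exp_partial a (S (S n))) with (fun u => Cplus (exp_partial a (S n) u)
      (Cmult (RtoC (u ^ S n / INR (fact (S n)))) (Cpow a (S n)))).
    evar_last.
    + apply Cder_plus; [exact IH|].
      apply Cder_mult; [apply Cder_RtoC, is_derive_pow_fact|apply Cder_const].
    + unfold exp_partial. simpl Csum. simpl Cpow. ring.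
Qed.

Definition exp_rem (z : C) (n : nat) (s : R) : C :=
  Cminus (cexp2pi (Cmult (RtoC s) z)) (exp_partial (Cmult (0, 2 * PI) z) n s).

Lemma Cder_exp_rem (z : C) (n : nat) (s : R) :
  Cder (exp_rem z (S n)) s (Cmult (Cmult (0, 2 * PI) z) (exp_rem z n s)).
Proof.
  apply Cder_ext with (fun u => Cplus (cexp2pi (Cmult (RtoC u) z))
    (Cmult (RtoC (-1)) (exp_partial (Cmult (0, 2 * PI) z) (S n) u))).
  { intros u. unfold exp_rem. apply injective_projections; simpl; ring. }
  evar_last.
  - apply Cder_plus.
    + apply Cder_cexp2pi. apply Cder_mult; [apply Cder_RtoC, is_derive_id|apply Cder_const].
    + apply Cder_mult; [apply Cder_const|apply Cder_exp_partial].
  - unfold exp_rem. change (RtoC one) with (RtoC 1).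
    replace (RtoC (-1)) with (Copp (RtoC 1)) by (apply injective_projections; simpl; ring).
    ring.
Qed.

Lemma Cmod_2pi_i : Cmod (0, 2 * PI) = 2 * PI.
Proof.
  replace ((0, 2 * PI) : C) with (Cmult Ci (RtoC (2 * PI))).
  - rewrite Cmod_mult, Cmod_Ci, Cmod_R, Rabs_pos_eq; [ring|]. pose proof PI_RGT_0; lra.
  - apply injective_projections; simpl; ring.
Qed.

(** In s, the remainder of order n+1 vanishes at 0 and has derivative 2 pi i z times the remainder
    of order n, so the bound is integrated once per step. Each step loses a factor 2 by treating
    both components separately, whence 4 pi for 2 pi; the factorial absorbs this. *)
Lemma exp_rem_bound (z : C) (n : nat) (s : R) : 0 <= s <= 1 ->
  Cmod (exp_rem z n s) <=
  exp (2 * PI * Cmod z) * (4 * PI * Cmod z) ^ n * (s ^ n / INR (fact n)).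
Proof.
  pose proof PI_RGT_0 as Hpi. pose proof (Cmod_ge_0 z) as Hz.
  revert s. induction n as [|n IH]; intros s Hs.
  - unfold exp_rem, exp_partial. simpl Csum.
    replace (Cminus _ _) with (cexp2pi (Cmult (RtoC s) z)) by ring.
    rewrite Cmod_cexp2pi. simpl. rewrite Rdiv_1_r, !Rmult_1_r.
    assert (H : - (2 * PI * (s * snd z + 0 * fst z)) <= 2 * PI * Cmod z).
    { pose proof (im_le_Cmod z) as H. apply Rabs_le_between in H. unfold Im in H.
      assert (- (s * snd z) <= Cmod z) by nra. nra. }
    now apply exp_monotone.
  - set (K := exp (2 * PI * Cmod z) * (4 * PI * Cmod z) ^ n * (2 * PI * Cmod z)).
    assert (B : forall u, 0 <= u <= 1 ->
      Cmod (Cmult (Cmult (0, 2 * PI) z) (exp_rem z n u)) <= K * (u ^ n / INR (fact n))).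
    { intros u Hu. rewrite !Cmod_mult, Cmod_2pi_i. unfold K.
      specialize (IH u Hu).
      replace (_ * (2 * PI * Cmod z) * _) with (2 * PI * Cmod z *
        (exp (2 * PI * Cmod z) * (4 * PI * Cmod z) ^ n * (u ^ n / INR (fact n)))) by ring.
      apply Rmult_le_compat_l; [nra|easy]. }
    assert (D : forall u, is_derive (fun v => K * (v ^ S n / INR (fact (S n)))) u
      (K * (u ^ n / INR (fact n)))).
    { intros u. apply (is_derive_scal (fun v => v ^ S n / INR (fact (S n)))).
      apply is_derive_pow_fact. }
    assert (Z0 : exp_rem z (S n) 0 = RtoC 0).
    { unfold exp_rem. rewrite Cmult_0_l, cexp2pi_0.
      assert (E : forall m, exp_partial (Cmult (0, 2 * PI) z) (S m) 0 = RtoC 1).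
      { induction m as [|m IHm]; unfold exp_partial in *.
        - apply injective_projections; simpl; field.
        - change (Csum ?f (S (S m))) with (Cplus (Csum f (S m)) (f (S m))).
          rewrite IHm, pow_i by lia. unfold Rdiv. rewrite Rmult_0_l. ring. }
      rewrite E. ring. }
    assert (Bs : forall u, 0 <= u <= s ->
      Cmod (Cmult (Cmult (0, 2 * PI) z) (exp_rem z n u)) <= K * (u ^ n / INR (fact n)))
      by (intros u Hu; apply B; lra).
    eapply Rle_trans; [apply Cmod_le_abs|].
    pose proof (increment_bound _ _ _ _ 0 s (proj1 Hs)
      (fun u _ => proj1 (Cder_exp_rem z n u)) (fun u _ => D u)
      (fun u Hu => Rle_trans _ _ _ (re_le_Cmod _) (Bs u Hu))) as H1.
    pose proof (increment_bound _ _ _ _ 0 s (proj1 Hs)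
      (fun u _ => proj2 (Cder_exp_rem z n u)) (fun u _ => D u)
      (fun u Hu => Rle_trans _ _ _ (im_le_Cmod _) (Bs u Hu))) as H2.
    cbv beta in H1, H2. rewrite Z0 in H1, H2.
    change (Re (RtoC 0)) with 0 in H1. change (Im (RtoC 0)) with 0 in H2.
    rewrite pow_i in H1, H2 by lia. unfold Rdiv in H1, H2.
    rewrite Rmult_0_l, Rmult_0_r, !Rminus_0_r in H1, H2.
    replace (exp _ * _ * _) with (2 * (K * (s ^ S n * / INR (fact (S n))))); [lra|].
    unfold K. rewrite <- !tech_pow_Rmult. unfold Rdiv. ring.
Qed.

(** * Limits and integrals over a horizontal line *)

(** One notion for an arbitrary filter serves both the partial sums ([eventually]) and the truncated
    line integrals ([pinf]). *)
Definition Clim {T : Type} (F : (T -> Prop) -> Prop) (f : T -> C) (l : C) : Prop :=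
  forall eps : R, 0 < eps -> F (fun x => Cmod (Cminus (f x) l) < eps).

Lemma Clim_ext {T : Type} (F : (T -> Prop) -> Prop) {FF : Filter F} (f g : T -> C) (l : C) :
  (forall x, f x = g x) -> Clim F f l -> Clim F g l.
Proof.
  intros E H eps He. apply filter_imp with (2 := H eps He). intros x. now rewrite E.
Qed.

Lemma Clim_const {T : Type} (F : (T -> Prop) -> Prop) {FF : Filter F} (c : C) :
  Clim F (fun _ => c) c.
Proof.
  intros eps He. apply filter_forall. intros _.
  replace (Cminus c c) with (RtoC 0) by ring. now rewrite Cmod_0.
Qed.

Lemma Clim_squeeze {T : Type} (F : (T -> Prop) -> Prop) {FF : Filter F}
  (f g : T -> C) (l m : C) (K : R) :
  (forall x, Cmod (Cminus (g x) m) <= K * Cmod (Cminus (f x) l)) ->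
  Clim F f l -> Clim F g m.
Proof.
  intros B H eps He.
  assert (HK : 0 < Rabs K + 1) by (pose proof (Rabs_pos K); lra).
  apply filter_imp with (2 := H (eps / (Rabs K + 1)) (Rdiv_lt_0_compat _ _ He HK)).
  intros x Hx. apply Rle_lt_trans with (1 := B x).
  pose proof (Cmod_ge_0 (Cminus (f x) l)). pose proof (Rle_abs K).
  apply Rle_lt_trans with ((Rabs K + 1) * Cmod (Cminus (f x) l)).
  - apply Rmult_le_compat_r; lra.
  - apply Rmult_lt_reg_r with (/ (Rabs K + 1)); [now apply Rinv_0_lt_compat|].
    replace ((Rabs K + 1) * _ * _) with (Cmod (Cminus (f x) l)) by (field; lra). exact Hx.
Qed.

Lemma Clim_plus {T : Type} (F : (T -> Prop) -> Prop) {FF : Filter F} (f g : T -> C) (l m : C) :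
  Clim F f l -> Clim F g m -> Clim F (fun x => Cplus (f x) (g x)) (Cplus l m).
Proof.
  intros Hf Hg eps He.
  generalize (filter_and (F := F) _ _ (Hf (eps / 2) ltac:(lra)) (Hg (eps / 2) ltac:(lra))).
  apply filter_imp. intros x [H1 H2].
  replace (Cminus _ _) with (Cplus (Cminus (f x) l) (Cminus (g x) m)) by ring.
  eapply Rle_lt_trans; [apply Cmod_triangle|]. lra.
Qed.

Lemma Clim_scal {T : Type} (F : (T -> Prop) -> Prop) {FF : Filter F} (f : T -> C) (c l : C) :
  Clim F f l -> Clim F (fun x => Cmult c (f x)) (Cmult c l).
Proof.
  intros H. apply (Clim_squeeze F f _ l _ (Cmod c)); [intros x|exact H].
  replace (Cminus _ _) with (Cmult c (Cminus (f x) l)) by ring.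
  rewrite Cmod_mult. lra.
Qed.

Lemma Clim_minus {T : Type} (F : (T -> Prop) -> Prop) {FF : Filter F} (f g : T -> C) (l m : C) :
  Clim F f l -> Clim F g m -> Clim F (fun x => Cminus (f x) (g x)) (Cminus l m).
Proof.
  intros Hf Hg. replace (Cminus l m) with (Cplus l (Cmult (RtoC (-1)) m)).
  - apply Clim_ext with (fun x => Cplus (f x) (Cmult (RtoC (-1)) (g x))); [easy| |].
    + intros x. apply injective_projections; simpl; ring.
    + now apply Clim_plus, Clim_scal.
  - apply injective_projections; simpl; ring.
Qed.

Lemma Clim_Csum {T : Type} (F : (T -> Prop) -> Prop) {FF : Filter F}
  (f : nat -> T -> C) (l : nat -> C) (n : nat) :
  (forall i, Clim F (f i) (l i)) ->
  Clim F (fun x => Csum (fun i => f i x) n) (Csum l n).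
Proof.
  intros H. induction n as [|n IH]; simpl; [now apply Clim_const|now apply Clim_plus].
Qed.

Lemma Clim_bound {T : Type} (F : (T -> Prop) -> Prop) {FF : ProperFilter F}
  (f : T -> C) (l : C) (B : R) :
  Clim F f l -> F (fun x => Cmod (f x) <= B) -> Cmod l <= B.
Proof.
  intros H HB. apply Rnot_lt_le. intros L.
  destruct (filter_ex _ (filter_and (F := F) _ _ HB (H (Cmod l - B) ltac:(lra)))) as [x [H1 H2]].
  pose proof (Cmod_triangle (Cminus l (f x)) (f x)) as H3.
  replace (Cplus (Cminus l (f x)) (f x)) with l in H3 by ring.
  replace (Cminus l (f x)) with (Copp (Cminus (f x) l)) in H3 by ring.
  rewrite Cmod_opp in H3. lra.
Qed.

Lemma Clim_Re_ge {T : Type} (F : (T -> Prop) -> Prop) {FF : ProperFilter F}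
  (f : T -> C) (l : C) (B : R) :
  Clim F f l -> F (fun x => B <= Re (f x)) -> B <= Re l.
Proof.
  intros H HB. apply Rnot_lt_le. intros L.
  destruct (filter_ex _ (filter_and (F := F) _ _ HB (H (B - Re l) ltac:(lra)))) as [x [H1 H2]].
  pose proof (re_le_Cmod (Cminus (f x) l)) as H3. apply Rabs_le_between in H3.
  simpl in H3. unfold Re in *. lra.
Qed.

Lemma Clim_comp {T U : Type} (E : (T -> Prop) -> Prop) (F : (U -> Prop) -> Prop)
  (g : T -> U) (f : U -> C) (l : C) :
  filterlim g E F -> Clim F f l -> Clim E (fun x => f (g x)) l.
Proof. intros G H eps He. exact (G _ (H eps He)). Qed.

Definition pinf : (R -> Prop) -> Prop := Rbar_locally p_infty.

Instance pinf_proper : ProperFilter pinf.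
Proof. apply Rbar_locally_filter. Qed.

(** The two half-lines have separate limits, so the cut-off points may go to infinity independently,
    as they do at the two ends of a row of the series. *)
Definition line_int (G : R -> C) (I : C) : Prop :=
  exists p m, Clim pinf (fun u => Cint G 0 u) p /\ Clim pinf (fun u => Cint G 0 (- u)) m /\
    I = Cminus p m.

Lemma atan_tail (u : R) : 0 < u -> PI / 2 - atan u <= / u.
Proof.
  intros Hu. rewrite <- atan_inv by easy.
  set (x := / u). assert (Hx : 0 < x) by now apply Rinv_0_lt_compat.
  assert (H : atan x - atan 0 <= x - 0).
  { apply (increment_le atan (fun y => y) (fun y => / (1 + y ^ 2)) (fun _ => 1)); try lra.
    - intros y _. apply is_derive_Reals, Ratan.derivable_pt_lim_atan.
    - intros y _. apply (is_derive_id (K := R_AbsRing)).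
    - intros y _. rewrite <- Rinv_1. apply Rinv_le_contravar; nra. }
  rewrite atan_0 in H. lra.
Qed.

(** Cauchy's criterion, with the bounded increasing function K atan controlling the increments. It
    fits integrands of size K/(1+u^2). *)
Lemma Clim_of_atan_bound (H : R -> C) (K : R) : 0 <= K ->
  (forall u v, 0 <= v <= u -> Cmod (Cminus (H u) (H v)) <= K * (atan u - atan v)) ->
  exists l, Clim pinf H l.
Proof.
  intros HK B.
  assert (L : forall g : R -> R,
    (forall u v, 0 <= v <= u -> Rabs (g u - g v) <= K * (atan u - atan v)) ->
    exists l : R, filterlim g pinf (locally l)).
  { intros g Bg. apply (filterlim_locally_cauchy (U := R_CompleteSpace)). intros eps.
    (* Beyond v the increments are at most K/v, which is below eps once v > A; K + 1 in place of K
       keeps A positive when K = 0. *)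
    set (A := (K + 1) / eps).
    assert (HA : 0 < A) by (apply Rdiv_lt_0_compat; [lra|apply cond_pos]).
    assert (T : forall u v, A < v -> v <= u -> Rabs (g u - g v) < eps).
    { intros u v Hv Hu. apply Rle_lt_trans with (1 := Bg u v ltac:(lra)).
      pose proof (atan_tail v ltac:(lra)). pose proof (atan_bound u) as [_ Hb].
      assert (Hi : / v < / A) by (apply Rinv_0_lt_contravar; lra).
      assert (HE : eps * A = K + 1) by (unfold A; field; apply Rgt_not_eq, cond_pos).
      assert (HA' : eps = (K + 1) * / A :> R).
      { rewrite <- HE. field. lra. }
      rewrite HA'. assert (0 < / A) by now apply Rinv_0_lt_compat.
      apply Rle_lt_trans with (K * / v); [apply Rmult_le_compat_l; lra|]. nra. }
    exists (fun u => A < u). split; [now exists A|].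
    intros u v Hu Hv. change (Rabs (g v - g u) < eps).
    destruct (Rle_dec u v) as [Huv|Huv].
    - now apply T.
    - rewrite Rabs_minus_sym. apply T; lra. }
  destruct (L (fun u => Re (H u))) as [a Ha].
  { intros u v Huv. eapply Rle_trans; [|apply B, Huv].
    apply (re_le_Cmod (Cminus (H u) (H v))). }
  destruct (L (fun u => Im (H u))) as [b Hb].
  { intros u v Huv. eapply Rle_trans; [|apply B, Huv].
    apply (im_le_Cmod (Cminus (H u) (H v))). }
  exists (a, b). intros eps He.
  pose proof (proj1 (filterlim_locally _ _) Ha (mkposreal (eps / 2) ltac:(lra))) as Fa.
  pose proof (proj1 (filterlim_locally _ _) Hb (mkposreal (eps / 2) ltac:(lra))) as Fb.
  generalize (filter_and (F := pinf) _ _ Fa Fb). apply filter_imp. intros x [H1 H2].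
  change (Rabs (Re (H x) - a) < eps / 2) in H1. change (Rabs (Im (H x) - b) < eps / 2) in H2.
  eapply Rle_lt_trans; [apply Cmod_le_abs|]. simpl. unfold Re, Im, Rminus in *. lra.
Qed.

Lemma Cint_atan_bound (G : R -> C) (K a b : R) : a <= b -> Ccont G ->
  (forall u, Cmod (G u) <= K / (1 + u ^ 2)) ->
  Cmod (Cint G a b) <= 2 * K * (atan b - atan a).
Proof.
  intros Hab HG B.
  replace (2 * K * (atan b - atan a)) with (2 * (K * atan b - K * atan a)) by ring.
  apply (Cint_bound G (fun u => K * atan u) (fun u => K / (1 + u ^ 2))); try easy.
  intros x _. apply (is_derive_scal atan).
  apply is_derive_Reals, Ratan.derivable_pt_lim_atan.
Qed.

Lemma Cint_minus_swap (G : R -> C) (a b : R) : Ccont G ->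
  Cmod (Cint G a b) = Cmod (Cint G b a).
Proof.
  intros HG. replace (Cint G a b) with (Copp (Cint G b a)); [apply Cmod_opp|].
  assert (H : Cplus (Cint G b a) (Cint G a b) = Cint G b b) by now apply Cint_Chasles.
  assert (Z : Cint G b b = RtoC 0) by (unfold Cint; now rewrite !RInt_point).
  rewrite Z in H.
  replace (Cint G a b) with (Cplus (Copp (Cint G b a)) (Cplus (Cint G b a) (Cint G a b))) by ring.
  rewrite H. ring.
Qed.

Lemma line_int_exists (G : R -> C) (K : R) : Ccont G ->
  (forall u, Cmod (G u) <= K / (1 + u ^ 2)) -> exists I, line_int G I.
Proof.
  intros HG B.
  assert (HK : 0 <= K).
  { specialize (B 0). pose proof (Cmod_ge_0 (G 0)).
    replace (K / (1 + 0 ^ 2)) with K in B by field. lra. }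
  destruct (Clim_of_atan_bound (fun u => Cint G 0 u) (2 * K)) as [p Hp]; [lra| |].
  { intros u v Huv.
    replace (Cminus _ _) with (Cint G v u); [apply Cint_atan_bound; easy|].
    rewrite <- (Cint_Chasles G 0 v u HG). ring. }
  destruct (Clim_of_atan_bound (fun u => Cint G 0 (- u)) (2 * K)) as [m Hm]; [lra| |].
  { intros u v Huv.
    replace (Cminus _ _) with (Cint G (- v) (- u)).
    - rewrite Cint_minus_swap by easy.
      replace (atan u - atan v) with (atan (- v) - atan (- u)) by (rewrite !atan_opp; ring).
      apply Cint_atan_bound; [lra|easy|easy].
    - rewrite <- (Cint_Chasles G 0 (- v) (- u) HG). ring. }
  exists (Cminus p m), p, m. easy.
Qed.

(** Each half-line contributes at most 2K times the increment pi/2 of atan. *)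
Lemma line_int_bound (G : R -> C) (K : R) (I : C) : Ccont G ->
  (forall u, Cmod (G u) <= K / (1 + u ^ 2)) -> line_int G I -> Cmod I <= 2 * PI * K.
Proof.
  intros HG B [p [m [Hp [Hm ->]]]].
  assert (HK : 0 <= K).
  { specialize (B 0). pose proof (Cmod_ge_0 (G 0)).
    replace (K / (1 + 0 ^ 2)) with K in B by field. lra. }
  assert (H : forall u, Cmod (Cint G 0 u) <= PI * K).
  { assert (P : forall a b, a <= b -> (a = 0 \/ b = 0) -> Cmod (Cint G a b) <= PI * K).
    { intros a b Hab Hz. eapply Rle_trans; [apply Cint_atan_bound; eassumption|].
      pose proof (atan_bound a). pose proof (atan_bound b).
      assert (atan b - atan a <= PI / 2) by (destruct Hz; subst; rewrite ?atan_0 in *; lra).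
      nra. }
    intros u. destruct (Rle_dec 0 u); [apply P; auto|].
    rewrite Cint_minus_swap by easy. apply P; [lra|auto]. }
  assert (Bp : Cmod p <= PI * K).
  { apply (Clim_bound pinf) with (1 := Hp). apply filter_forall. auto. }
  assert (Bm : Cmod m <= PI * K).
  { apply (Clim_bound pinf) with (1 := Hm). apply filter_forall. auto. }
  unfold Cminus. eapply Rle_trans; [apply Cmod_triangle|]. rewrite Cmod_opp. lra.
Qed.

Lemma line_int_ext (f g : R -> C) (I : C) : (forall u, f u = g u) ->
  line_int f I -> line_int g I.
Proof.
  intros E [p [m [Hp [Hm ->]]]]. exists p, m. repeat split.
  - apply (Clim_ext pinf) with (2 := Hp). intros u. apply Cint_ext. auto.
  - apply (Clim_ext pinf) with (2 := Hm). intros u. apply Cint_ext. auto.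
Qed.

Lemma line_int_plus (f g : R -> C) (I J : C) : Ccont f -> Ccont g ->
  line_int f I -> line_int g J -> line_int (fun u => Cplus (f u) (g u)) (Cplus I J).
Proof.
  intros Cf Cg [p [m [Hp [Hm ->]]]] [q [n [Hq [Hn ->]]]].
  exists (Cplus p q), (Cplus m n). repeat split; [| |ring].
  - apply (Clim_ext pinf) with (fun u => Cplus (Cint f 0 u) (Cint g 0 u)).
    + intros u. now rewrite Cint_plus.
    + now apply (Clim_plus pinf).
  - apply (Clim_ext pinf) with (fun u => Cplus (Cint f 0 (- u)) (Cint g 0 (- u))).
    + intros u. now rewrite Cint_plus.
    + now apply (Clim_plus pinf).
Qed.

Lemma line_int_scal (c : C) (f : R -> C) (I : C) : Ccont f ->
  line_int f I -> line_int (fun u => Cmult c (f u)) (Cmult c I).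
Proof.
  intros Cf [p [m [Hp [Hm ->]]]].
  exists (Cmult c p), (Cmult c m). repeat split; [| |ring].
  - apply (Clim_ext pinf) with (fun u => Cmult c (Cint f 0 u)).
    + intros u. now rewrite Cint_scal.
    + now apply (Clim_scal pinf).
  - apply (Clim_ext pinf) with (fun u => Cmult c (Cint f 0 (- u))).
    + intros u. now rewrite Cint_scal.
    + now apply (Clim_scal pinf).
Qed.

Lemma line_int_0 : line_int (fun _ => RtoC 0) (RtoC 0).
Proof.
  assert (Z : forall a b, Cint (fun _ => RtoC 0) a b = RtoC 0).
  { intros a b. unfold Cint. simpl. rewrite !RInt_const. unfold scal; simpl; unfold mult; simpl.
    now rewrite !Rmult_0_r. }
  exists (RtoC 0), (RtoC 0). repeat split; [| |ring].
  - apply (Clim_ext pinf) with (fun _ => RtoC 0); [now intros; rewrite Z|apply (Clim_const pinf)].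
  - apply (Clim_ext pinf) with (fun _ => RtoC 0); [now intros; rewrite Z|apply (Clim_const pinf)].
Qed.

Lemma line_int_Csum (f : nat -> R -> C) (I : nat -> C) (n : nat) :
  (forall i, Ccont (f i)) -> (forall i, line_int (f i) (I i)) ->
  line_int (fun u => Csum (fun i => f i u) n) (Csum I n).
Proof.
  intros Cf H. induction n as [|n IH]; simpl.
  - apply line_int_0.
  - apply line_int_plus; try easy. now apply Ccont_Csum.
Qed.

Lemma line_int_unique (G : R -> C) (I J : C) : Ccont G -> line_int G I -> line_int G J -> I = J.
Proof.
  intros HG HI HJ.
  (* By linearity I - J is an integral of the zero function, and [line_int_bound] with K = 0 forces
     it to vanish. *)
  assert (H : line_int (fun _ => RtoC 0) (Cplus I (Cmult (RtoC (-1)) J))).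
  { apply line_int_ext with (fun u => Cplus (G u) (Cmult (RtoC (-1)) (G u))).
    - intros u. apply injective_projections; simpl; ring.
    - apply line_int_plus; try easy; [apply Ccont_mult; [apply Ccont_const|easy]|].
      now apply line_int_scal. }
  apply (line_int_bound _ 0) in H.
  - rewrite Rmult_0_r in H. pose proof (Cmod_ge_0 (Cplus I (Cmult (RtoC (-1)) J))).
    assert (E : Cplus I (Cmult (RtoC (-1)) J) = RtoC 0) by (apply Cmod_eq_0; lra).
    replace I with (Cplus (Cplus I (Cmult (RtoC (-1)) J)) J).
    + rewrite E. ring.
    + apply injective_projections; simpl; ring.
  - apply Ccont_const.
  - intros u. rewrite Cmod_0. unfold Rdiv. rewrite Rmult_0_l. lra.
Qed.

Lemma line_int_derive (F f : R -> C) : (forall x, Cder F x (f x)) -> Ccont f ->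
  Clim pinf F (RtoC 0) -> Clim pinf (fun u => F (- u)) (RtoC 0) -> line_int f (RtoC 0).
Proof.
  intros D Cf Lp Lm. exists (Copp (F 0)), (Copp (F 0)). repeat split; [| |ring].
  - apply (Clim_ext pinf) with (fun u => Cminus (F u) (F 0)).
    + intros u. now rewrite (Cint_derive F f).
    + replace (Copp (F 0)) with (Cminus (RtoC 0) (F 0)) by ring.
      apply (Clim_minus pinf); [easy|apply (Clim_const pinf)].
  - apply (Clim_ext pinf) with (fun u => Cminus (F (- u)) (F 0)).
    + intros u. now rewrite (Cint_derive F f).
    + replace (Copp (F 0)) with (Cminus (RtoC 0) (F 0)) by ring.
      apply (Clim_minus pinf); [easy|apply (Clim_const pinf)].
Qed.

Lemma Clim_0_of_bound (F : R -> C) (K : R) :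
  (forall u, Cmod (F u) <= K / (1 + u ^ 2)) -> Clim pinf F (RtoC 0).
Proof.
  intros B eps He.
  assert (HK : 0 <= K).
  { specialize (B 0). pose proof (Cmod_ge_0 (F 0)).
    replace (K / (1 + 0 ^ 2)) with K in B by field. lra. }
  exists (K / eps + 1). intros u Hu.
  replace (Cminus (F u) (RtoC 0)) with (F u) by ring.
  apply Rle_lt_trans with (1 := B u).
  assert (0 <= K / eps) by (apply Rmult_le_pos; [lra|left; now apply Rinv_0_lt_compat]).
  apply Rmult_lt_reg_r with (1 + u ^ 2); [nra|].
  replace (K / (1 + u ^ 2) * (1 + u ^ 2)) with K by (field; nra).
  assert (HE : K = eps * (K / eps)) by (field; lra).
  rewrite HE at 1. apply Rmult_lt_compat_l; [easy|]. nra.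
Qed.

(** * The integrals of w^-s e(-mu/w - w) over Im w = 1 *)

(* On the line [w = u + i]: [vinv u] is [1/w], [wave u] is [e(-w)] and
   [kern s mu u] is [w^-s e(-mu/w - w)]. *)
Definition vinv (u : R) : C := Cinv (u, 1).
Definition wave (u : R) : C := cexp2pi (Copp (u, 1)).
Definition kern0 (s : nat) (u : R) : C := Cmult (Cpow (vinv u) s) (wave u).
Definition kern (s : nat) (mu u : R) : C :=
  Cmult (cexp2pi (Copp (Cmult (RtoC mu) (vinv u)))) (kern0 s u).

Lemma line_neq_0 (u : R) : ((u, 1) : C) <> RtoC 0.
Proof. intros H. injection H. lra. Qed.

Lemma Re_vinv (u : R) : Re (vinv u) = u / (1 + u ^ 2).
Proof. unfold vinv, Re; simpl. f_equal. ring. Qed.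

Lemma Im_vinv (u : R) : Im (vinv u) = - 1 / (1 + u ^ 2).
Proof. unfold vinv, Im; simpl. f_equal. ring. Qed.

Lemma Cmod_vinv_sq (u : R) : Cmod (vinv u) ^ 2 = / (1 + u ^ 2).
Proof. rewrite Cmod2_alt, Re_vinv, Im_vinv. field. nra. Qed.

Lemma Cmod_vinv_le_1 (u : R) : Cmod (vinv u) <= 1.
Proof.
  pose proof (Cmod_vinv_sq u) as H. pose proof (Cmod_ge_0 (vinv u)).
  assert (/ (1 + u ^ 2) <= 1) by (rewrite <- Rinv_1 at 2; apply Rinv_le_contravar; nra).
  nra.
Qed.

Lemma pow_le_1 (x : R) (n : nat) : 0 <= x <= 1 -> 0 <= x ^ n <= 1.
Proof.
  intros Hx. split; [now apply pow_le|]. rewrite <- (pow1 n). now apply pow_incr.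
Qed.

Lemma Cmod_vinv_pow (s : nat) (u : R) : (2 <= s)%nat -> Cmod (Cpow (vinv u) s) <= / (1 + u ^ 2).
Proof.
  intros Hs. rewrite Cmod_pow. replace s with (2 + (s - 2))%nat by lia.
  rewrite pow_add, Cmod_vinv_sq.
  destruct (pow_le_1 (Cmod (vinv u)) (s - 2)) as [H1 H2].
  { split; [apply Cmod_ge_0|apply Cmod_vinv_le_1]. }
  rewrite <- Rmult_1_r. apply Rmult_le_compat_l; [|easy].
  left. apply Rinv_0_lt_compat. nra.
Qed.

Lemma Cmod_wave (u : R) : Cmod (wave u) = exp (2 * PI).
Proof. unfold wave. rewrite Cmod_cexp2pi. f_equal. simpl. ring. Qed.

Lemma Cmod_kern0 (s : nat) (u : R) : (2 <= s)%nat ->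
  Cmod (kern0 s u) <= exp (2 * PI) / (1 + u ^ 2).
Proof.
  intros Hs. unfold kern0. rewrite Cmod_mult, Cmod_wave, Rmult_comm.
  apply Rmult_le_compat_l; [left; apply exp_pos|now apply Cmod_vinv_pow].
Qed.

(** For Im w > 0 and mu >= 0 the point -mu/w has nonnegative imaginary part, so e(-mu/w) has modulus
    at most 1. This makes the later bounds independent of mu. *)
Lemma Cmod_kern_le (s : nat) (mu u : R) : 0 <= mu ->
  Cmod (kern s mu u) <= Cmod (kern0 s u).
Proof.
  intros Hmu. unfold kern. rewrite Cmod_mult, Cmod_cexp2pi.
  rewrite <- (Rmult_1_l (Cmod (kern0 s u))) at 2.
  apply Rmult_le_compat_r; [apply Cmod_ge_0|].
  rewrite <- exp_0.
  assert (H : Im (Copp (Cmult (RtoC mu) (vinv u))) = mu * / (1 + u ^ 2)).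
  { change (Im (Copp (Cmult (RtoC mu) (vinv u)))) with
      (- (mu * Im (vinv u) + 0 * Re (vinv u))).
    rewrite Im_vinv. field. nra. }
  rewrite H.
  assert (0 < / (1 + u ^ 2)) by (apply Rinv_0_lt_compat; nra).
  assert (Hle : - (2 * PI * (mu * / (1 + u ^ 2))) <= 0).
  { pose proof PI_RGT_0. assert (0 <= mu * / (1 + u ^ 2)) by nra. nra. }
  now apply exp_monotone.
Qed.

Lemma Cder_line (u : R) : Cder (fun x => (x, 1) : C) u (RtoC 1).
Proof.
  split; [apply (is_derive_id (K := R_AbsRing))|exact (is_derive_const 1 u)].
Qed.

Lemma Cder_vinv (u : R) : Cder vinv u (Copp (Cpow (vinv u) 2)).
Proof.
  split.
  - apply is_derive_ext with (fun x => x / (1 + x ^ 2)); [intros; now rewrite Re_vinv|].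
    evar_last; [auto_derive; [nra|reflexivity]|].
    change (Re (Copp (Cpow (vinv u) 2))) with
      (- (Re (vinv u) * (Re (vinv u) * 1 - Im (vinv u) * 0) -
          Im (vinv u) * (Re (vinv u) * 0 + Im (vinv u) * 1))).
    rewrite Re_vinv, Im_vinv. field. nra.
  - apply is_derive_ext with (fun x => - 1 / (1 + x ^ 2)); [intros; now rewrite Im_vinv|].
    evar_last; [auto_derive; [nra|reflexivity]|].
    change (Im (Copp (Cpow (vinv u) 2))) with
      (- (Re (vinv u) * (Re (vinv u) * 0 + Im (vinv u) * 1) +
          Im (vinv u) * (Re (vinv u) * 1 - Im (vinv u) * 0))).
    rewrite Re_vinv, Im_vinv. field. nra.
Qed.

Lemma Cder_vinv_pow (s : nat) (u : R) :
  Cder (fun x => Cpow (vinv x) s) u (Cmult (RtoC (- INR s)) (Cpow (vinv u) (S s))).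
Proof.
  induction s as [|s IH].
  - evar_last; [exact (Cder_const (RtoC 1) u)|]. apply injective_projections; simpl; ring.
  - simpl Cpow. evar_last.
    + apply Cder_mult; [apply Cder_vinv|apply IH].
    + rewrite S_INR. simpl Cpow.
      replace (RtoC (- (INR s + 1))) with (Cminus (RtoC (- INR s)) (RtoC 1))
        by (apply injective_projections; simpl; ring).
      ring.
Qed.

Lemma Cder_wave (u : R) : Cder wave u (Cmult (Copp (0, 2 * PI)) (wave u)).
Proof.
  evar_last.
  - apply Cder_cexp2pi. apply Cder_ext with (fun x => Cmult (RtoC (-1)) (x, 1)).
    + intros x. apply injective_projections; simpl; ring.
    + apply Cder_mult; [apply Cder_const|apply Cder_line].
  - fold (wave u). apply injective_projections; simpl; ring.
Qed.

Lemma Ccont_vinv : Ccont vinv.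
Proof. apply Cder_cont with (1 := Cder_vinv). Qed.

Lemma Ccont_wave : Ccont wave.
Proof. apply Cder_cont with (1 := Cder_wave). Qed.

Lemma Ccont_kern0 (s : nat) : Ccont (kern0 s).
Proof. apply Ccont_mult; [apply Ccont_pow, Ccont_vinv|apply Ccont_wave]. Qed.

Lemma Ccont_kern (s : nat) (mu : R) : Ccont (kern s mu).
Proof.
  apply Ccont_mult; [|apply Ccont_kern0].
  apply Ccont_cexp2pi, Ccont_opp, Ccont_mult; [apply Ccont_const|apply Ccont_vinv].
Qed.

Lemma Ccont_scal (c : C) (f : R -> C) : Ccont f -> Ccont (fun x => Cmult c (f x)).
Proof. intros H. exact (Ccont_mult (fun _ => c) f (Ccont_const c) H). Qed.

(** Hankel's integral for 1/Gamma; for s >= 2 its classical value is (-2 pi i)^s/(s-1)!. Picking it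
    by [epsilon] is harmless because [line_int] determines its value. *)
Definition hankel (s : nat) : C := epsilon (inhabits (RtoC 0)) (line_int (kern0 s)).

Lemma hankel_spec (s : nat) : (2 <= s)%nat -> line_int (kern0 s) (hankel s).
Proof.
  intros Hs. unfold hankel. apply epsilon_spec.
  apply line_int_exists with (exp (2 * PI)); [apply Ccont_kern0|].
  intros u. now apply Cmod_kern0.
Qed.

Lemma hankel_S (s : nat) : (2 <= s)%nat ->
  Cmult (RtoC (INR s)) (hankel (S s)) = Cmult (Copp (0, 2 * PI)) (hankel s).
Proof.
  intros Hs.
  pose proof (Ccont_scal (RtoC (- INR s)) _ (Ccont_kern0 (S s))) as C1.
  pose proof (Ccont_scal (Copp (0, 2 * PI)) _ (Ccont_kern0 s)) as C2.
  assert (H0 : line_int (fun u => Cplus (Cmult (RtoC (- INR s)) (kern0 (S s) u))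
    (Cmult (Copp (0, 2 * PI)) (kern0 s u))) (RtoC 0)).
  { apply (line_int_derive (kern0 s)).
    - intros u. evar_last.
      + apply Cder_mult; [apply Cder_vinv_pow|apply Cder_wave].
      + unfold kern0. ring.
    - exact (Ccont_plus _ _ C1 C2).
    - apply Clim_0_of_bound with (exp (2 * PI)). intros u. now apply Cmod_kern0.
    - apply Clim_0_of_bound with (exp (2 * PI)). intros u.
      replace (u ^ 2) with ((- u) ^ 2) by ring. now apply Cmod_kern0. }
  assert (H1 : line_int (fun u => Cplus (Cmult (RtoC (- INR s)) (kern0 (S s) u))
    (Cmult (Copp (0, 2 * PI)) (kern0 s u)))
    (Cplus (Cmult (RtoC (- INR s)) (hankel (S s))) (Cmult (Copp (0, 2 * PI)) (hankel s)))).
  { apply line_int_plus; [exact C1|exact C2| |].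
    - apply line_int_scal; [apply Ccont_kern0|apply hankel_spec; lia].
    - apply line_int_scal; [apply Ccont_kern0|apply hankel_spec; lia]. }
  pose proof (line_int_unique _ _ _ (Ccont_plus _ _ C1 C2) H0 H1) as E.
  rewrite <- (Cplus_0_r (Cmult (RtoC (INR s)) (hankel (S s)))), E.
  apply injective_projections; simpl; ring.
Qed.

Lemma Cmod_hankel_S (s : nat) : (2 <= s)%nat ->
  INR s * Cmod (hankel (S s)) = 2 * PI * Cmod (hankel s).
Proof.
  intros Hs. pose proof (f_equal Cmod (hankel_S s Hs)) as H.
  rewrite !Cmod_mult, Cmod_opp, Cmod_2pi_i, Cmod_R, Rabs_pos_eq in H by apply pos_INR. easy.
Qed.

(** Iterating [hankel_S] produces the factor n!/(n+j)!, which becomes the j-th coefficient of the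
    Bessel series once divided by j!. *)
Lemma hankel_shift (n j : nat) : (1 <= n)%nat ->
  hankel (S n + j) =
  Cmult (Cmult (RtoC (INR (fact n) / INR (fact (n + j)))) (Cpow (Copp (0, 2 * PI)) j))
    (hankel (S n)).
Proof.
  intros Hn. induction j as [|j IH].
  - rewrite !Nat.add_0_r. pose proof (INR_fact_pos n).
    replace (INR (fact n) / INR (fact n)) with 1 by (field; lra). simpl. ring.
  - replace (S n + S j)%nat with (S (S n + j)) by lia.
    replace (n + S j)%nat with (S (n + j)) by lia. rewrite INR_fact_S.
    pose proof (INR_fact_pos n). pose proof (INR_fact_pos (n + j)). pose proof (pos_INR (n + j)).
    assert (HS : INR (S n + j) = INR (n + j) + 1) by (rewrite <- S_INR; f_equal; lia).
    pose proof (hankel_S (S n + j) ltac:(lia)) as E. rewrite IH, HS in E.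
    assert (Hnz : RtoC (INR (n + j) + 1) <> RtoC 0) by (intros Z; injection Z; lra).
    replace (hankel (S (S n + j))) with (Cmult (Cinv (RtoC (INR (n + j) + 1)))
      (Cmult (RtoC (INR (n + j) + 1)) (hankel (S (S n + j))))) by (field; easy).
    rewrite E. simpl Cpow. rewrite <- RtoC_inv by lra.
    replace (INR (fact n) / ((INR (n + j) + 1) * INR (fact (n + j)))) with
      (/ (INR (n + j) + 1) * (INR (fact n) / INR (fact (n + j)))) by (field; lra).
    rewrite (RtoC_mult (/ _)). ring.
Qed.

Lemma Csum_ext (f g : nat -> C) (n : nat) :
  (forall i, (i < n)%nat -> f i = g i) -> Csum f n = Csum g n.
Proof.
  intros E. induction n as [|n IH]; simpl; [easy|].
  rewrite IH, E; [easy|lia|]. intros i Hi. apply E. lia.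
Qed.

Lemma Csum_scal (c : C) (f : nat -> C) (n : nat) :
  Csum (fun i => Cmult c (f i)) n = Cmult c (Csum f n).
Proof. induction n as [|n IH]; simpl; [ring|rewrite IH; ring]. Qed.

Lemma Csum_RtoC (f : nat -> R) (n : nat) :
  Csum (fun i => RtoC (f i)) (S n) = RtoC (sum_n f n).
Proof.
  induction n as [|n IH].
  - rewrite sum_O. simpl. ring.
  - change (Csum (fun i => RtoC (f i)) (S (S n))) with
      (Cplus (Csum (fun i => RtoC (f i)) (S n)) (RtoC (f (S n)))).
    rewrite IH, sum_Sn, <- RtoC_plus. easy.
Qed.

Lemma Clim_seq_of_real (f : nat -> C) (l : C) (r : nat -> R) :
  (forall n, Cmod (Cminus (f n) l) <= r n) -> is_lim_seq r 0 -> Clim eventually f l.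
Proof.
  intros B H eps He. apply is_lim_seq_spec in H.
  generalize (H (mkposreal eps He)). apply filter_imp. intros n Hn. simpl in Hn.
  apply Rabs_def2 in Hn. specialize (B n). lra.
Qed.

Lemma is_lim_seq_pow_fact (c x : R) : is_lim_seq (fun n => c * (x ^ n / INR (fact n))) 0.
Proof.
  replace (Finite 0) with (Rbar_mult c 0) by (simpl; f_equal; ring).
  apply is_lim_seq_scal_l. apply is_lim_seq_Reals.
  apply (cv_speed_pow_fact x).
Qed.

Lemma Clim_unique {T : Type} (F : (T -> Prop) -> Prop) {FF : ProperFilter F}
  (f : T -> C) (l m : C) : Clim F f l -> Clim F f m -> l = m.
Proof.
  intros Hl Hm. pose proof (Clim_minus F _ _ _ _ Hl Hm) as H.
  assert (B : Cmod (Cminus l m) <= 0).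
  { apply (Clim_bound F) with (1 := H). apply filter_forall. intros x.
    replace (Cminus (f x) (f x)) with (RtoC 0) by ring. rewrite Cmod_0. lra. }
  pose proof (Cmod_ge_0 (Cminus l m)).
  assert (E : Cminus l m = RtoC 0) by (apply Cmod_eq_0; lra).
  replace l with (Cplus (Cminus l m) m) by ring. rewrite E. ring.
Qed.

(* Expand [e(-mu/w)] in powers of [1/w] and integrate term by term. *)
Lemma line_int_kern (n : nat) (mu : R) : (1 <= n)%nat -> 0 <= mu ->
  line_int (kern (S n) mu)
    (Cmult (hankel (S n)) (RtoC (bessel_series n (4 * PI ^ 2 * mu)))).
Proof.
  intros Hn Hmu. pose proof PI_RGT_0 as Hpi.
  destruct (line_int_exists (kern (S n) mu) (exp (2 * PI))) as [I HI].
  { apply Ccont_kern. }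
  { intros u. eapply Rle_trans; [now apply Cmod_kern_le|]. apply Cmod_kern0. lia. }
  set (a := Copp (0, 2 * PI)).
  set (K := exp (2 * PI * mu) * exp (2 * PI)).
  set (P := fun N => Csum (fun j => Cmult (Cmult (RtoC (1 ^ j / INR (fact j)))
      (Cpow (Cmult a (RtoC mu)) j)) (hankel (S n + j))) N).
  (* On the line |1/w| <= 1, so the Taylor remainder of e(-mu/w) is bounded uniformly in u.
     Multiplied by |w^-s e(-w)| <= exp(2 pi)/(1+u^2), it can be integrated with [line_int_bound]. *)
  assert (Happ : forall N, Cmod (Cminus (P N) I) <=
    (2 * PI * K) * ((4 * PI * mu) ^ N / INR (fact N))).
  { intros N.
    set (p := fun u => Csum (fun j => Cmult (Cmult (RtoC (1 ^ j / INR (fact j)))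
      (Cpow (Cmult a (RtoC mu)) j)) (kern0 (S n + j) u)) N).
    assert (Cp : Ccont p).
    { apply (Ccont_Csum (fun j u => Cmult (Cmult (RtoC (1 ^ j / INR (fact j)))
      (Cpow (Cmult a (RtoC mu)) j)) (kern0 (S n + j) u))). intros j.
      apply Ccont_scal, Ccont_kern0. }
    assert (Hp : line_int p (P N)).
    { apply (line_int_Csum (fun j u => Cmult (Cmult (RtoC (1 ^ j / INR (fact j)))
      (Cpow (Cmult a (RtoC mu)) j)) (kern0 (S n + j) u))).
      - intros j. apply Ccont_scal, Ccont_kern0.
      - intros j. apply line_int_scal; [apply Ccont_kern0|]. apply hankel_spec. lia. }
    assert (Hd : line_int (fun u => Cplus (p u) (Cmult (RtoC (-1)) (kern (S n) mu u)))
      (Cplus (P N) (Cmult (RtoC (-1)) I))).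
    { apply line_int_plus; [easy| |easy|].
      - apply Ccont_scal, Ccont_kern.
      - apply line_int_scal; [apply Ccont_kern|easy]. }
    replace (Cminus (P N) I) with (Cplus (P N) (Cmult (RtoC (-1)) I))
      by (apply injective_projections; simpl; ring).
    replace (2 * PI * K * _) with (2 * PI * (K * ((4 * PI * mu) ^ N / INR (fact N)))) by ring.
    apply line_int_bound with (3 := Hd).
    { apply Ccont_plus; [easy|]. apply Ccont_scal, Ccont_kern. }
    intros u. set (z := Copp (Cmult (RtoC mu) (vinv u))).
    assert (E : Cplus (p u) (Cmult (RtoC (-1)) (kern (S n) mu u)) =
      Copp (Cmult (exp_rem z N 1) (kern0 (S n) u))).
    { unfold exp_rem, exp_partial, kern, p. fold z. rewrite Cmult_1_l.
      transitivity (Cminus (Cmult (kern0 (S n) u) (Csum (fun j => Cmult (RtoC (1 ^ j / INR (fact j)))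
        (Cpow (Cmult (0, 2 * PI) z) j)) N)) (Cmult (cexp2pi z) (kern0 (S n) u))); [|ring].
      rewrite <- Csum_scal.
      replace (Csum (fun j => Cmult (kern0 (S n) u) _) N) with
        (Csum (fun j => Cmult (Cmult (RtoC (1 ^ j / INR (fact j)))
          (Cpow (Cmult a (RtoC mu)) j)) (kern0 (S n + j) u)) N).
      { apply injective_projections; simpl; ring. }
      apply Csum_ext. intros j _. unfold kern0. rewrite Cpow_add_r.
      replace (Cmult (0, 2 * PI) z) with (Cmult (Cmult a (RtoC mu)) (vinv u))
        by (unfold a, z; ring).
      rewrite (Cpow_mult_l _ (vinv u)). ring. }
    rewrite E, Cmod_opp, Cmod_mult.
    pose proof (exp_rem_bound z N 1 ltac:(lra)) as Hr. rewrite pow1 in Hr.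
    assert (Hz : 0 <= Cmod z <= mu).
    { split; [apply Cmod_ge_0|]. unfold z. rewrite Cmod_opp, Cmod_mult, Cmod_R, Rabs_pos_eq by easy.
      pose proof (Cmod_vinv_le_1 u). nra. }
    pose proof (INR_fact_pos N) as HF.
    assert (Hr' : Cmod (exp_rem z N 1) <= exp (2 * PI * mu) * ((4 * PI * mu) ^ N / INR (fact N))).
    { eapply Rle_trans; [exact Hr|]. rewrite Rmult_assoc. apply Rmult_le_compat.
      - left. apply exp_pos.
      - apply Rmult_le_pos; [apply pow_le; nra|]. left. apply Rdiv_lt_0_compat; lra.
      - apply exp_monotone. nra.
      - unfold Rdiv. rewrite Rmult_1_l. apply Rmult_le_compat_r.
        + left. now apply Rinv_0_lt_compat.
        + apply pow_incr. nra. }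
    replace (K * ((4 * PI * mu) ^ N / INR (fact N)) / (1 + u ^ 2)) with
      (exp (2 * PI * mu) * ((4 * PI * mu) ^ N / INR (fact N)) * (exp (2 * PI) / (1 + u ^ 2)))
      by (unfold K; field; split; (lra || nra)).
    apply Rmult_le_compat; try apply Cmod_ge_0; [easy|]. apply Cmod_kern0. lia. }
  assert (L1 : Clim eventually P I).
  { apply Clim_seq_of_real with (1 := Happ). apply is_lim_seq_pow_fact. }
  (* The shift to S N matches [sum_n _ N], which has N + 1 terms. The argument of the Bessel series
     arises as (-2 pi i)^2 mu = -4 pi^2 mu. *)
  assert (L2 : Clim eventually (fun N => P (S N))
    (Cmult (hankel (S n)) (RtoC (bessel_series n (4 * PI ^ 2 * mu))))).
  { apply Clim_ext with (fun N => Cmult (hankel (S n))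
      (RtoC (sum_n (bessel_term n (4 * PI ^ 2 * mu)) N))); [typeclasses eauto| |].
    - intros N. rewrite <- Csum_RtoC, <- Csum_scal. apply Csum_ext. intros j _.
      rewrite hankel_shift by easy. rewrite pow1. fold a.
      unfold bessel_term.
      replace (RtoC (INR (fact n) / (INR (fact j) * INR (fact (n + j))) * (- (4 * PI ^ 2 * mu)) ^ j))
        with (Cmult (Cmult (RtoC (1 / INR (fact j))) (RtoC (INR (fact n) / INR (fact (n + j)))))
          (Cmult (Cpow (Cmult a (RtoC mu)) j) (Cpow a j))).
      { ring. }
      rewrite <- Cpow_mult_l.
      replace (Cmult (Cmult a (RtoC mu)) a) with (RtoC (- (4 * PI ^ 2 * mu))).
      + rewrite <- RtoC_pow, <- !RtoC_mult. f_equal.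
        pose proof (INR_fact_pos j). pose proof (INR_fact_pos (n + j)). field. lra.
      + unfold a. apply injective_projections; simpl; ring.
    - apply (Clim_scal eventually). intros eps He.
      assert (Hs : is_lim_seq (sum_n (bessel_term n (4 * PI ^ 2 * mu)))
        (bessel_series n (4 * PI ^ 2 * mu))).
      { apply (Series_correct (bessel_term n (4 * PI ^ 2 * mu))), ex_bessel.
        apply Rmult_le_pos; [nra|easy]. }
      apply is_lim_seq_spec in Hs. generalize (Hs (mkposreal eps He)). apply filter_imp.
      intros N HN. rewrite <- RtoC_minus, Cmod_R. exact HN. }
  assert (L3 : Clim eventually (fun N => P (S N)) I).
  { apply (Clim_comp eventually eventually S P); [|exact L1].
    apply eventually_subseq. intros; lia. }
  rewrite <- (Clim_unique eventually _ _ _ L3 L2). exact HI.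
Qed.

(** * Non-vanishing and smallness of J *)

Definition polar (r theta : R) : C := (r * cos theta, r * sin theta).

Lemma polar_mult (r s a b : R) : Cmult (polar r a) (polar s b) = polar (r * s) (a + b).
Proof.
  unfold polar. rewrite cos_plus, sin_plus. apply injective_projections; simpl; ring.
Qed.

Lemma polar_pow (r a : R) (n : nat) : Cpow (polar r a) n = polar (r ^ n) (INR n * a).
Proof.
  induction n as [|n IH].
  - unfold polar. simpl. rewrite Rmult_0_l, cos_0, sin_0.
    apply injective_projections; simpl; ring.
  - simpl Cpow. rewrite IH, polar_mult, S_INR. simpl. f_equal. ring.
Qed.

Lemma vinv_polar (u : R) : vinv u = polar (/ sqrt (1 + u ^ 2)) (atan u - PI / 2).
Proof.
  assert (Hp : 0 < 1 + u ^ 2) by nra.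
  pose proof (sqrt_lt_R0 _ Hp) as Hs. pose proof (sqrt_sqrt _ (Rlt_le _ _ Hp)) as Hq.
  unfold polar.
  rewrite cos_minus, sin_minus, cos_PI2, sin_PI2, cos_atan, sin_atan.
  replace (1 + u²) with (1 + u ^ 2) by (unfold Rsqr; ring).
  rewrite (surjective_pairing (vinv u)). f_equal.
  - change (fst (vinv u)) with (Re (vinv u)). rewrite Re_vinv.
    set (r := sqrt (1 + u ^ 2)) in *. rewrite <- Hq. field. lra.
  - change (snd (vinv u)) with (Im (vinv u)). rewrite Im_vinv.
    set (r := sqrt (1 + u ^ 2)) in *. rewrite <- Hq. field. lra.
Qed.

(* The exponent 8 is chosen because the phase of [w^-8 e(-w)] is then nearly
   stationary on [0 <= u <= 1/2], where most of the mass of the integrand lies. *)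
Definition phase (u : R) : R := 8 * atan u - 2 * PI * u.

Lemma Re_kern0_8 (u : R) : Re (kern0 8 u) = exp (2 * PI) * (/ (1 + u ^ 2) ^ 4 * cos (phase u)).
Proof.
  unfold kern0. rewrite vinv_polar, polar_pow.
  assert (Hw : wave u = polar (exp (2 * PI)) (- (2 * PI * u))).
  { unfold wave, cexp2pi, polar, Re, Im; simpl.
    replace (2 * PI * - u) with (- (2 * PI * u)) by ring.
    replace (- (2 * PI * - (1))) with (2 * PI) by ring. easy. }
  rewrite Hw, polar_mult. unfold polar, Re; cbn [fst].
  (* Eight times the constant phase -pi/2 is -4 pi, which drops out. What remains is an odd phase,
     hence an even real part. *)
  replace (INR 8 * (atan u - PI / 2) + - (2 * PI * u)) with
    (phase u - 2 * PI - 2 * PI) by (unfold phase; simpl INR; field).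
  replace (cos (phase u - 2 * PI - 2 * PI)) with (cos (phase u)).
  - assert (Hp : 0 < 1 + u ^ 2) by nra.
    pose proof (sqrt_lt_R0 _ Hp) as Hs. pose proof (sqrt_sqrt _ (Rlt_le _ _ Hp)) as Hq.
    replace ((/ sqrt (1 + u ^ 2)) ^ 8) with (/ (1 + u ^ 2) ^ 4); [ring|].
    set (r := sqrt (1 + u ^ 2)) in *. rewrite <- Hq. field. lra.
  - rewrite <- (cos_period (phase u - 2 * PI - 2 * PI) 2). f_equal. simpl. ring.
Qed.

(** On [0, 1/2] the derivative 8/(1+x^2) - 2 pi lies between 32/5 - 2 pi and 8 - 2 pi, and 3 < pi <=
    4 puts both within [-2, 2]. *)
Lemma phase_bound (u : R) : 0 <= u <= 1 / 2 -> Rabs (phase u) <= 2 * u.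
Proof.
  intros Hu. pose proof PI_4 as Hpi4. pose proof PI2_3_2 as Hpi3.
  assert (H : Rabs (phase u - phase 0) <= 2 * u - 2 * 0).
  { apply (increment_bound phase (fun x => 2 * x) (fun x => 8 * / (1 + x ^ 2) - 2 * PI)
      (fun _ => 2)); [lra| | |].
    - intros x _. unfold phase. apply (is_derive_minus (fun x => 8 * atan x) (fun x => 2 * PI * x)).
      + apply (is_derive_scal atan). apply is_derive_Reals, Ratan.derivable_pt_lim_atan.
      + evar_last; [apply (is_derive_scal (fun x => x)), is_derive_id|].
        unfold one; simpl; ring.
    - intros x _. evar_last; [apply (is_derive_scal (fun x => x)), is_derive_id|].
      unfold one; simpl; ring.
    - intros x Hx. assert (0 <= x <= 1 / 2) by lra.
      assert (H1 : / (1 + x ^ 2) <= 1) by (rewrite <- Rinv_1; apply Rinv_le_contravar; nra).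
      assert (H2 : / (5 / 4) <= / (1 + x ^ 2)) by (apply Rinv_le_contravar; nra).
      apply Rabs_le. lra. }
  assert (Z : phase 0 = 0) by (unfold phase; rewrite atan_0; ring).
  rewrite Z in H. replace (phase u) with (phase u - 0) by ring. lra.
Qed.

Lemma phase_opp (u : R) : phase (- u) = - phase u.
Proof. unfold phase. rewrite atan_opp. ring. Qed.

Lemma cos_ge_quadratic (x : R) : 1 - x ^ 2 / 2 <= cos x.
Proof.
  pose proof (cos_2a_sin (x / 2)) as H. replace (2 * (x / 2)) with x in H by field.
  assert (Hs : Rabs (sin (x / 2)) <= Rabs (x / 2)).
  { destruct (MVT_abs sin cos 0 (x / 2)) as [c [E _]].
    - intros c _. apply derivable_pt_lim_sin.
    - rewrite sin_0, !Rminus_0_r in E. rewrite E.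
      pose proof (Rabs_pos (x / 2)).
      assert (Rabs (cos c) <= 1) by (apply Rabs_le; pose proof (COS_bound c); lra).
      nra. }
  apply Rsqr_le_abs_1 in Hs. unfold Rsqr in Hs. rewrite H. nra.
Qed.

Definition core (u : R) : R := / (1 + u ^ 2) ^ 4 * cos (phase u).

Lemma core_opp (u : R) : core (- u) = core u.
Proof.
  unfold core. rewrite phase_opp, cos_neg. replace ((- u) ^ 2) with (u ^ 2) by ring. easy.
Qed.

(** With y = u^2 <= 1/4, the two factors are at least 1 - 4y and 1 - 2y. Both lower bounds are
    nonnegative, so they may be multiplied. *)
Lemma core_near (u : R) : 0 <= u <= 1 / 2 -> 1 - 6 * u ^ 2 <= core u.
Proof.
  intros Hu. unfold core.
  assert (Hy : 0 <= u ^ 2 <= 1 / 4) by nra. set (y := u ^ 2) in *.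
  assert (Hc : 1 - 2 * y <= cos (phase u)).
  { eapply Rle_trans; [|apply cos_ge_quadratic].
    pose proof (phase_bound u Hu) as H.
    assert (phase u ^ 2 <= 4 * y); [|lra].
    unfold y. rewrite <- pow2_abs. pose proof (Rabs_pos (phase u)). nra. }
  assert (Hi : 1 - 4 * y <= / (1 + y) ^ 4).
  { assert (0 < (1 + y) ^ 4) by (apply pow_lt; lra).
    apply Rmult_le_reg_r with ((1 + y) ^ 4); [easy|]. rewrite Rinv_l by lra.
    assert (H1 : (1 - 4 * y) * (1 + y) ^ 4 = 1 - y ^ 2 * (10 + 20 * y + 15 * y ^ 2 + 4 * y ^ 3)) by ring.
    rewrite H1. assert (0 <= y ^ 2) by nra. assert (0 <= y ^ 3) by (apply pow_le; lra). nra. }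
  assert (1 - 6 * y <= (1 - 4 * y) * (1 - 2 * y)) by nra.
  assert ((1 - 4 * y) * (1 - 2 * y) <= / (1 + y) ^ 4 * cos (phase u)) by (apply Rmult_le_compat; lra).
  lra.
Qed.

(** 1 + u^2 >= u + 3/4 is the tangent line at u = 1/2; it turns the majorant into a pure power with
    an elementary antiderivative. *)
Lemma core_far (u : R) : 0 <= u -> Rabs (core u) <= / (u + 3 / 4) ^ 4.
Proof.
  intros Hu. unfold core. rewrite Rabs_mult.
  assert (Hp : 0 < (1 + u ^ 2) ^ 4) by (apply pow_lt; nra).
  rewrite (Rabs_pos_eq (/ _)) by (left; now apply Rinv_0_lt_compat).
  rewrite <- (Rmult_1_r (/ (u + 3 / 4) ^ 4)).
  apply Rmult_le_compat; [left; now apply Rinv_0_lt_compat|apply Rabs_pos| |].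
  - apply Rinv_le_contravar; [apply pow_lt; lra|]. apply pow_incr.
    pose proof (pow2_ge_0 (u - 1 / 2)). lra.
  - apply Rabs_le. apply COS_bound.
Qed.

Lemma continuous_core (u : R) : continuous core u.
Proof.
  assert (E : forall x, / exp (2 * PI) * Re (kern0 8 x) = core x).
  { intros x. rewrite Re_kern0_8. unfold core. pose proof (exp_pos (2 * PI)). field.
    split; [nra|lra]. }
  apply (continuous_ext (fun x => / exp (2 * PI) * Re (kern0 8 x))); [exact E|].
  apply continuous_scal_R. exact (proj1 (Ccont_kern0 8) u).
Qed.

(** The part over [0, 1/2] is at least 1/2 - 2/8 = 1/4, and the rest has modulus at most 1/(3
    (5/4)^3) = 64/375. The difference exceeds 1/20. *)
Lemma RInt_core (u : R) : 1 / 2 <= u -> 1 / 20 <= RInt core 0 u.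
Proof.
  intros Hu.
  assert (H1 : (fun x => x - 2 * x ^ 3) (1 / 2) - (fun x => x - 2 * x ^ 3) 0 <=
    RInt core 0 (1 / 2) - RInt core 0 0).
  { apply (increment_le (fun x => x - 2 * x ^ 3) (RInt core 0) (fun x => 1 - 6 * x ^ 2) core);
      [lra| | |].
    - intros x _. auto_derive; [easy|ring].
    - intros x _. apply is_derive_RInt_cont, continuous_core.
    - intros x Hx. now apply core_near. }
  assert (H2 : Rabs (RInt core 0 u - RInt core 0 (1 / 2)) <=
    (fun x => - / (3 * (x + 3 / 4) ^ 3)) u - (fun x => - / (3 * (x + 3 / 4) ^ 3)) (1 / 2)).
  { apply (increment_bound (RInt core 0) (fun x => - / (3 * (x + 3 / 4) ^ 3)) core (fun x => / (x + 3 / 4) ^ 4)); [easy| | |].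
    - intros x _. apply is_derive_RInt_cont, continuous_core.
    - intros x Hx. assert (0 < x + 3 / 4) by lra.
      auto_derive; [|field; lra].
      apply Rmult_integral_contrapositive_currified; [lra|].
      apply (pow_nonzero (x + 3 / 4) 3). lra.
    - intros x Hx. apply core_far. lra. }
  rewrite RInt_point in H1. unfold zero in H1; simpl in H1.
  assert (H3 : 0 < / (3 * (u + 3 / 4) ^ 3)).
  { apply Rinv_0_lt_compat. apply Rmult_lt_0_compat; [lra|]. apply pow_lt. lra. }
  apply Rabs_le_between in H2. cbv beta in H2.
  assert (H4 : / (3 * (1 / 2 + 3 / 4) ^ 3) = 64 / 375) by field.
  rewrite H4 in H2. lra.
Qed.

(** Since [core] is even, both half-lines contribute a positive real part, at least exp(2 pi)/20
    each. *)
Lemma hankel_8 : hankel 8 <> RtoC 0.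
Proof.
  destruct (hankel_spec 8 ltac:(lia)) as [p [m [Hp [Hm E]]]].
  pose proof (exp_pos (2 * PI)) as He.
  assert (R0 : forall a b, Re (Cint (kern0 8) a b) = exp (2 * PI) * RInt core a b).
  { intros a b. unfold Cint. simpl.
    transitivity (RInt (fun x => exp (2 * PI) * core x) a b).
    - apply RInt_ext. intros x _. apply Re_kern0_8.
    - apply (RInt_scal (V := R_CompleteNormedModule)). apply ex_RInt_cont, continuous_core. }
  assert (Hp' : exp (2 * PI) * (1 / 20) <= Re p).
  { apply (Clim_Re_ge pinf) with (1 := Hp). exists 1. intros u Hu.
    rewrite R0. apply Rmult_le_compat_l; [lra|]. apply RInt_core. lra. }
  assert (Hm' : exp (2 * PI) * (1 / 20) <= Re (Copp m)).
  { apply (Clim_Re_ge pinf) with (fun u => Copp (Cint (kern0 8) 0 (- u))).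
    - replace (Copp m) with (Cmult (RtoC (-1)) m) by (apply injective_projections; simpl; ring).
      apply (Clim_ext pinf) with (fun u => Cmult (RtoC (-1)) (Cint (kern0 8) 0 (- u))).
      + intros u. apply injective_projections; simpl; ring.
      + now apply (Clim_scal pinf).
    - exists 1. intros u Hu.
      change (Re (Copp (Cint (kern0 8) 0 (- u)))) with (- Re (Cint (kern0 8) 0 (- u))).
      rewrite R0.
      assert (S : RInt core 0 (- u) = - RInt core 0 u).
      { replace 0 with (- (1) * 0 + 0) at 1 by ring.
        replace (- u) with (- (1) * u + 0) by ring.
        rewrite <- (RInt_comp_lin (V := R_CompleteNormedModule) core (- (1)) 0 0 u).
        - rewrite <- (RInt_opp (V := R_CompleteNormedModule) core).
          + apply RInt_ext. intros x _.
            replace (- (1) * x + 0) with (- x) by ring. rewrite core_opp.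
            unfold scal, opp; simpl. unfold mult; simpl. ring.
          + apply ex_RInt_cont, continuous_core.
        - apply ex_RInt_cont, continuous_core. }
      rewrite S. ring_simplify. apply Rmult_le_compat_l; [lra|]. apply RInt_core. lra. }
  intros Z. rewrite Z in E. apply (f_equal Re) in E. simpl in E. unfold Re in *. simpl in *. lra.
Qed.

Lemma hankel_neq_0 (s : nat) : (8 <= s)%nat -> hankel s <> RtoC 0.
Proof.
  induction s as [|s IH]; intros Hs; [lia|].
  destruct (Nat.eq_dec s 7) as [->|Hn]; [apply hankel_8|].
  intros Z. pose proof (Cmod_hankel_S s ltac:(lia)) as H.
  rewrite Z, Cmod_0, Rmult_0_r in H. pose proof PI_RGT_0.
  pose proof (proj1 (Cmod_gt_0 _) (IH ltac:(lia))). nra.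
Qed.

Lemma hankel_small : exists s0, forall s, (s0 <= s)%nat -> Cmod (hankel s) < 1 / 4.
Proof.
  pose proof PI_4 as Hpi.
  (* From s = 16 on, the ratio 2 pi/s is at most 1/2 because pi <= 4. *)
  assert (H : forall n, Cmod (hankel (16 + n)) <= Cmod (hankel 16) * (1 / 2) ^ n).
  { induction n as [|n IH]; [simpl; lra|].
    replace (16 + S n)%nat with (S (16 + n)) by lia.
    pose proof (Cmod_hankel_S (16 + n) ltac:(lia)) as E.
    pose proof (Cmod_ge_0 (hankel (16 + n))). pose proof (Cmod_ge_0 (hankel (S (16 + n)))).
    assert (Hn : 16 <= INR (16 + n)) by (rewrite plus_INR; simpl; pose proof (pos_INR n); lra).
    simpl pow. nra. }
  assert (L : is_lim_seq (fun n => Cmod (hankel 16) * (1 / 2) ^ n) 0).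
  { replace (Finite 0) with (Rbar_mult (Cmod (hankel 16)) 0) by (simpl; f_equal; ring).
    apply is_lim_seq_scal_l, is_lim_seq_geom. rewrite Rabs_pos_eq; lra. }
  apply is_lim_seq_spec in L. destruct (L (mkposreal (1 / 4) ltac:(lra))) as [N HN].
  exists (16 + N)%nat. intros s Hs. specialize (HN (s - 16)%nat ltac:(lia)).
  simpl in HN. specialize (H (s - 16)%nat). replace (16 + (s - 16))%nat with s in H by lia.
  apply Rabs_def2 in HN. lra.
Qed.

(** * The summands of the Poincare series *)

(** Summation over [-M, M] ordered by absolute value, so that passing from M to M + 1 adds exactly
    the two new ends. *)
Fixpoint CZ (M : nat) (g : Z -> C) : C :=
  match M with
  | O => g 0%Z
  | S n => Cplus (CZ n g) (Cplus (g (Z.of_nat (S n))) (g (- Z.of_nat (S n))%Z))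
  end.

Lemma CZ_ext (M : nat) (f g : Z -> C) : (forall d, f d = g d) -> CZ M f = CZ M g.
Proof. intros E. induction M as [|M IH]; simpl; rewrite ?IH, !E; easy. Qed.

Lemma Csum_head (f : nat -> C) (n : nat) :
  Csum f (S n) = Cplus (f O) (Csum (fun i => f (S i)) n).
Proof.
  induction n as [|n IH]; [simpl; ring|].
  change (Csum f (S (S n))) with (Cplus (Csum f (S n)) (f (S n))). rewrite IH. simpl. ring.
Qed.

Lemma Csum_CZ (g : Z -> C) (M : nat) :
  Csum (fun i => g (Z.of_nat i - Z.of_nat M)%Z) (2 * M + 1) = CZ M g.
Proof.
  induction M as [|M IH]; [simpl; ring|].
  replace (2 * S M + 1)%nat with (S (S (2 * M + 1))) by lia.
  change (CZ (S M) g) with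
    (Cplus (CZ M g) (Cplus (g (Z.of_nat (S M))) (g (- Z.of_nat (S M))%Z))).
  rewrite <- IH.
  change (Csum ?f (S (S (2 * M + 1)))) with (Cplus (Csum f (S (2 * M + 1))) (f (S (2 * M + 1)))).
  cbv beta. rewrite Csum_head.
  replace (Z.of_nat (S (2 * M + 1)) - Z.of_nat (S M))%Z with (Z.of_nat (S M)) by lia.
  replace (Z.of_nat 0 - Z.of_nat (S M))%Z with (- Z.of_nat (S M))%Z by lia.
  rewrite (Csum_ext (fun i => g (Z.of_nat (S i) - Z.of_nat (S M))%Z)
    (fun i => g (Z.of_nat i - Z.of_nat M)%Z)).
  - ring.
  - intros i _. f_equal. lia.
Qed.

Lemma top_row_spec (c d : Z) : Z.gcd c d = 1%Z ->
  (fst (top_row c d) * d - snd (top_row c d) * c = 1)%Z.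
Proof.
  intros H. unfold top_row. apply epsilon_spec.
  destruct (rel_prime_bezout c d) as [u v E].
  { now apply Zgcd_1_rel_prime. }
  exists (v, (- u)%Z). simpl. lia.
Qed.

Lemma row_unique (a b a' b' c d : Z) :
  (a * d - b * c = 1 -> a' * d - b' * c = 1 ->
   exists t, a' = a + t * c /\ b' = b + t * d)%Z.
Proof.
  intros H H'. exists (a * (b' - b) - b * (a' - a))%Z.
  assert (E : ((a' - a) * d = (b' - b) * c)%Z) by lia.
  split.
  - assert (K : ((a' - a) * (a * d - b * c) = (a * (b' - b) - b * (a' - a)) * c)%Z).
    { replace ((a' - a) * (a * d - b * c))%Z with (a * ((a' - a) * d) - b * c * (a' - a))%Z by ring.
      rewrite E. ring. }
    rewrite H in K. lia.
  - assert (K : ((b' - b) * (a * d - b * c) = (a * (b' - b) - b * (a' - a)) * d)%Z).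
    { replace ((b' - b) * (a * d - b * c))%Z with (a * d * (b' - b) - b * ((b' - b) * c))%Z by ring.
      rewrite <- E. ring. }
    rewrite H in K. lia.
Qed.

Lemma RtoC_neq_0 (r : R) : r <> 0 -> RtoC r <> RtoC 0.
Proof. intros H E. apply H. now injection E. Qed.

(** Adding t times the bottom row to the top row adds the integer t to gamma z, and e(mt) = 1. Hence
    the row picked by [top_row] may be replaced by any convenient one. *)
Lemma poinc_term_row (k m : nat) (a b c d : Z) (z : C) : (a * d - b * c = 1)%Z ->
  0 < Im z ->
  let j := Cplus (Cmult (IZR c) z) (IZR d) in
  poinc_term k m c d z = Cmult (Cinv (Cpow j k))
    (cexp2pi (Cmult (INR m) (Cdiv (Cplus (Cmult (IZR a) z) (IZR b)) j))).
Proof.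
  intros H Hz j. unfold poinc_term. fold j. f_equal.
  assert (Hg : Z.gcd c d = 1%Z).
  { apply Zgcd_1_rel_prime, bezout_rel_prime. exists (- b)%Z a. lia. }
  destruct (row_unique a b _ _ c d H (top_row_spec c d Hg)) as [t [-> ->]].
  assert (Hj : j <> RtoC 0).
  { intros E. unfold j in E.
    assert (E2 := f_equal Im E). assert (E1 := f_equal Re E).
    destruct z as [x y]. unfold Re, Im in *. simpl in *.
    assert (Ec : IZR c = 0) by nra. rewrite Ec in E1.
    assert (Ed : IZR d = 0) by lra.
    apply eq_IZR in Ec. apply eq_IZR in Ed. subst. lia. }
  rewrite !plus_IZR, !mult_IZR, !RtoC_plus, !RtoC_mult.
  replace (Cmult (RtoC (INR m)) (Cdiv (Cplus (Cmult (Cplus (RtoC (IZR a))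
    (Cmult (RtoC (IZR t)) (RtoC (IZR c)))) z)
    (Cplus (RtoC (IZR b)) (Cmult (RtoC (IZR t)) (RtoC (IZR d))))) j)) with
    (Cplus (Cmult (RtoC (INR m)) (Cdiv (Cplus (Cmult (RtoC (IZR a)) z) (RtoC (IZR b))) j))
      (RtoC (IZR (Z.of_nat m * t)))).
  - rewrite cexp2pi_plus, cexp2pi_Z. ring.
  - rewrite mult_IZR, <- INR_IZR_INZ, RtoC_mult.
    transitivity (Cplus (Cmult (RtoC (INR m)) (Cdiv (Cplus (Cmult (RtoC (IZR a)) z) (RtoC (IZR b))) j))
      (Cdiv (Cmult (Cmult (RtoC (INR m)) (RtoC (IZR t))) j) j)).
    + f_equal. field. easy.
    + unfold j at 2. field. easy.
Qed.

(** On z = x + i the factor [wave x] is e(-z), so the integral over [0, 1] is the contribution of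
    (c, d) to the first Fourier coefficient. *)
Definition summand (k m : nat) (c d : Z) (x : R) : C :=
  Cmult (if bottom_row_ok 1 c d then poinc_term k m c d (x, 1) else RtoC 0) (wave x).

Lemma bottom_row_ok_1 (c d : Z) : bottom_row_ok 1 c d = Z.eqb (Z.gcd c d) 1.
Proof. unfold bottom_row_ok. simpl Z.of_nat. rewrite Z.mod_1_r. apply Bool.andb_true_r. Qed.

Lemma Cpow_opp_even (z : C) (k : nat) : Nat.Even k -> Cpow (Copp z) k = Cpow z k.
Proof.
  intros [h ->]. rewrite !Cpow_mult_r. f_equal. simpl. ring.
Qed.

(** (-c, -d) is the bottom row of -gamma, which acts on z as gamma does, and j^k is unchanged for
    even k. This is the source of the overall factor 2. *)
Lemma summand_opp (k m : nat) (c d : Z) (x : R) : Nat.Even k ->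
  summand k m (- c) (- d) x = summand k m c d x.
Proof.
  intros Hk. unfold summand. rewrite !bottom_row_ok_1, Z.gcd_opp_l, Z.gcd_opp_r. f_equal.
  destruct (Z.eqb_spec (Z.gcd c d) 1) as [H|H]; [|easy].
  pose proof (top_row_spec c d H) as E.
  rewrite (poinc_term_row k m (fst (top_row c d)) (snd (top_row c d)) c d) by (easy || simpl; lra).
  rewrite (poinc_term_row k m (- fst (top_row c d)) (- snd (top_row c d)) (- c) (- d))
    by (lia || simpl; lra).
  rewrite !opp_IZR, !RtoC_opp.
  set (c' := RtoC (IZR c)). set (d' := RtoC (IZR d)).
  set (a' := RtoC (IZR (fst (top_row c d)))). set (b' := RtoC (IZR (snd (top_row c d)))).
  replace (Cplus (Cmult (Copp c') (x, 1)) (Copp d')) with (Copp (Cplus (Cmult c' (x, 1)) d')) by ring.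
  rewrite Cpow_opp_even by easy. f_equal. f_equal. f_equal.
  assert (Hj : Cplus (Cmult c' (x, 1)) d' <> RtoC 0).
  { intros Z. assert (E2 := f_equal Im Z). assert (E1 := f_equal Re Z).
    unfold c', d' in *. unfold Re, Im in *. simpl in *.
    assert (Ec : IZR c = 0) by nra. rewrite Ec in E1.
    assert (Ed : IZR d = 0) by lra.
    apply eq_IZR in Ec. apply eq_IZR in Ed. subst. simpl in H. lia. }
  field. easy.
Qed.

Lemma summand_0_l (k m : nat) (d : Z) (x : R) : Nat.Even k ->
  summand k m 0 d x =
  if Z.eqb (Z.abs d) 1 then Cmult (cexp2pi (Cmult (RtoC (INR m)) (x, 1))) (wave x) else RtoC 0.
Proof.
  intros Hk. unfold summand. rewrite bottom_row_ok_1, Z.gcd_0_l.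
  destruct (Z.eqb_spec (Z.abs d) 1) as [H|H]; [|ring].
  (* For c = 0 and d = 1 or -1 the top row (d, 0) has determinant d^2 = 1 and makes gamma z = z. *)
  rewrite (poinc_term_row k m d 0 0 d) by (nia || simpl; lra).
  assert (Hd : d = 1%Z \/ d = (-1)%Z) by lia. f_equal.
  assert (P : Cpow (Cplus (Cmult (RtoC 0) (x, 1)) (RtoC (IZR d))) k = RtoC 1).
  { replace (Cplus (Cmult (RtoC 0) (x, 1)) (RtoC (IZR d))) with (RtoC (IZR d)) by ring.
    destruct Hd as [-> | ->]; [apply Cpow_1_l|].
    replace (RtoC (-1)) with (Copp (RtoC 1)) by (apply injective_projections; simpl; ring).
    rewrite Cpow_opp_even by easy. apply Cpow_1_l. }
  rewrite P.
  replace (Cdiv (Cplus (Cmult (RtoC (IZR d)) (x, 1)) (RtoC 0))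
    (Cplus (Cmult (RtoC 0) (x, 1)) (RtoC (IZR d)))) with ((x, 1) : C).
  - apply injective_projections; simpl; field.
  - assert (RtoC (IZR d) <> RtoC 0).
    { apply RtoC_neq_0. destruct Hd as [-> | ->]; lra. }
    replace (Cplus (Cmult (RtoC 0) (x, 1)) (RtoC (IZR d))) with (RtoC (IZR d)) by ring.
    assert (Q : forall z w : C, w <> RtoC 0 -> z = Cdiv (Cplus (Cmult w z) (RtoC 0)) w)
      by (intros z w Hw; field; easy).
    now apply Q.
Qed.

(** With a inverse to d modulo c this is e((ma + d)/c), a term of the Kloosterman sum S(m, 1; c);
    the value 0 restricts that sum to d prime to c. *)
Definition kl_phase (m : nat) (c d : Z) : C :=
  if Z.eqb (Z.gcd c d) 1
  then cexp2pi (RtoC (IZR (Z.of_nat m * fst (top_row c d) + d) / IZR c)) else RtoC 0.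

Lemma kl_phase_le_1 (m : nat) (c d : Z) : Cmod (kl_phase m c d) <= 1.
Proof.
  unfold kl_phase. destruct (Z.eqb _ _).
  - rewrite Cmod_cexp2pi. unfold Im, RtoC; simpl. rewrite Rmult_0_r, Ropp_0, exp_0. lra.
  - rewrite Cmod_0. lra.
Qed.

Lemma kl_phase_periodic (m : nat) (c d : Z) : (0 < c)%Z ->
  kl_phase m c (d + c) = kl_phase m c d.
Proof.
  intros Hc. unfold kl_phase.
  rewrite Z.gcd_add_diag_r.
  destruct (Z.eqb_spec (Z.gcd c d) 1) as [H|H]; [|easy].
  pose proof (top_row_spec c d H) as E.
  assert (H' : Z.gcd c (d + c) = 1%Z) by now rewrite Z.gcd_add_diag_r.
  pose proof (top_row_spec c (d + c) H') as E'.
  (* If (a', b') completes (c, d+c), then (a', b' - a') completes (c, d): this is multiplication on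
     the right by a translation. *)
  destruct (row_unique _ _ (fst (top_row c (d + c)))
    (snd (top_row c (d + c)) - fst (top_row c (d + c))) c d E) as [t [-> _]]; [lia|].
  assert (Hc' : IZR c <> 0) by (apply not_0_IZR; lia).
  replace (RtoC (IZR (Z.of_nat m * (fst (top_row c d) + t * c) + (d + c)) / IZR c)) with
    (Cplus (RtoC (IZR (Z.of_nat m * fst (top_row c d) + d) / IZR c))
      (RtoC (IZR (Z.of_nat m * t + 1)))).
  - rewrite cexp2pi_plus, cexp2pi_Z. ring.
  - rewrite <- RtoC_plus. f_equal. rewrite !plus_IZR, !mult_IZR, !plus_IZR, !mult_IZR. field. easy.
Qed.

Lemma kl_phase_1 (m : nat) (d : Z) : kl_phase m 1 d = RtoC 1.
Proof.
  unfold kl_phase. rewrite Z.gcd_1_l. simpl Z.eqb. cbv iota.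
  rewrite Rdiv_1_r. apply cexp2pi_Z.
Qed.

(* [(a z + b) / (c z + d) = a/c - 1/(c (c z + d))] and [c z + d = c w] with
   [w = x + d/c + i]. *)
Lemma summand_pos (k m : nat) (c d : Z) (x : R) : (0 < c)%Z ->
  summand k m c d x = Cmult (Cmult (Cinv (Cpow (RtoC (IZR c)) k)) (kl_phase m c d))
    (kern k (INR m / IZR c ^ 2) (x + IZR d / IZR c)).
Proof.
  intros Hc. unfold summand, kl_phase. rewrite bottom_row_ok_1.
  destruct (Z.eqb_spec (Z.gcd c d) 1) as [H|H]; [|ring].
  pose proof (top_row_spec c d H) as E.
  set (a := fst (top_row c d)) in *. set (b := snd (top_row c d)) in *.
  rewrite (poinc_term_row k m a b c d) by (easy || simpl; lra).
  assert (Hc' : 0 < IZR c) by now apply IZR_lt.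
  assert (HcC : RtoC (IZR c) <> RtoC 0) by (apply RtoC_neq_0; lra).
  set (w := (x + IZR d / IZR c, 1) : C).
  assert (Hw : w <> RtoC 0) by apply line_neq_0.
  assert (Hj : Cplus (Cmult (RtoC (IZR c)) (x, 1)) (RtoC (IZR d)) = Cmult (RtoC (IZR c)) w).
  { apply injective_projections; simpl; field; lra. }
  rewrite Hj, Cpow_mult_l.
  unfold kern, kern0, wave. change (vinv (x + IZR d / IZR c)) with (Cinv w). fold w.
  rewrite Cpow_inv by easy.
  assert (Hwk : Cpow w k <> RtoC 0) by now apply Cpow_nz.
  assert (Hck : Cpow (RtoC (IZR c)) k <> RtoC 0) by now apply Cpow_nz.
  assert (Ea : Cmult (RtoC (INR m)) (Cdiv (Cplus (Cmult (RtoC (IZR a)) (x, 1)) (RtoC (IZR b)))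
      (Cmult (RtoC (IZR c)) w)) =
    Cplus (RtoC (INR m * IZR a / IZR c)) (Copp (Cmult (RtoC (INR m / IZR c ^ 2)) (Cinv w)))).
  { assert (Eb : RtoC (IZR b) = Cdiv (Cminus (Cmult (RtoC (IZR a)) (RtoC (IZR d))) (RtoC 1)) (RtoC (IZR c))).
    { rewrite <- RtoC_mult, <- RtoC_minus, <- RtoC_div by lra. f_equal.
      assert (E' : (b * c = a * d - 1)%Z) by lia.
      apply (f_equal IZR) in E'. rewrite minus_IZR, !mult_IZR in E'. rewrite <- E'. field. lra. }
    assert (Ez : ((x, 1) : C) = Cminus w (Cdiv (RtoC (IZR d)) (RtoC (IZR c)))).
    { rewrite <- RtoC_div by lra. apply injective_projections; simpl; ring. }
    rewrite Ez, Eb. unfold Rdiv. rewrite !RtoC_mult, !RtoC_inv, RtoC_pow by (try apply pow_nonzero; lra).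
    field. split; easy. }
  rewrite Ea, cexp2pi_plus.
  assert (Ew : cexp2pi (Copp (x, 1)) = Cmult (cexp2pi (Copp w)) (cexp2pi (RtoC (IZR d / IZR c)))).
  { rewrite <- cexp2pi_plus. f_equal. apply injective_projections; simpl; ring. }
  rewrite Ew.
  assert (Ep : cexp2pi (RtoC (IZR (Z.of_nat m * a + d) / IZR c)) =
    Cmult (cexp2pi (RtoC (INR m * IZR a / IZR c))) (cexp2pi (RtoC (IZR d / IZR c)))).
  { rewrite <- cexp2pi_plus, <- RtoC_plus. do 2 f_equal.
    rewrite plus_IZR, mult_IZR, <- INR_IZR_INZ. field. lra. }
  rewrite Ep. field. split; easy.
Qed.

(** A summable weight in one variable. The majorant ud c * ud d is separable, so its sum over a
    square is the square of a one-dimensional sum. *)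
Definition ud (c : Z) : R := / (1 + IZR c ^ 2).

Lemma ud_pos (c : Z) : 0 < ud c.
Proof. apply Rinv_0_lt_compat. nra. Qed.

(** D is |cz + d|^2 = (cx+d)^2 + c^2 for z = x + i, and k >= 4 gives |cz + d|^(-k) <= D^(-2). For 0
    <= x <= 1 one has 1 + c^2 <= 2D and 1 + d^2 <= 3D, whence the factor 6; exp(2 pi) is the modulus
    of e(-z). *)
Lemma summand_bound_pos (k m : nat) (c d : Z) (x : R) : (4 <= k)%nat -> (0 < c)%Z ->
  0 <= x <= 1 -> Cmod (summand k m c d x) <= 6 * exp (2 * PI) * (ud c * ud d).
Proof.
  intros Hk Hc Hx. rewrite summand_pos by easy.
  assert (Hc' : 1 <= IZR c) by (apply IZR_le; lia).
  set (u := x + IZR d / IZR c).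
  set (D := IZR c ^ 2 * (1 + u ^ 2)).
  assert (HD : D = (IZR c * x + IZR d) ^ 2 + IZR c ^ 2) by (unfold D, u; field; lra).
  assert (HD1 : 1 <= D) by (rewrite HD; pose proof (pow2_ge_0 (IZR c * x + IZR d)); nra).
  assert (Hq : (/ IZR c * Cmod (vinv u)) ^ 2 = / D).
  { rewrite Rpow_mult_distr, Cmod_vinv_sq. unfold D. field. split; nra. }
  set (q := / IZR c * Cmod (vinv u)) in *.
  assert (Hq0 : 0 <= q).
  { apply Rmult_le_pos; [left; apply Rinv_0_lt_compat; lra|apply Cmod_ge_0]. }
  assert (HDi : / D <= 1) by (rewrite <- Rinv_1; apply Rinv_le_contravar; lra).
  assert (Hq1 : q <= 1) by nra.
  apply Rle_trans with (exp (2 * PI) * q ^ k).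
  - rewrite !Cmod_mult.
    rewrite Cmod_inv by (apply Cpow_nz, RtoC_neq_0; lra).
    rewrite Cmod_pow, Cmod_R, Rabs_pos_eq by lra.
    assert (B : Cmod (kern k (INR m / IZR c ^ 2) u) <= Cmod (vinv u) ^ k * exp (2 * PI)).
    { eapply Rle_trans; [apply Cmod_kern_le|].
      - apply Rmult_le_pos; [apply pos_INR|]. left. apply Rinv_0_lt_compat. nra.
      - unfold kern0. rewrite Cmod_mult, Cmod_pow, Cmod_wave. lra. }
    unfold q. rewrite Rpow_mult_distr, pow_inv.
    pose proof (kl_phase_le_1 m c d) as Hchi. pose proof (Cmod_ge_0 (kl_phase m c d)).
    assert (Hi : 0 < / IZR c ^ k) by (apply Rinv_0_lt_compat, pow_lt; lra).
    replace (exp (2 * PI) * (/ IZR c ^ k * Cmod (vinv u) ^ k)) with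
      ((/ IZR c ^ k * 1) * (Cmod (vinv u) ^ k * exp (2 * PI))) by ring.
    apply Rmult_le_compat; [|apply Cmod_ge_0| |exact B].
    + apply Rmult_le_pos; lra.
    + apply Rmult_le_compat_l; lra.
  - assert (Hk4 : q ^ k <= (/ D) ^ 2).
    { replace k with (4 + (k - 4))%nat by lia. rewrite pow_add.
      destruct (pow_le_1 q (k - 4)) as [_ H]; [lra|].
      replace ((/ D) ^ 2) with (q ^ 4 * 1) by (rewrite <- Hq; ring).
      apply Rmult_le_compat_l; [now apply pow_le|easy]. }
    assert (H6 : (/ D) ^ 2 <= 6 * (ud c * ud d)).
    { unfold ud. rewrite <- Rinv_mult, pow_inv.
      set (P := (1 + IZR c ^ 2) * (1 + IZR d ^ 2)).
      assert (HP : P <= 6 * D ^ 2).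
      { assert (H1 : 1 + IZR c ^ 2 <= 2 * D).
        { assert (IZR c ^ 2 <= D) by (rewrite HD; pose proof (pow2_ge_0 (IZR c * x + IZR d)); lra).
          lra. }
        assert (H2 : 1 + IZR d ^ 2 <= 3 * D).
        { assert (H3 : IZR d ^ 2 <= 2 * (IZR c * x + IZR d) ^ 2 + 2 * (IZR c * x) ^ 2).
          { pose proof (pow2_ge_0 (2 * (IZR c * x) + IZR d)). lra. }
          assert (H4 : (IZR c * x) ^ 2 <= IZR c ^ 2) by (apply pow_incr; nra).
          lra. }
        unfold P. replace (6 * D ^ 2) with ((2 * D) * (3 * D)) by ring.
        apply Rmult_le_compat; nra. }
      assert (HP0 : 0 < P) by (unfold P; nra).
      assert (HD2 : 0 < D ^ 2) by nra.
      apply Rmult_le_reg_r with (P * D ^ 2); [nra|].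
      replace (/ D ^ 2 * (P * D ^ 2)) with P by (field; lra).
      replace (6 * / P * (P * D ^ 2)) with (6 * D ^ 2) by (field; lra). easy. }
    pose proof (exp_pos (2 * PI)). nra.
Qed.

Lemma ud_opp (c : Z) : ud (- c) = ud c.
Proof. unfold ud. rewrite opp_IZR. f_equal. ring. Qed.

Lemma summand_bound (k m : nat) (c d : Z) (x : R) : Nat.Even k -> (4 <= k)%nat ->
  0 <= x <= 1 -> Cmod (summand k m c d x) <= 6 * exp (2 * PI) * (ud c * ud d).
Proof.
  intros Ek Hk Hx. destruct (Z.lt_trichotomy c 0) as [H|[->|H]].
  - rewrite <- summand_opp by easy. rewrite <- (ud_opp c), <- (ud_opp d).
    apply summand_bound_pos; (lia || easy).
  - rewrite summand_0_l by easy.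
    pose proof (exp_pos (2 * PI)). pose proof (ud_pos 0). pose proof (ud_pos d).
    destruct (Z.eqb_spec (Z.abs d) 1) as [Hd|Hd].
    + rewrite Cmod_mult, Cmod_wave, Cmod_cexp2pi.
      assert (U : ud 0 * ud d = 1 / 2).
      { unfold ud. assert (Hd' : d = 1%Z \/ d = (-1)%Z) by lia.
        destruct Hd' as [-> | ->]; field. }
      rewrite U.
      assert (E : exp (- (2 * PI * Im (Cmult (RtoC (INR m)) (x, 1)))) <= 1).
      { pose proof (pos_INR m). pose proof PI_RGT_0.
        apply Rle_trans with (exp 0); [apply exp_monotone|rewrite exp_0; lra].
        unfold Im; simpl. nra. }
      nra.
    + rewrite Cmod_0. apply Rmult_le_pos; [lra|]. apply Rmult_le_pos; lra.
  - now apply summand_bound_pos.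
Qed.

Lemma Ccont_summand (k m : nat) (c d : Z) : Nat.Even k -> Ccont (summand k m c d).
Proof.
  intros Ek.
  assert (P : forall c' d', (0 < c')%Z -> Ccont (summand k m c' d')).
  { intros c' d' Hc. apply Ccont_ext with (fun x =>
      Cmult (Cmult (Cinv (Cpow (RtoC (IZR c')) k)) (kl_phase m c' d'))
        (kern k (INR m / IZR c' ^ 2) (x + IZR d' / IZR c'))).
    - intros x. now rewrite summand_pos.
    - apply Ccont_scal. apply (Ccont_comp (kern k (INR m / IZR c' ^ 2))); [apply Ccont_kern|].
      intros x. apply (continuous_plus (fun y : R => y) (fun _ : R => IZR d' / IZR c'));
        [apply continuous_id|apply continuous_const]. }
  destruct (Z.lt_trichotomy c 0) as [H|[->|H]].
  - apply Ccont_ext with (summand k m (- c) (- d)); [intros x; now apply summand_opp|].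
    apply P. lia.
  - apply Ccont_ext with (fun x => if Z.eqb (Z.abs d) 1
      then Cmult (cexp2pi (Cmult (RtoC (INR m)) (x, 1))) (wave x) else RtoC 0).
    + intros x. now rewrite summand_0_l.
    + destruct (Z.eqb (Z.abs d) 1); [|apply Ccont_const].
      apply Ccont_mult; [|apply Ccont_wave].
      apply Ccont_cexp2pi, Ccont_scal. exact (Cder_cont _ (fun _ => RtoC 1) Cder_line).
  - now apply P.
Qed.

(** * Sums over rows and the limit of the partial sums *)

Definition block (h : Z -> C) (n : nat) (a : Z) : C :=
  Csum (fun r => h (a + Z.of_nat r)%Z) n.

Lemma block_succ (h : Z -> C) (n : nat) (a : Z) :
  block h n (a + 1) = Cplus (block h n a) (Cminus (h (a + Z.of_nat n)%Z) (h a)).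
Proof.
  induction n as [|n IH].
  - unfold block. simpl. rewrite Z.add_0_r. ring.
  - unfold block in *. cbn [Csum]. rewrite IH.
    replace (a + 1 + Z.of_nat n)%Z with (a + Z.of_nat (S n))%Z by lia. ring.
Qed.

(* Unfolding: a row of the Poincare series has the form [h (d + c) - h d], so that
   only blocks of [c] consecutive values at both ends survive. *)
Lemma CZ_telescope (h : Z -> C) (n M : nat) :
  CZ M (fun d => Cminus (h (d + Z.of_nat n)%Z) (h d)) =
  Cminus (block h n (Z.of_nat M + 1)) (block h n (- Z.of_nat M)).
Proof.
  induction M as [|M IH].
  - cbn [CZ]. change (- Z.of_nat 0)%Z with 0%Z. change (Z.of_nat 0) with 0%Z.
    rewrite (block_succ h n 0). ring.
  - cbn [CZ]. rewrite IH.
    rewrite (block_succ h n (Z.of_nat (S M))).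
    replace (- Z.of_nat M)%Z with (- Z.of_nat (S M) + 1)%Z by lia.
    rewrite (block_succ h n (- Z.of_nat (S M))).
    replace (Z.of_nat M + 1)%Z with (Z.of_nat (S M)) by lia. ring.
Qed.

Lemma block_periodic (h : Z -> C) (n : nat) (a : Z) :
  (forall d, h (d + Z.of_nat n)%Z = h d) -> block h n a = block h n 0.
Proof.
  intros H.
  assert (Hs : forall b, block h n (b + 1) = block h n b).
  { intros b. rewrite block_succ, H. ring. }
  assert (P : forall i : nat, block h n (Z.of_nat i) = block h n 0 /\
    block h n (- Z.of_nat i) = block h n 0).
  { induction i as [|i [IH1 IH2]]; [easy|]. split.
    - rewrite <- IH1, <- (Hs (Z.of_nat i)). f_equal. lia.
    - rewrite <- IH2, <- (Hs (- Z.of_nat (S i))%Z). f_equal. lia. }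
  destruct (Z_le_gt_dec 0 a) as [L|L].
  - rewrite <- (Z2Nat.id a L). apply P.
  - replace a with (- Z.of_nat (Z.to_nat (- a)))%Z by lia. apply P.
Qed.

Lemma Cmod_Csum_le (f : nat -> C) (g : nat -> R) (n : nat) :
  (forall i, Cmod (f i) <= g (S i) - g i) -> Cmod (Csum f n) <= g n - g O.
Proof.
  intros H. induction n as [|n IH]; simpl.
  - rewrite Cmod_0. lra.
  - eapply Rle_trans; [apply Cmod_triangle|]. specialize (H n). lra.
Qed.

Lemma Cmod_block_le (h : Z -> C) (n : nat) (a : Z) :
  (forall d, Cmod (h d) <= 1) -> Cmod (block h n a) <= INR n.
Proof.
  intros H. unfold block. rewrite <- (Rminus_0_r (INR n)).
  apply (Cmod_Csum_le _ INR). intros i. rewrite S_INR. specialize (H (a + Z.of_nat i)%Z). lra.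
Qed.

Lemma affine_pinf (b c : R) : 0 < c -> filterlim (fun M => (INR M + b) / c) eventually pinf.
Proof.
  intros Hc P [A HA]. destruct (INR_unbounded (A * c - b)) as [N HN].
  exists N. intros M HM. apply HA.
  apply Rmult_lt_reg_r with c; [easy|].
  replace ((INR M + b) / c * c) with (INR M + b) by (field; lra).
  apply le_INR in HM. lra.
Qed.

(** * Unfolding one row c = n of the series *)

Section Row.

Variables (k m n : nat).
Hypothesis Hn : (1 <= n)%nat.
Let c := Z.of_nat n.
Let mu := INR m / IZR c ^ 2.
Let chi := kl_phase m c.
Let H (u : R) := Cint (kern k mu) 0 u.

(** The window moves with M, but it always covers a full residue system modulo c, so the sum of chi
    over it is constant. The factor H tends to l at each of its finitely many places, and chi is
    bounded. *)
Lemma block_limit (l : C) (base : nat -> Z) :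
  (forall r, Clim eventually (fun M => H (IZR (base M + Z.of_nat r) / IZR c)) l) ->
  Clim eventually (fun M => block (fun d => Cmult (chi d) (H (IZR d / IZR c))) n (base M))
    (Cmult (block chi n 0) l).
Proof.
  intros L.
  apply (Clim_ext eventually) with (fun M => Cplus
    (Csum (fun r => Cmult (chi (base M + Z.of_nat r)%Z)
      (Cminus (H (IZR (base M + Z.of_nat r) / IZR c)) l)) n)
    (Cmult (block chi n 0) l)).
  - intros M. rewrite <- (block_periodic chi n (base M)).
    + unfold block. clearbody H chi c. clear Hn. revert n. intros j.
      induction j as [|j IH]; cbn [Csum]; [ring|]. rewrite <- IH. ring.
    + intros d. apply kl_phase_periodic. unfold c. lia.
  - assert (Z : Csum (fun _ => RtoC 0) n = RtoC 0).
    { generalize n. intros j. induction j as [|j IH]; simpl; [easy|]. rewrite IH. ring. }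
    rewrite <- (Cplus_0_l (Cmult (block chi n 0) l)), <- Z.
    apply (Clim_plus eventually); [|rewrite Z, Cplus_0_l; apply (Clim_const eventually)].
    apply (Clim_Csum eventually (fun r M => Cmult (chi (base M + Z.of_nat r)%Z)
      (Cminus (H (IZR (base M + Z.of_nat r) / IZR c)) l))).
    intros r. apply (Clim_squeeze eventually) with (2 := L r) (K := 1).
    intros M. replace (Cminus (Cmult _ _) (RtoC 0)) with (Cmult (chi (base M + Z.of_nat r)%Z)
      (Cminus (H (IZR (base M + Z.of_nat r) / IZR c)) l)) by ring.
    rewrite Cmod_mult. apply Rmult_le_compat_r; [apply Cmod_ge_0|apply kl_phase_le_1].
Qed.

(** As x runs over [0, 1], x + d/c runs over [d/c, (d+c)/c]. Periodicity of chi allows it to be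
    moved to the upper end, which gives the form h (d+c) - h d required by [CZ_telescope]. *)
Lemma Cint_summand (d : Z) :
  Cint (summand k m c d) 0 1 = Cmult (Cinv (Cpow (RtoC (IZR c)) k))
    (Cminus (Cmult (chi (d + c)%Z) (H (IZR (d + c) / IZR c))) (Cmult (chi d) (H (IZR d / IZR c)))).
Proof.
  assert (Hc : (0 < c)%Z) by (unfold c; lia).
  assert (Hc' : 0 < IZR c) by now apply IZR_lt.
  unfold chi at 1. rewrite kl_phase_periodic by easy. fold chi.
  rewrite (Cint_ext _ (fun x => Cmult (Cmult (Cinv (Cpow (RtoC (IZR c)) k)) (chi d))
    (kern k mu (x + IZR d / IZR c)))).
  2: { intros x _. now apply summand_pos. }
  rewrite Cint_scal.
  - rewrite (Cint_shift (kern k mu)) by apply Ccont_kern.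
    rewrite Rplus_0_l.
    replace (1 + IZR d / IZR c) with (IZR (d + c) / IZR c) by (rewrite plus_IZR; field; lra).
    unfold H. rewrite <- (Cint_Chasles (kern k mu) 0 (IZR d / IZR c) (IZR (d + c) / IZR c))
      by apply Ccont_kern.
    ring.
  - apply (Ccont_comp (kern k mu)); [apply Ccont_kern|].
    intros x. apply (continuous_plus (fun y : R => y) (fun _ : R => IZR d / IZR c));
      [apply continuous_id|apply continuous_const].
Qed.

Lemma row_limit (I : C) : line_int (kern k mu) I ->
  Clim eventually (fun M => CZ M (fun d => Cint (summand k m c d) 0 1))
    (Cmult (Cinv (Cpow (RtoC (IZR c)) k)) (Cmult (block chi n 0) I)).
Proof.
  intros [p [q [Hp [Hq ->]]]].
  assert (Hc' : 0 < IZR c) by (apply IZR_lt; unfold c; lia).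
  set (h := fun d => Cmult (chi d) (H (IZR d / IZR c))).
  apply (Clim_ext eventually) with (fun M => Cmult (Cinv (Cpow (RtoC (IZR c)) k))
    (Cminus (block h n (Z.of_nat M + 1)) (block h n (- Z.of_nat M)))).
  - intros M. rewrite <- CZ_telescope.
    transitivity (CZ M (fun d => Cmult (Cinv (Cpow (RtoC (IZR c)) k))
      (Cminus (h (d + Z.of_nat n)%Z) (h d)))).
    + induction M as [|M IH]; [easy|]. cbn [CZ]. rewrite <- IH. ring.
    + apply CZ_ext. intros d. symmetry. apply Cint_summand.
  - apply (Clim_scal eventually).
    replace (Cmult (block chi n 0) (Cminus p q)) with
      (Cminus (Cmult (block chi n 0) p) (Cmult (block chi n 0) q)) by ring.
    apply (Clim_minus eventually); apply block_limit; intros r.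
    + apply (Clim_ext eventually) with (fun M => H ((INR M + (1 + INR r)) / IZR c)).
      * intros M. rewrite !plus_IZR, <- !INR_IZR_INZ. do 2 f_equal. ring.
      * apply (Clim_comp eventually pinf (fun M => (INR M + (1 + INR r)) / IZR c) H); [|exact Hp].
        now apply affine_pinf.
    + apply (Clim_ext eventually) with (fun M => H (- ((INR M + - INR r) / IZR c))).
      * intros M. rewrite plus_IZR, opp_IZR, <- !INR_IZR_INZ. f_equal. field. lra.
      * apply (Clim_comp eventually pinf (fun M => (INR M + - INR r) / IZR c) (fun u => H (- u)));
          [|exact Hq]. now apply affine_pinf.
Qed.

End Row.

(** * Dominated convergence of sums over growing squares *)

Fixpoint RZ (M : nat) (g : Z -> R) : R :=
  match M with
  | O => g 0%Z
  | S n => RZ n g + (g (Z.of_nat (S n)) + g (- Z.of_nat (S n))%Z)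
  end.

Lemma Re_CZ (M : nat) (g : Z -> C) : Re (CZ M g) = RZ M (fun d => Re (g d)).
Proof. induction M as [|M IH]; [easy|]. cbn [CZ RZ]. now rewrite <- IH. Qed.

Lemma Im_CZ (M : nat) (g : Z -> C) : Im (CZ M g) = RZ M (fun d => Im (g d)).
Proof. induction M as [|M IH]; [easy|]. cbn [CZ RZ]. now rewrite <- IH. Qed.

Lemma RZ_ext (M : nat) (f g : Z -> R) : (forall d, f d = g d) -> RZ M f = RZ M g.
Proof. intros E. induction M as [|M IH]; cbn [RZ]; rewrite ?IH, !E; easy. Qed.

Lemma RZ_nonneg (M : nat) (g : Z -> R) : (forall d, 0 <= g d) -> 0 <= RZ M g.
Proof.
  intros Hg. induction M as [|M IH]; cbn [RZ]; [apply Hg|].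
  pose proof (Hg (Z.of_nat (S M))). pose proof (Hg (- Z.of_nat (S M))%Z). lra.
Qed.

Lemma RZ_plus (M : nat) (f g : Z -> R) : RZ M (fun d => f d + g d) = RZ M f + RZ M g.
Proof. induction M as [|M IH]; cbn [RZ]; [easy|]. rewrite IH. ring. Qed.

Lemma RZ_scal (M : nat) (a : R) (f : Z -> R) : RZ M (fun d => a * f d) = a * RZ M f.
Proof. induction M as [|M IH]; cbn [RZ]; [easy|]. rewrite IH. ring. Qed.

Definition box (M : nat) (g : Z -> Z -> R) : R := RZ M (fun c => RZ M (g c)).

Lemma box_plus (M : nat) (f g : Z -> Z -> R) :
  box M (fun c d => f c d + g c d) = box M f + box M g.
Proof. unfold box. rewrite <- RZ_plus. apply RZ_ext. intros c. apply RZ_plus. Qed.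

Lemma box_scal (M : nat) (a : R) (f : Z -> Z -> R) :
  box M (fun c d => a * f c d) = a * box M f.
Proof. unfold box. rewrite <- RZ_scal. apply RZ_ext. intros c. apply RZ_scal. Qed.

Lemma box_monotone (M : nat) (g : Z -> Z -> R) : (forall c d, 0 <= g c d) ->
  box M g <= box (S M) g.
Proof.
  intros Hg. unfold box.
  assert (P : RZ M (fun c => RZ (S M) (g c)) =
    RZ M (fun c => RZ M (g c)) +
    RZ M (fun c => g c (Z.of_nat (S M)) + g c (- Z.of_nat (S M))%Z)).
  { rewrite <- RZ_plus. easy. }
  change (RZ (S M) (fun c => RZ (S M) (g c))) with (RZ M (fun c => RZ (S M) (g c)) +
    (RZ (S M) (g (Z.of_nat (S M))) + RZ (S M) (g (- Z.of_nat (S M))%Z))).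
  rewrite P.
  assert (0 <= RZ M (fun c => g c (Z.of_nat (S M)) + g c (- Z.of_nat (S M))%Z)).
  { apply RZ_nonneg. intros c. now apply Rplus_le_le_0_compat. }
  pose proof (RZ_nonneg (S M) (g (Z.of_nat (S M))) (Hg _)).
  pose proof (RZ_nonneg (S M) (g (- Z.of_nat (S M))%Z) (Hg _)). lra.
Qed.

(** Both v + f and v - f are nonnegative, so their box sums grow with M. This avoids describing the
    boundary of the square. *)
Lemma box_increment (M : nat) (f v : Z -> Z -> R) : (forall c d, Rabs (f c d) <= v c d) ->
  Rabs (box (S M) f - box M f) <= box (S M) v - box M v.
Proof.
  intros B.
  assert (P : forall s, (s = 1 \/ s = -1) -> box M v + s * box M f <= box (S M) v + s * box (S M) f).
  { intros s Hs. rewrite <- !box_scal, <- !box_plus. apply box_monotone. intros c d.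
    specialize (B c d). apply Rabs_le_between in B. destruct Hs; subst; lra. }
  pose proof (P 1 (or_introl eq_refl)). pose proof (P (-1) (or_intror eq_refl)).
  apply Rabs_le. lra.
Qed.

Lemma box_prod (M : nat) (a : R) (f : Z -> R) :
  box M (fun c d => a * (f c * f d)) = a * RZ M f ^ 2.
Proof.
  rewrite box_scal. unfold box. f_equal. simpl. rewrite Rmult_1_r, <- RZ_scal.
  apply RZ_ext. intros c. rewrite RZ_scal. ring.
Qed.

Lemma ud_nat_le (N : nat) : (1 <= N)%nat ->
  ud (Z.of_nat N) <= 2 * (/ INR N - / INR (S N)).
Proof.
  intros HN. unfold ud. rewrite <- INR_IZR_INZ, S_INR.
  assert (Hp : 1 <= INR N) by (apply le_INR in HN; exact HN).
  apply Rmult_le_reg_r with (1 + INR N ^ 2); [nra|]. rewrite Rinv_l by nra.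
  replace (2 * (/ INR N - / (INR N + 1)) * (1 + INR N ^ 2)) with
    (2 * (1 + INR N ^ 2) * / (INR N * (INR N + 1))) by (field; lra).
  apply Rmult_le_reg_r with (INR N * (INR N + 1)); [nra|].
  rewrite Rmult_assoc, Rinv_l by nra. nra.
Qed.

(** The term d = 0 gives 1, and [ud_nat_le] used for both signs gives 4 times a telescoping sum. The
    subtracted term carries the induction. *)
Lemma RZ_ud_le (M : nat) : RZ M ud <= 5 - 4 * / INR (S M).
Proof.
  induction M as [|M IH].
  - simpl. unfold ud. simpl. rewrite !Rmult_0_l, Rplus_0_r, Rinv_1. lra.
  - cbn [RZ]. rewrite ud_opp. pose proof (ud_nat_le (S M) ltac:(lia)). lra.
Qed.

Lemma RZ_ud_le_5 (M : nat) : 0 <= RZ M ud <= 5.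
Proof.
  split; [apply RZ_nonneg; intros; apply Rlt_le, ud_pos|].
  pose proof (RZ_ud_le M). assert (0 < / INR (S M)) by (apply Rinv_0_lt_compat, lt_0_INR; lia). lra.
Qed.

Lemma RZ_ud_sq_lim : exists U : R, is_lim_seq (fun M => RZ M ud ^ 2) U.
Proof.
  destruct (ex_finite_lim_seq_incr (fun M => RZ M ud ^ 2) 25) as [U HU].
  - intros M. apply pow_incr. split; [apply RZ_ud_le_5|]. cbn [RZ].
    pose proof (ud_pos (Z.of_nat (S M))). pose proof (ud_pos (- Z.of_nat (S M))). lra.
  - intros M. replace 25 with (5 ^ 2) by ring. apply pow_incr, RZ_ud_le_5.
  - now exists U.
Qed.

(** a + v is nondecreasing and bounded, hence convergent, and a is recovered by subtracting v. The
    error V - v n does not involve a, so it is uniform in any parameter on which only a depends. *)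
Lemma dominated_seq (a v : nat -> R) (V : R) :
  (forall n, Rabs (a (S n) - a n) <= v (S n) - v n) -> is_lim_seq v V ->
  exists l : R, is_lim_seq a l /\ forall n, Rabs (a n - l) <= V - v n.
Proof.
  intros B L.
  assert (B' : forall i n, Rabs (a (i + n)%nat - a n) <= v (i + n)%nat - v n).
  { intros i n. induction i as [|i IH]; simpl.
    - rewrite !Rminus_diag, Rabs_R0. lra.
    - specialize (B (i + n)%nat).
      replace (a (S (i + n)) - a n) with ((a (S (i + n)) - a (i + n)%nat) + (a (i + n)%nat - a n)) by ring.
      eapply Rle_trans; [apply Rabs_triang|]. lra. }
  assert (Hv : forall n, v n <= V).
  { intros n. apply (is_lim_seq_incr_compare v V L). intros i.
    specialize (B i). pose proof (Rabs_pos (a (S i) - a i)). lra. }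
  destruct (ex_finite_lim_seq_incr (fun n => a n + v n) (a O + 2 * V - v O)) as [s Hs].
  - intros i. specialize (B i). apply Rabs_le_between in B. lra.
  - intros i. specialize (B' i O). rewrite Nat.add_0_r in B'.
    apply Rabs_le_between in B'. pose proof (Hv i). lra.
  - assert (La : is_lim_seq a (s - V)).
    { apply is_lim_seq_ext with (fun n => (a n + v n) - v n); [intros; ring|].
      now apply is_lim_seq_minus'. }
    exists (s - V). split; [easy|]. intros n. rewrite Rabs_minus_sym.
    apply (is_lim_seq_le (fun i => Rabs (a (i + n)%nat - a n)) (fun _ => V - v n)
      (Rabs (s - V - a n)) (V - v n)).
    + intros i. eapply Rle_trans; [apply B'|]. pose proof (Hv (i + n)%nat). lra.
    + apply (is_lim_seq_abs _ (Finite (s - V - a n))). apply is_lim_seq_minus'.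
      * now apply (is_lim_seq_incr_n a n).
      * apply is_lim_seq_const.
    + apply is_lim_seq_const.
Qed.

Lemma RInt_uniform_limit (f : nat -> R -> R) (g : R -> R) (tau : nat -> R) :
  (forall n x, continuous (f n) x) ->
  (forall n x, 0 <= x <= 1 -> Rabs (f n x - g x) <= tau n) ->
  is_lim_seq tau 0 -> is_lim_seq (fun n => RInt (f n) 0 1) (RInt g 0 1).
Proof.
  intros Cf B L.
  (* [filterlim_RInt] asks for uniform convergence on the whole line, while the bound holds on
     [0, 1]; cutting off outside leaves the integrals unchanged. It also yields the integrability of
     the limit. *)
  set (cut := fun (h : R -> R) (x : R) => if Rle_dec 0 x then if Rle_dec x 1 then h x else 0 else 0).
  assert (Ecut : forall h x, Rmin 0 1 < x < Rmax 0 1 -> cut h x = h x).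
  { intros h x. rewrite Rmin_left, Rmax_right by lra. intros Hx. unfold cut.
    destruct (Rle_dec 0 x); [|lra]. destruct (Rle_dec x 1); [easy|lra]. }
  destruct (filterlim_RInt (V := R_CompleteNormedModule) (fun n => cut (f n)) 0 1 eventually _
    (cut g) (fun n => RInt (f n) 0 1)) as [If [H1 H2]].
  - intros n. apply (is_RInt_ext (f n)); [intros x Hx; symmetry; now apply Ecut|].
    apply (RInt_correct (V := R_CompleteNormedModule)). now apply ex_RInt_cont.
  - apply filterlim_locally. intros eps. apply is_lim_seq_spec in L.
    generalize (L eps). apply filter_imp. intros n Hn x.
    change (Rabs (cut (f n) x - cut g x) < eps).
    apply Rabs_def2 in Hn. pose proof (cond_pos eps). unfold cut.
    destruct (Rle_dec 0 x); [destruct (Rle_dec x 1)|];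
      try (rewrite Rminus_diag, Rabs_R0; easy).
    specialize (B n x ltac:(lra)). lra.
  - replace (RInt g 0 1) with If; [exact H1|].
    symmetry. apply is_RInt_unique. apply (is_RInt_ext (cut g)); [exact (Ecut g)|exact H2].
Qed.

Lemma Cint_CZ (M : nat) (f : Z -> R -> C) (a b : R) : (forall d, Ccont (f d)) ->
  Ccont (fun x => CZ M (fun d => f d x)) /\
  Cint (fun x => CZ M (fun d => f d x)) a b = CZ M (fun d => Cint (f d) a b).
Proof.
  intros Cf. induction M as [|M [IH1 IH2]]; cbn [CZ].
  - split; [apply Cf|easy].
  - assert (C2 : Ccont (fun x => Cplus (f (Z.of_nat (S M)) x) (f (- Z.of_nat (S M))%Z x)))
      by (apply (Ccont_plus (f _) (f _)); apply Cf).
    split.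
    + exact (Ccont_plus _ _ IH1 C2).
    + rewrite (Cint_plus _ _ _ _ IH1 C2), IH2. f_equal.
      apply (Cint_plus (f _) (f _)); apply Cf.
Qed.

Lemma CZ_mult_r (M : nat) (g : Z -> C) (w : C) :
  CZ M (fun d => Cmult (g d) w) = Cmult (CZ M g) w.
Proof. induction M as [|M IH]; cbn [CZ]; [easy|]. rewrite IH. ring. Qed.

Lemma poinc_partial_CZ (k m M : nat) (z : C) :
  poinc_partial k m 1 M z = CZ M (fun c => CZ M (fun d =>
    if bottom_row_ok 1 c d then poinc_term k m c d z else RtoC 0)).
Proof.
  unfold poinc_partial.
  rewrite <- (Csum_CZ (fun c => CZ M (fun d =>
    if bottom_row_ok 1 c d then poinc_term k m c d z else RtoC 0))).
  apply Csum_ext. intros i _. cbv zeta.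
  apply (Csum_CZ (fun d => if bottom_row_ok 1 (Z.of_nat i - Z.of_nat M) d
    then poinc_term k m (Z.of_nat i - Z.of_nat M) d z else RtoC 0)).
Qed.

(** * The first Fourier coefficient as a limit of double sums *)

Section Coefficient.

Variables (k m : nat).
Hypothesis Hev : Nat.Even k.
Hypothesis Hk : (4 <= k)%nat.

Let T (c d : Z) (x : R) : C :=
  if bottom_row_ok 1 c d then poinc_term k m c d (x, 1) else RtoC 0.

Lemma term_bound (c d : Z) (x : R) : 0 <= x <= 1 -> Cmod (T c d x) <= 6 * (ud c * ud d).
Proof.
  intros Hx. pose proof (summand_bound k m c d x Hev Hk Hx) as B.
  unfold summand in B. fold (T c d x) in B. rewrite Cmod_mult, Cmod_wave in B.
  pose proof (exp_pos (2 * PI)).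
  apply Rmult_le_reg_r with (exp (2 * PI)); [easy|]. lra.
Qed.

(** [dominated_seq] shows that the limits inside [Poincare] exist and are finite, so [real] and
    [Lim_seq] return no default value there. The constant 12 is 6 for each component, and tau does
    not depend on x. *)
Lemma Poincare_approx : exists tau : nat -> R, is_lim_seq tau 0 /\
  forall M x, 0 <= x <= 1 ->
  Cmod (Cminus (poinc_partial k m 1 M (x, 1)) (Poincare k m 1 (x, 1))) <= tau M.
Proof.
  destruct RZ_ud_sq_lim as [U HU].
  exists (fun M => 12 * (U - RZ M ud ^ 2)). split.
  { replace (Finite 0) with (Rbar_mult 12 (U - U)) by (simpl; f_equal; ring).
    apply is_lim_seq_scal_l. apply is_lim_seq_minus'; [apply is_lim_seq_const|easy]. }
  intros M x Hx.
  assert (HV : is_lim_seq (fun n => 6 * RZ n ud ^ 2) (6 * U)).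
  { apply (is_lim_seq_scal_l _ 6 (Finite U)). easy. }
  destruct (dominated_seq (fun n => Re (poinc_partial k m 1 n (x, 1)))
    (fun n => 6 * RZ n ud ^ 2) (6 * U)) as [lr [Lr Br]]; [|exact HV|].
  { intros n. rewrite <- !box_prod, !poinc_partial_CZ.
    assert (E : forall i, Re (CZ i (fun c => CZ i (fun d => T c d x))) =
      box i (fun c d => Re (T c d x))).
    { intros i. rewrite Re_CZ. apply RZ_ext. intros c. apply Re_CZ. }
    unfold T in E. rewrite !E. fold T. apply box_increment. intros c d.
    eapply Rle_trans; [apply re_le_Cmod|]. now apply term_bound. }
  destruct (dominated_seq (fun n => Im (poinc_partial k m 1 n (x, 1)))
    (fun n => 6 * RZ n ud ^ 2) (6 * U)) as [li [Li Bi]]; [|exact HV|].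
  { intros n. rewrite <- !box_prod, !poinc_partial_CZ.
    assert (E : forall i, Im (CZ i (fun c => CZ i (fun d => T c d x))) =
      box i (fun c d => Im (T c d x))).
    { intros i. rewrite Im_CZ. apply RZ_ext. intros c. apply Im_CZ. }
    unfold T in E. rewrite !E. fold T. apply box_increment. intros c d.
    eapply Rle_trans; [apply im_le_Cmod|]. now apply term_bound. }
  unfold Poincare. rewrite (is_lim_seq_unique _ _ Lr), (is_lim_seq_unique _ _ Li).
  cbn [real]. eapply Rle_trans; [apply Cmod_le_abs|].
  specialize (Br M). specialize (Bi M). unfold Rminus in Br, Bi.
  unfold Re, Im in *. simpl in *. lra.
Qed.

Definition coef (c d : Z) : C := Cint (summand k m c d) 0 1.

(** Uniform convergence on the segment of integration lets the integral pass to the partial sums,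
    which are finite sums of the [coef c d]. *)
Lemma fourier_coef_limit :
  Clim eventually (fun M => CZ M (fun c => CZ M (coef c)))
    (fourier_coef (Poincare k m 1) 1).
Proof.
  destruct Poincare_approx as [tau [Ht B]].
  set (D := fun M x => CZ M (fun c => CZ M (fun d => summand k m c d x))).
  assert (CD : forall M, Ccont (D M) /\ Cint (D M) 0 1 = CZ M (fun c => CZ M (coef c))).
  { intros M.
    destruct (Cint_CZ M (fun c x => CZ M (fun d => summand k m c d x)) 0 1) as [H1 H2].
    - intros c. apply (Cint_CZ M (summand k m c) 0 1). intros d. now apply Ccont_summand.
    - split; [exact H1|]. unfold D. rewrite H2. apply CZ_ext. intros c.
      apply (Cint_CZ M (summand k m c) 0 1). intros d. now apply Ccont_summand. }
  set (g := fun x : R => Cmult (Poincare k m 1 (x, 1)) (wave x)).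
  assert (Bg : forall M x, 0 <= x <= 1 -> Cmod (Cminus (D M x) (g x)) <= exp (2 * PI) * tau M).
  { intros M x Hx. unfold D, g.
    replace (CZ M (fun c => CZ M (fun d => summand k m c d x))) with
      (Cmult (poinc_partial k m 1 M (x, 1)) (wave x)).
    - replace (Cminus _ _) with (Cmult (Cminus (poinc_partial k m 1 M (x, 1))
        (Poincare k m 1 (x, 1))) (wave x)) by ring.
      rewrite Cmod_mult, Cmod_wave, Rmult_comm. apply Rmult_le_compat_l; [left; apply exp_pos|].
      now apply B.
    - rewrite poinc_partial_CZ, <- CZ_mult_r. apply CZ_ext. intros c. now rewrite <- CZ_mult_r. }
  assert (Lt : is_lim_seq (fun M => exp (2 * PI) * tau M) 0).
  { replace (Finite 0) with (Rbar_mult (exp (2 * PI)) 0) by (simpl; f_equal; ring).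
    now apply is_lim_seq_scal_l. }
  assert (Lr : is_lim_seq (fun M => RInt (fun x => Re (D M x)) 0 1) (RInt (fun x => Re (g x)) 0 1)).
  { apply (RInt_uniform_limit (fun M x => Re (D M x)) _ (fun M => exp (2 * PI) * tau M)); [| |easy].
    - intros M. apply (CD M).
    - intros M x Hx. eapply Rle_trans; [|now apply (Bg M x)].
      apply (re_le_Cmod (Cminus (D M x) (g x))). }
  assert (Li : is_lim_seq (fun M => RInt (fun x => Im (D M x)) 0 1) (RInt (fun x => Im (g x)) 0 1)).
  { apply (RInt_uniform_limit (fun M x => Im (D M x)) _ (fun M => exp (2 * PI) * tau M)); [| |easy].
    - intros M. apply (CD M).
    - intros M x Hx. eapply Rle_trans; [|now apply (Bg M x)].
      apply (im_le_Cmod (Cminus (D M x) (g x))). }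
  assert (EF : fourier_coef (Poincare k m 1) 1 = Cint g 0 1).
  { unfold fourier_coef. fold (Cint (fun x => Cmult (Poincare k m 1 (x, 1))
      (cexp2pi (Cmult (Copp (RtoC (INR 1))) (x, 1)))) 0 1).
    apply Cint_ext. intros x _. unfold g, wave. do 2 f_equal.
    apply injective_projections; simpl; ring. }
  rewrite EF.
  apply is_lim_seq_spec in Lr. apply is_lim_seq_spec in Li. intros eps He.
  generalize (filter_and (F := eventually) _ _ (Lr (mkposreal (eps / 2) ltac:(lra)))
    (Li (mkposreal (eps / 2) ltac:(lra)))).
  apply filter_imp. intros M [H1 H2]. rewrite <- (proj2 (CD M)).
  change (Rabs (Re (Cminus (Cint (D M) 0 1) (Cint g 0 1))) < eps / 2) in H1.
  change (Rabs (Im (Cminus (Cint (D M) 0 1) (Cint g 0 1))) < eps / 2) in H2.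
  eapply Rle_lt_trans; [apply Cmod_le_abs|]. lra.
Qed.

Lemma coef_opp (c d : Z) : coef (- c) (- d) = coef c d.
Proof. apply Cint_ext. intros x _. now apply summand_opp. Qed.

Lemma CZ_opp (M : nat) (g : Z -> C) : CZ M (fun d => g (- d)%Z) = CZ M g.
Proof.
  induction M as [|M IH]; [easy|]. cbn [CZ]. rewrite IH, Z.opp_involutive. ring.
Qed.

Lemma row_opp (M : nat) (c : Z) : CZ M (coef (- c)) = CZ M (coef c).
Proof.
  rewrite <- CZ_opp. apply CZ_ext. intros d. apply coef_opp.
Qed.

Lemma CZ_even (M : nat) (g : Z -> C) : (forall c, g (- c)%Z = g c) ->
  CZ M g = Cplus (g 0%Z) (Cmult (RtoC 2) (Csum (fun i => g (Z.of_nat (S i))) M)).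
Proof.
  intros E. induction M as [|M IH]; cbn [CZ Csum]; [ring|].
  rewrite IH, E. replace (RtoC 2) with (Cplus (RtoC 1) (RtoC 1)); [ring|].
  apply injective_projections; simpl; ring.
Qed.

Lemma coef_bound (c d : Z) : Cmod (coef c d) <= 12 * exp (2 * PI) * (ud c * ud d).
Proof.
  set (K := 6 * exp (2 * PI) * (ud c * ud d)).
  replace (12 * exp (2 * PI) * (ud c * ud d)) with (2 * (K * 1 - K * 0)) by (unfold K; ring).
  apply (Cint_bound (summand k m c d) (fun x => K * x) (fun _ => K)); [lra|now apply Ccont_summand| |].
  - intros x _. evar_last; [apply (is_derive_scal (fun y => y)), is_derive_id|].
    unfold one; simpl; ring.
  - intros x Hx. now apply summand_bound.
Qed.

Lemma CZ_bound (M : nat) (g : Z -> C) (v : Z -> R) : (forall d, Cmod (g d) <= v d) ->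
  Cmod (CZ M g) <= RZ M v.
Proof.
  intros B. induction M as [|M IH]; cbn [CZ RZ]; [apply B|].
  eapply Rle_trans; [apply Cmod_triangle|]. apply Rplus_le_compat; [easy|].
  eapply Rle_trans; [apply Cmod_triangle|]. now apply Rplus_le_compat.
Qed.

(** Uniformity in M is the point: together with the summable factor ud c it allows the limit to be
    taken row by row. 60 is 12 times the bound 5 for the sum of [ud]. *)
Lemma row_bound (M : nat) (c : Z) : Cmod (CZ M (coef c)) <= 60 * exp (2 * PI) * ud c.
Proof.
  eapply Rle_trans; [apply CZ_bound with (v := fun d => 12 * exp (2 * PI) * ud c * ud d)|].
  - intros d. rewrite Rmult_assoc. apply coef_bound.
  - rewrite RZ_scal. pose proof (RZ_ud_le_5 M). pose proof (ud_pos c). pose proof (exp_pos (2 * PI)).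
    assert (0 < exp (2 * PI) * ud c) by nra. nra.
Qed.

End Coefficient.

(** Tannery's theorem, reduced to a bound on the limit. The majorant is given as differences of
    1/(i+1), so the tail after n terms is at most B/(n+1) for every M >= n. *)
Lemma tannery_bound (r : nat -> nat -> C) (A : nat -> C) (l : C) (B s : R) : 0 <= B ->
  (forall i, Clim eventually (fun M => r M i) (A i)) ->
  (forall M i, Cmod (r M i) <= B * (/ INR (i + 1) - / INR (i + 2))) ->
  (forall n, Cmod (Csum A n) <= s) ->
  Clim eventually (fun M => Csum (r M) M) l -> Cmod l <= s.
Proof.
  intros HB HA Hr HS Hl.
  assert (Hd : forall n, Cmod l <= s + B * / INR (n + 1)).
  { intros n.
    assert (H : Cmod (Cminus l (Csum A n)) <= B * / INR (n + 1)).
    { apply (Clim_bound eventually (fun M => Cminus (Csum (r M) M) (Csum (r M) n))).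
      - apply (Clim_minus eventually); [easy|].
        now apply (Clim_Csum eventually (fun i M => r M i)).
      - exists n. intros M HM.
        assert (E : forall j, Cmod (Cminus (Csum (r M) (n + j)) (Csum (r M) n)) <=
          B * (/ INR (n + 1) - / INR (n + j + 1))).
        { induction j as [|j IH].
          - rewrite Nat.add_0_r. replace (Cminus _ _) with (RtoC 0) by ring. rewrite Cmod_0.
            lra.
          - rewrite Nat.add_succ_r. cbn [Csum].
            replace (Cminus (Cplus _ _) _) with (Cplus (Cminus (Csum (r M) (n + j)) (Csum (r M) n))
              (r M (n + j)%nat)) by ring.
            eapply Rle_trans; [apply Cmod_triangle|]. specialize (Hr M (n + j)%nat).
            replace (S (n + j) + 1)%nat with (n + j + 2)%nat by lia. lra. }
        specialize (E (M - n)%nat). replace (n + (M - n))%nat with M in E by lia.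
        assert (0 < / INR (M + 1)) by (apply Rinv_0_lt_compat, lt_0_INR; lia). nra. }
    pose proof (Cmod_triangle (Cminus l (Csum A n)) (Csum A n)) as H'.
    replace (Cplus (Cminus l (Csum A n)) (Csum A n)) with l in H' by ring.
    specialize (HS n). lra. }
  apply (is_lim_seq_le (fun _ => Cmod l) (fun n => s + B * / INR (n + 1)) (Cmod l) s); [easy| |].
  - apply is_lim_seq_const.
  - replace (Finite s) with (Rbar_plus s (B * 0)) by (simpl; f_equal; ring).
    apply is_lim_seq_plus'; [apply is_lim_seq_const|].
    apply (is_lim_seq_scal_l _ B (Finite 0)).
    replace (Finite 0) with (Rbar_inv p_infty) by easy.
    apply is_lim_seq_inv; [|easy].
    apply is_lim_seq_ext with (fun n => INR (S n)).
    { intros n. f_equal. lia. }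
    apply (is_lim_seq_incr_1 INR), is_lim_seq_INR.
Qed.

(** * The dominant term *)

(** The integral of e((m-1)z) over one period, i.e. the Kronecker delta of m and 1 when m >= 1; it
    comes from c = 0. *)
Definition central (m : nat) : C :=
  Cint (fun x => Cmult (cexp2pi (Cmult (RtoC (INR m)) (x, 1))) (wave x)) 0 1.

Lemma central_1 : central 1 = RtoC 1.
Proof.
  unfold central. rewrite (Cint_ext _ (fun _ => RtoC 1)).
  - unfold Cint. simpl. rewrite !RInt_const. unfold scal; simpl; unfold mult; simpl.
    apply injective_projections; simpl; ring.
  - intros x _. unfold wave. rewrite <- cexp2pi_plus, <- cexp2pi_0. f_equal.
    apply injective_projections; simpl; ring.
Qed.

(** With a = m - 1 > 0, e(az)/(2 pi i a) is an antiderivative of period 1, so its values at both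
    ends cancel. *)
Lemma central_ge_2 (m : nat) : (2 <= m)%nat -> central m = RtoC 0.
Proof.
  intros Hm. destruct m as [|n]; [lia|]. set (a := RtoC (INR n)).
  assert (Hn : 0 < INR n) by (apply lt_0_INR; lia).
  pose proof PI_RGT_0 as Hpi.
  assert (Ha : Cmult (0, 2 * PI) a <> RtoC 0).
  { intros E. apply (f_equal Im) in E. unfold a, Im in E. simpl in E. nra. }
  set (F := fun x : R => cexp2pi (Cmult a (x, 1))).
  assert (DF : forall x, Cder F x (Cmult (Cmult (0, 2 * PI) a) (F x))).
  { intros x. unfold F.
    replace (Cmult (0, 2 * PI) a) with (Cmult (0, 2 * PI)
      (Cplus (Cmult (RtoC 0) (x, 1)) (Cmult a (RtoC 1)))) by ring.
    apply (Cder_cexp2pi (fun y => Cmult a (y, 1))).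
    apply (Cder_mult (fun _ => a) (fun y => (y, 1))); [apply Cder_const|apply Cder_line]. }
  set (G := fun x => Cmult (Cinv (Cmult (0, 2 * PI) a)) (F x)).
  unfold central. rewrite (Cint_ext _ F).
  - rewrite (Cint_derive G F).
    + unfold G, F.
      replace (Cmult a (1, 1)) with (Cplus (Cmult a (0, 1)) (RtoC (IZR (Z.of_nat n)))).
      * rewrite cexp2pi_plus, cexp2pi_Z. ring.
      * rewrite <- INR_IZR_INZ. unfold a. apply injective_projections; simpl; ring.
    + intros x.
      replace (F x) with (Cplus (Cmult (RtoC 0) (F x))
        (Cmult (Cinv (Cmult (0, 2 * PI) a)) (Cmult (Cmult (0, 2 * PI) a) (F x)))).
      * apply (Cder_mult (fun _ => Cinv (Cmult (0, 2 * PI) a)) F); [apply Cder_const|apply DF].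
      * rewrite Cmult_assoc, Cinv_l by easy. ring.
    + apply Cder_cont with (1 := DF).
  - intros x _. unfold wave, F. rewrite <- cexp2pi_plus. f_equal. rewrite S_INR. unfold a.
    apply injective_projections; simpl; ring.
Qed.

(** Only d = 1 and d = -1 contribute, and [S M] guarantees that both are in range. *)
Lemma row_0 (k m M : nat) : Nat.Even k ->
  CZ (S M) (coef k m 0) = Cmult (RtoC 2) (central m).
Proof.
  intros Hev.
  assert (E : forall d, coef k m 0 d = if Z.eqb (Z.abs d) 1 then central m else RtoC 0).
  { intros d. unfold coef. rewrite (Cint_ext _ _ 0 1 (fun x _ => summand_0_l k m d x Hev)).
    destruct (Z.eqb (Z.abs d) 1); [easy|].
    unfold Cint. simpl. rewrite !RInt_const. unfold scal; simpl; unfold mult; simpl.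
    apply injective_projections; simpl; ring. }
  induction M as [|M IH].
  - cbn [CZ]. rewrite !E. simpl.
    replace (RtoC 2) with (Cplus (RtoC 1) (RtoC 1)) by (apply injective_projections; simpl; ring).
    ring.
  - change (CZ (S (S M)) (coef k m 0)) with (Cplus (CZ (S M) (coef k m 0))
      (Cplus (coef k m 0 (Z.of_nat (S (S M)))) (coef k m 0 (- Z.of_nat (S (S M)))%Z))).
    rewrite IH, !E.
    replace (Z.abs (Z.of_nat (S (S M))) =? 1)%Z with false by (symmetry; apply Z.eqb_neq; lia).
    replace (Z.abs (- Z.of_nat (S (S M))) =? 1)%Z with false by (symmetry; apply Z.eqb_neq; lia).
    ring.
Qed.

(** With y = i + 1, two of the factors y + 1 give 1/(y(y+1)), which telescopes. The other nu - 2 are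
    each at least 2, and 2^(nu-2) = 2^nu/4. *)
Lemma inverse_power_bound (i nu : nat) : (2 <= nu)%nat ->
  / INR (i + 2) ^ nu <= 4 / 2 ^ nu * (/ INR (i + 1) - / INR (i + 2)).
Proof.
  intros Hnu. set (y := INR (i + 1)).
  assert (Ey : INR (i + 2) = y + 1) by (unfold y; rewrite <- S_INR; f_equal; lia).
  assert (Hy : 1 <= y) by (unfold y; rewrite plus_INR; simpl; pose proof (pos_INR i); lra).
  rewrite Ey. replace nu with (2 + (nu - 2))%nat by lia.
  rewrite !pow_add. set (p := (nu - 2)%nat).
  assert (H2 : 0 < 2 ^ p) by (apply pow_lt; lra).
  assert (Hp : 2 ^ p <= (y + 1) ^ p) by (apply pow_incr; lra).
  rewrite Rinv_mult.
  replace (4 / (2 ^ 2 * 2 ^ p) * (/ y - / (y + 1))) with (/ (y * (y + 1)) * / 2 ^ p)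
    by (field; lra).
  apply Rmult_le_compat.
  - left. apply Rinv_0_lt_compat. nra.
  - left. apply Rinv_0_lt_compat. lra.
  - apply Rinv_le_contravar; nra.
  - apply Rinv_le_contravar; lra.
Qed.

(** Raised to the eighth power, this is e^5 <= 3^5 = 243 < 256 = 2^8. *)
Lemma exp_5_8_lt_2 : exp (5 / 8) < 2.
Proof.
  apply Rnot_le_lt. intros H.
  assert (E : exp (5 / 8) ^ 8 = exp 1 ^ 5).
  { simpl. rewrite !Rmult_1_r, <- !exp_plus. f_equal. field. }
  assert (H8 : 2 ^ 8 <= exp (5 / 8) ^ 8) by (apply pow_incr; lra).
  assert (H5 : exp 1 ^ 5 <= 3 ^ 5).
  { apply pow_incr. split; [left; apply exp_pos|apply exp_le_3]. }
  lra.
Qed.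

Lemma exp_vs_pow2 : exists N, forall nu, (N <= nu)%nat -> 4 / 2 ^ nu < exp (- (5 / 8 * INR nu)).
Proof.
  pose proof exp_5_8_lt_2 as H. pose proof (exp_pos (5 / 8)) as H0.
  assert (L : is_lim_seq (fun n => (exp (5 / 8) / 2) ^ n) 0).
  { apply is_lim_seq_geom. rewrite Rabs_pos_eq; lra. }
  apply is_lim_seq_spec in L. destruct (L (mkposreal (1 / 4) ltac:(lra))) as [N HN].
  exists N. intros nu Hnu. specialize (HN nu Hnu). cbn [pos] in HN.
  rewrite Rminus_0_r in HN. apply Rabs_def2 in HN. destruct HN as [HN _].
  assert (E : exp (5 / 8) ^ nu = exp (5 / 8 * INR nu)).
  { clear. induction nu as [|n IH]; [simpl; now rewrite Rmult_0_r, exp_0|].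
    rewrite S_INR, Rmult_plus_distr_l, exp_plus, Rmult_1_r, <- IH. simpl. ring. }
  assert (H2 : 0 < 2 ^ nu) by (apply pow_lt; lra).
  rewrite exp_Ropp, <- E.
  assert (HE : 0 < exp (5 / 8) ^ nu) by (now apply pow_lt).
  unfold Rdiv in HN at 1. rewrite Rpow_mult_distr, pow_inv in HN.
  apply Rmult_lt_reg_r with (exp (5 / 8) ^ nu); [easy|]. rewrite Rinv_l by lra.
  unfold Rdiv. nra.
Qed.

(** * The row c = 1 against the rows c >= 2 *)

Section FirstCoefficient.

Variables (nu m : nat).
Hypothesis Hev : Nat.Even (S nu).
Hypothesis Hnu : (3 <= nu)%nat.
Hypothesis Hm : 16 * PI ^ 2 * INR m <= INR nu ^ 2.

Let J := hankel (S nu).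
Let phi (c : Z) : R := bessel_series nu (4 * PI ^ 2 * (INR m / IZR c ^ 2)).
(** The limit of the row c = n; the block is the Kloosterman sum S(m, 1; n). *)
Let A (n : nat) : C := Cmult (Cinv (Cpow (RtoC (IZR (Z.of_nat n))) (S nu)))
  (Cmult (block (kl_phase m (Z.of_nat n)) n 0) (Cmult J (RtoC (phi (Z.of_nat n))))).

Lemma row_tends (n : nat) : (1 <= n)%nat ->
  Clim eventually (fun M => CZ M (coef (S nu) m (Z.of_nat n))) (A n).
Proof.
  intros Hn. apply (row_limit (S nu) m n Hn).
  apply line_int_kern; [lia|]. apply Rmult_le_pos; [apply pos_INR|].
  left. apply Rinv_0_lt_compat, pow_lt. apply IZR_lt. lia.
Qed.

(** Dividing m by c^2 only decreases the Bessel argument, so the hypothesis on m serves all rows at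
    once, with the same order nu. *)
Lemma argument_bound (n : nat) : (1 <= n)%nat ->
  0 <= 4 * PI ^ 2 * (INR m / IZR (Z.of_nat n) ^ 2) /\
  4 * (4 * PI ^ 2 * (INR m / IZR (Z.of_nat n) ^ 2)) <= INR nu ^ 2.
Proof.
  intros Hn. rewrite <- INR_IZR_INZ. apply le_INR in Hn. simpl in Hn.
  pose proof (pos_INR m) as Hm0. pose proof (pow2_ge_0 PI) as Hpi.
  assert (Hi : 0 < / INR n ^ 2 <= 1).
  { split; [apply Rinv_0_lt_compat; nra|]. rewrite <- Rinv_1. apply Rinv_le_contravar; nra. }
  unfold Rdiv. assert (0 <= PI ^ 2 * INR m) by (now apply Rmult_le_pos).
  assert (0 <= PI ^ 2 * INR m * / INR n ^ 2 <= PI ^ 2 * INR m) by nra.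
  split; lra.
Qed.

(** The trivial bound n for the Kloosterman sum costs one of the nu + 1 inverse powers of n, and the
    Bessel factor is at most 1. *)
Lemma A_bound (i : nat) :
  Cmod (A (i + 2)) <= Cmod J * (4 / 2 ^ nu) * (/ INR (i + 1) - / INR (i + 2)).
Proof.
  unfold A. set (n := (i + 2)%nat).
  assert (Hn : (1 <= n)%nat) by (unfold n; lia).
  destruct (argument_bound n Hn) as [H1 H2].
  pose proof (bessel_series_upper nu _ H1 H2) as Hphi. fold (phi (Z.of_nat n)) in Hphi.
  pose proof (Cmod_block_le (kl_phase m (Z.of_nat n)) n 0 (kl_phase_le_1 m _)) as Hb.
  assert (Hp : 0 < INR n) by (apply lt_0_INR; lia).
  rewrite <- INR_IZR_INZ.
  rewrite !Cmod_mult, Cmod_inv, Cmod_pow, !Cmod_R, (Rabs_pos_eq (INR n)) by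
    (try apply Cpow_nz, RtoC_neq_0; lra).
  pose proof (inverse_power_bound i nu ltac:(lia)) as Hq. fold n in Hq.
  pose proof (Cmod_ge_0 J). pose proof (Rabs_pos (phi (Z.of_nat n))).
  pose proof (Cmod_ge_0 (block (kl_phase m (Z.of_nat n)) n 0)).
  assert (Hpow : 0 < INR n ^ nu) by (now apply pow_lt).
  apply Rle_trans with (/ INR n ^ S nu * (INR n * (Cmod J * 1))).
  - apply Rmult_le_compat_l; [left; apply Rinv_0_lt_compat; now apply pow_lt|].
    apply Rmult_le_compat; [easy| |easy|].
    + now apply Rmult_le_pos.
    + now apply Rmult_le_compat_l.
  - replace (/ INR n ^ S nu * (INR n * (Cmod J * 1))) with (Cmod J * / INR n ^ nu)
      by (simpl; field; lra).
    rewrite Rmult_assoc. now apply Rmult_le_compat_l.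
Qed.

(** Rows c and -c agree, so the coefficient is twice the sum of [central m], the row c = 1 and the
    rows c >= 2; the last are controlled by [tannery_bound] and [A_bound]. *)
Lemma main_terms_bound : Cmod (Cminus (fourier_coef (Poincare (S nu) m 1) 1)
    (Cmult (RtoC 2) (Cplus (central m) (A 1)))) <= 2 * (Cmod J * (4 / 2 ^ nu)).
Proof.
  set (row := fun M c => CZ M (coef (S nu) m c)).
  (* The outer 2 accounts for the rows c and -c, 60 exp(2 pi) is from [row_bound], and the inner 2
     from the bound for [ud]. *)
  set (B := 2 * (60 * exp (2 * PI) * 2)).
  assert (HB : 0 <= B) by (unfold B; pose proof (exp_pos (2 * PI)); lra).
  apply (tannery_bound (fun M i => Cmult (RtoC 2) (row (S M) (Z.of_nat (i + 2))))
    (fun i => Cmult (RtoC 2) (A (i + 2))) _ B); [easy| | | |].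
  - intros i. apply (Clim_scal eventually).
    apply (Clim_comp eventually eventually S (fun M => row M (Z.of_nat (i + 2)))).
    + apply eventually_subseq. intros; lia.
    + apply row_tends. lia.
  - intros M i. rewrite Cmod_mult, Cmod_R, Rabs_pos_eq by lra.
    pose proof (row_bound (S nu) m Hev ltac:(lia) (S M) (Z.of_nat (i + 2))) as Hr.
    fold (row (S M) (Z.of_nat (i + 2))) in Hr.
    assert (Hu : ud (Z.of_nat (i + 2)) <= 2 * (/ INR (i + 1) - / INR (i + 2))).
    { apply Rle_trans with (1 := ud_nat_le (i + 2) ltac:(lia)).
      set (y := INR (i + 1)).
      assert (Hy : 1 <= y) by (unfold y; rewrite plus_INR; simpl; pose proof (pos_INR i); lra).
      replace (INR (S (i + 2))) with (y + 2) by (unfold y; rewrite S_INR, !plus_INR; simpl; ring).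
      replace (INR (i + 2)) with (y + 1) by (unfold y; rewrite !plus_INR; simpl; ring).
      apply Rminus_le_0.
      replace (_ - _) with (4 * / (y * (y + 1) * (y + 2))) by (field; lra).
      apply Rmult_le_pos; [lra|]. left. apply Rinv_0_lt_compat.
      apply Rmult_lt_0_compat; nra. }
    pose proof (exp_pos (2 * PI)). unfold B. nra.
  - intros n. rewrite Csum_scal, Cmod_mult, Cmod_R, Rabs_pos_eq by lra.
    apply Rmult_le_compat_l; [lra|].
    assert (H : Cmod (Csum (fun i => A (i + 2)) n) <=
      - (Cmod J * (4 / 2 ^ nu) * / INR (n + 1)) - - (Cmod J * (4 / 2 ^ nu) * / INR (0 + 1))).
    { apply (Cmod_Csum_le _ (fun i => - (Cmod J * (4 / 2 ^ nu) * / INR (i + 1)))).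
      intros i. pose proof (A_bound i). replace (S i + 1)%nat with (i + 2)%nat by lia. lra. }
    assert (HJ : 0 <= Cmod J * (4 / 2 ^ nu)).
    { apply Rmult_le_pos; [apply Cmod_ge_0|]. left. apply Rdiv_lt_0_compat; [lra|].
      apply pow_lt; lra. }
    assert (0 < / INR (n + 1)) by (apply Rinv_0_lt_compat, lt_0_INR; lia).
    simpl INR in H at 2. rewrite Rinv_1 in H. nra.
  (* Remove the rows c = 0, 1 and -1 from the square of size S M; exactly M pairs of rows remain,
     those with c = i + 2 and its negative. *)
  - apply (Clim_ext eventually) with (fun M => Cminus (CZ (S M) (row (S M)))
      (Cmult (RtoC 2) (Cplus (central m) (row (S M) 1%Z)))).
    + intros M. rewrite CZ_even by (intros c; now apply row_opp).
      rewrite Csum_head. unfold row at 1. rewrite row_0 by easy. rewrite Csum_scal.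
      change (Z.of_nat 1) with 1%Z.
      rewrite (Csum_ext (fun i => row (S M) (Z.of_nat (S (S i))))
        (fun i => row (S M) (Z.of_nat (i + 2)))).
      * ring.
      * intros i _. f_equal. lia.
    + apply (Clim_comp eventually eventually S (fun M => Cminus (CZ M (row M))
        (Cmult (RtoC 2) (Cplus (central m) (row M 1%Z))))).
      { apply eventually_subseq. intros; lia. }
      apply (Clim_minus eventually).
      * apply fourier_coef_limit; [easy|lia].
      * apply (Clim_scal eventually), (Clim_plus eventually); [apply (Clim_const eventually)|].
        apply (row_tends 1). lia.
Qed.

Lemma A_1 : A 1 = Cmult J (RtoC (phi 1)).
Proof.
  unfold A, block. simpl Csum. change (Z.of_nat 1) with 1%Z. rewrite kl_phase_1, Cpow_1_l.
  rewrite <- RtoC_inv, Rinv_1 by lra. ring.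
Qed.

Lemma first_coefficient_neq_0 : (1 <= m)%nat ->
  J <> RtoC 0 -> Cmod J < 1 / 4 -> 4 / 2 ^ nu < exp (- (5 / 8 * INR nu)) ->
  fourier_coef (Poincare (S nu) m 1) 1 <> RtoC 0.
Proof.
  intros Hm1 HJ0 HJ Hexp Z. pose proof main_terms_bound as H. rewrite Z in H.
  replace (Cminus (RtoC 0) (Cmult (RtoC 2) (Cplus (central m) (A 1)))) with
    (Copp (Cmult (RtoC 2) (Cplus (central m) (A 1)))) in H by ring.
  rewrite Cmod_opp, Cmod_mult, Cmod_R, Rabs_pos_eq in H by lra.
  rewrite A_1 in H.
  destruct (argument_bound 1 ltac:(lia)) as [H1 H2].
  pose proof (bessel_series_lower nu _ H1 H2) as Hlow.
  pose proof (bessel_series_upper nu _ H1 H2) as Hup.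
  change (Z.of_nat 1) with 1%Z in Hlow, Hup. fold (phi 1) in Hlow, Hup.
  pose proof (proj1 (Cmod_gt_0 _) HJ0) as HJp.
  destruct (Nat.eq_dec m 1) as [E|E].
  (* For m = 1 the leading 1 wins: |1 + J phi| >= 1 - |J| > 3/4, while the other rows contribute at
     most |J| < 1/4. *)
  - rewrite E, central_1 in H at 1.
    assert (Hq : 4 / 2 ^ nu <= 1).
    { left. apply Rlt_le_trans with (1 := Hexp). rewrite <- exp_0. apply exp_monotone.
      pose proof (pos_INR nu). lra. }
    pose proof (Cmod_triangle (Cplus (RtoC 1) (Cmult J (RtoC (phi 1)))) (Copp (Cmult J (RtoC (phi 1))))) as T.
    replace (Cplus (Cplus (RtoC 1) (Cmult J (RtoC (phi 1)))) (Copp (Cmult J (RtoC (phi 1)))))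
      with (RtoC 1) in T by ring.
    rewrite Cmod_1, Cmod_opp, Cmod_mult, Cmod_R in T. nra.
  (* For m >= 2 both sides carry the factor |J| > 0, and after cancelling it the lower bound for phi
     exceeds 4/2^nu. *)
  - rewrite central_ge_2, Cplus_0_l in H by lia. rewrite Cmod_mult, Cmod_R in H.
    pose proof (Rle_abs (phi 1)). nra.
Qed.

End FirstCoefficient.

(** Used contrapositively: a non-zero coefficient exhibits a point of the line Im z = 1 where f does
    not vanish. *)
Lemma fourier_coef_of_zero (f : C -> C) (n : nat) :
  (forall x : R, f (x, 1) = RtoC 0) -> fourier_coef f n = RtoC 0.
Proof.
  intros H.
  assert (Z : RInt (fun _ => 0) 0 1 = 0) by (rewrite RInt_const; apply Rmult_0_r).
  transitivity ((RInt (fun _ => 0) 0 1, RInt (fun _ => 0) 0 1) : C); [|now rewrite Z].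
  unfold fourier_coef. f_equal; apply RInt_ext; intros x _; now rewrite H, Cmult_0_l.
Qed.

Theorem theorem1 :
  exists K0 : nat, forall k m : nat,
    Nat.Even k -> (K0 <= k)%nat -> (1 <= m)%nat ->
    INR m <= (INR k - 1) ^ 2 / (16 * PI ^ 2) ->
    vinfty_is (Poincare k m 1) 1 /\
    exists z : C, 0 < Im z /\ Poincare k m 1 z <> RtoC 0.
Proof.
  destruct hankel_small as [s0 Hs0]. destruct exp_vs_pow2 as [N HN].
  (* s0 makes |J| < 1/4, N makes 4/2^nu smaller than the Bessel bound, and 8 is where J is known to
     be non-zero; since nu = k - 1, the 8 also keeps nu >= N and nu >= 3. *)
  exists (s0 + N + 8)%nat. intros k m Hev Hk Hm Hle.
  destruct k as [|nu]; [lia|].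
  assert (HF : fourier_coef (Poincare (S nu) m 1) 1 <> RtoC 0).
  { apply first_coefficient_neq_0; try easy; try lia.
    - rewrite S_INR in Hle. replace (INR nu + 1 - 1) with (INR nu) in Hle by ring.
      assert (Hpi : 0 < 16 * PI ^ 2).
      { apply Rmult_lt_0_compat; [lra|]. apply pow_lt, PI_RGT_0. }
      apply Rmult_le_compat_l with (r := 16 * PI ^ 2) in Hle; [|lra].
      replace (16 * PI ^ 2 * (INR nu ^ 2 / (16 * PI ^ 2))) with (INR nu ^ 2) in Hle
        by (field; apply PI_neq0). easy.
    - apply hankel_neq_0. lia.
    - apply Hs0. lia.
    - apply HN. lia. }
  split.
  - split; [lia|]. split; [exact HF|]. intros j Hj. lia.
  - apply NNPP. intros Hno. apply HF. apply fourier_coef_of_zero. intros x.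
    apply NNPP. intros Hx. apply Hno. exists (x, 1). split; [simpl; lra|exact Hx].
Qed.
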